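(* Let $n=2$, $m>0$, $k>0$, $f(x)=\frac m2x^2+k$, and $\Omega=\{(x_1,x_2)\in\mathbb{R}^2: |x_2|<f(x_1)\}$, with outward unit normal $\vec{\mathbf n}$. Let $r(a)=\left(\frac a2+\frac{k}{ma}\right)\sqrt{m^2a^2+1}$ for $a>0$ and $r_{\min}=\inf\{r(a):a>0\}>0$. Let $c(x)=c$ be a constant forcing with $c\in(0,r_{\min}^{-1})$, and let $0<a_1<a_2$ be the two solutions of $r(a)=\frac1c$. For $a>0$ let $U(a)\subset\Omega$ be the region defined in the context. Let $\theta\in(0,1)$ and let $u\in C(\overline\Omega\times[0,\infty))$ be the solution (in the sense for unbounded $\Omega$ described in the context) of $$\begin{cases} u_t=|Du|\,\mathrm{div}\left(\frac{Du}{|Du|}\right)+c|Du| & \text{in }\Omega\times(0,\infty),\\ \frac{\partial u}{\partial\vec{\mathbf n}}=0 & \text{on }\partial\Omega\times[0,\infty),\\ u(x,0)=u_0(x) & \text{on }\overline\Omega,\end{cases}$$ where the initial data $u_0\in C^{2,\theta}(\overline\Omega)$ satisfies $\frac{\partial u_0}{\partial\vec{\mathbf n}}=0$ on $\partial\Omega$ and there exist constants $l_1\in(0,a_1)$, $l_2\in(0,a_2-a_1)$, $\alpha<\beta$ such that $$u_0(x)=\begin{cases}\beta & \text{for } x\in U(a_1-l_1),\\ \alpha & \text{for } x\in\overline\Omega\setminus\overline{U(a_1+l_2)},\end{cases}\qquad\text{and}\quad \alpha\le u_0\le\beta .$$ Then $$\lim_{t\to\infty}u(x,t)=\begin{cases}\beta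 & \text{if } x\in U(a_1),\\ \alpha & \text{if } x\in\overline\Omega\setminus\overline{U(a_1)}.\end{cases}$$
   Context: The sets $U(a)$. For $a>0$ put $p(a)=\left(\frac a2-\frac{k}{ma},0\right)$ and $X(a,\vartheta)=(X_1(a,\vartheta),X_2(a,\vartheta))=p(a)+r(a)(\cos\vartheta,\sin\vartheta)$ for $|\vartheta|<\arctan(ma)$. This is a circular arc of radius $r(a)$ meeting $\partial\Omega$ perpendicularly at $(a,\pm f(a))$. Then $$U(a)=\{(x_1,x_2)\in\Omega: |x_1|<X_1(a,\vartheta),\ |x_2|<X_2(a,\vartheta)\text{ for some }\vartheta\text{ with }|\vartheta|<\arctan(ma)\},$$ i.e. $U(a)$ is the part of $\Omega$ lying between the arc $X(a,\cdot)$ and its reflection in the $x_2$-axis. The function $r$ is strictly decreasing and then strictly increasing on $(0,\infty)$, tends to $\infty$ at $0$ and at $\infty$, so $r(a)=1/c$ has exactly two solutions when $0<c<1/r_{\min}$. Solutions on the unbounded domain. Let $R_0>0$ be a sufficiently large constant and let $\widetilde\Omega\subset\mathbb{R}^2$ be a bounded $C^{2,\theta}$ domain with $\Omega\cap B(0,R_0)\subset\widetilde\Omega\subset\Omega$. One says that $u$ is a solution of the problem on $\overline\Omega\times[0,\infty)$ if there exists $\alpha\in\mathbb{R}$ such that $u-\alpha=u_0-\alpha=0$ on $(\overline\Omega\setminus B(0,R_0))\times[0,\infty)$, and $u$ is a viscosity solution of the problem with $\widetilde\Omega$ in place of $\Omega$. Viscosity solutions (on a bounded domain, still denoted $\Omega$).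 Let $\mathcal S^n$ be the set of real symmetric $n\times n$ matrices, $F(x,p,X)=\mathrm{trace}\left(\left(I-\frac{p\otimes p}{|p|^2}\right)X\right)+c|p|$ for $p\ne0$, and let $F_*,F^*$ be its lower and upper semicontinuous envelopes on $\overline\Omega\times\mathbb{R}^n\times\mathcal S^n$. An upper semicontinuous $u:\overline\Omega\times[0,\infty)\to\mathbb{R}$ is a viscosity subsolution if $u(\cdot,0)\le u_0$ and, for any $\varphi\in C^2(\overline\Omega\times[0,\infty))$, whenever $(\hat x,\hat t)\in\overline\Omega\times(0,\infty)$ is a maximizer of $u-\varphi$: if $\hat x\in\Omega$ then $\varphi_t-F^*(\hat x,D\varphi,D^2\varphi)\le 0$ at $(\hat x,\hat t)$; if $\hat x\in\partial\Omega$ then $\min\{\varphi_t-F^*(\hat x,D\varphi,D^2\varphi),\frac{\partial\varphi}{\partial\vec{\mathbf n}}\}\le 0$. A lower semicontinuous $u$ is a viscosity supersolution if $u(\cdot,0)\ge u_0$ and, for any such $\varphi$, whenever $(\hat x,\hat t)\in\overline\Omega\times(0,\infty)$ is a minimizer of $u-\varphi$: if $\hat x\in\Omega$ then $\varphi_t-F_*(\hat x,D\varphi,D^2\varphi)\ge 0$; if $\hat x\in\partial\Omega$ then $\max\{\varphi_t-F_*(\hat x,D\varphi,D^2\varphi),\frac{\partial\varphi}{\partial\vec{\mathbf n}}\}\ge 0$. A continuous function is a viscosity solution if it is both. Existence, uniqueness and the comparison principle are well known on bounded $C^{2,\theta}$ domains. *)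

(* Defs.v *)
From mathcomp Require Import all_boot all_order all_algebra.
From mathcomp Require Import all_classical all_reals all_analysis.

Set Implicit Arguments.
Unset Strict Implicit.
Unset Printing Implicit Defensive.

Import Order.TTheory GRing.Theory Num.Theory.
Import numFieldNormedType.Exports.

Local Open Scope classical_set_scope.
Local Open Scope ring_scope.

(* [enorm] is needed because the library norm of ['rV[R]_n] is the sup norm. *)

Definition dot (R : realType) (n : nat) (x y : 'rV[R]_n) : R := (x *m y^T) 0 0.

Definition enorm (R : realType) (n : nat) (x : 'rV[R]_n) : R :=
  Num.sqrt (dot x x).

Definition eball (R : realType) (n : nat) (x : 'rV[R]_n) (r : R) :
  set 'rV[R]_n := [set y | enorm (y - x) < r].

Definition evec (R : realType) (n : nat) (i : 'I_n) : 'rV[R]_n :=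
  delta_mx 0 i.

(* A function belongs to C^k(closure A) when it is C^k in A and its derivatives
   of order <= k extend continuously to the closure of A.  [closure_ext A g] is
   the extension of [g]; it agrees with [g] at the points of [A] where [g] is
   continuous.  The space is meant to be finite-dimensional, so that it is
   enough to consider directional derivatives. *)

Definition closure_ext (R : realType) (V : normedModType R) (A : set V) (g : V -> R)
  (x : V) : R := lim (g @ within A (nbhs x)).

Definition extends_to_closure (R : realType) (V : normedModType R)
  (A : set V) (g : V -> R) : Prop :=
  forall x, closure A x -> cvg (g @ within A (nbhs x)).

Definition C2_closure (R : realType) (V : normedModType R) (A : set V)
  (f : V -> R) : Prop :=
  [/\ {within closure A, continuous f},
      forall v x, A x -> derivable f x v,
      forall v, extends_to_closure A ('D_v f),
      forall v w x, A x -> derivable ('D_v f) x w &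
      forall v w, extends_to_closure A ('D_w ('D_v f))].

Definition holder (R : realType) (V : normedModType R) (theta : R) (A : set V)
  (g : V -> R) : Prop :=
  exists C : R, forall x y, A x -> A y -> `|g x - g y| <= C * `|x - y| `^ theta.

Definition C2theta_closure (R : realType) (V : normedModType R) (theta : R)
  (A : set V) (f : V -> R) : Prop :=
  C2_closure A f /\ forall v w, holder theta A ('D_w ('D_v f)).

Definition grad_closure (R : realType) (n : nat) (A : set 'rV[R]_n)
  (f : 'rV[R]_n -> R) (x : 'rV[R]_n) : 'rV[R]_n :=
  \row_i closure_ext A ('D_(evec R i) f) x.

Definition frontier (R : realType) (n : nat) (A : set 'rV[R]_n) :
  set 'rV[R]_n := closure A `\` interior A.

(* In the orthonormal coordinates (y_0, y') = (x - x0) Q, the set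
   {graph_fun < 0} is the epigraph {y_0 > gamma(y')}. *)
Definition graph_fun (R : realType) (n : nat) (x0 : 'rV[R]_n.+1)
  (Q : 'M[R]_n.+1) (gamma : 'rV[R]_n -> R) (x : 'rV[R]_n.+1) : R :=
  let y : 'rV[R]_(1 + n) := (x - x0) *m Q in gamma (rsubmx y) - y 0 0.

Definition graph_chart (R : realType) (n : nat) (A : set 'rV[R]_n.+1)
  (x0 : 'rV[R]_n.+1) (Q : 'M[R]_n.+1) (gamma : 'rV[R]_n -> R) : Prop :=
  Q *m Q^T = 1%:M /\
  \forall x \near x0, A x <-> graph_fun x0 Q gamma x < 0.

Definition C2theta_domain (R : realType) (n : nat) (theta : R)
  (A : set 'rV[R]_n.+1) : Prop :=
  [/\ open A, connected A, A !=set0 &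
      forall x0, frontier A x0 -> exists Q gamma,
        graph_chart A x0 Q gamma /\ C2theta_closure theta setT gamma].

(* Near x0 the set is {graph_fun < 0}, so the gradient of [graph_fun], which
   never vanishes, points outwards. *)
Definition outward_unit_normal (R : realType) (n : nat) (A : set 'rV[R]_n.+1)
  (x0 nu : 'rV[R]_n.+1) : Prop :=
  exists Q gamma,
    [/\ graph_chart A x0 Q gamma, C2_closure setT gamma &
        let g := \row_i 'D_(evec R i) (graph_fun x0 Q gamma) x0 in
        nu = (enorm g)^-1 *: g].

Definition Fop (R : realType) (n : nat) (c : R)
  (z : 'rV[R]_n * 'rV[R]_n * 'M[R]_n) : R :=
  let: (x, p, X) := z in
  \tr ((1%:M - (enorm p ^+ 2)^-1 *: (p^T *m p)) *m X) + c * enorm p.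

(* The part of (closure A) x R^n x S^n where [Fop] is defined. *)
Definition F_dom (R : realType) (n : nat) (A : set 'rV[R]_n) :
  set ('rV[R]_n * 'rV[R]_n * 'M[R]_n) :=
  [set z | [/\ closure A z.1.1, z.1.2 != 0 & z.2^T = z.2]].

(* Semicontinuous envelopes: limsup and liminf of [Fop] over [F_dom], the base
   point itself not being excluded. *)
Definition F_upper (R : realType) (n : nat) (A : set 'rV[R]_n) (c : R)
  (x p : 'rV[R]_n) (X : 'M[R]_n) : \bar R :=
  limf_esup (fun z => (Fop c z)%:E) (within (F_dom A) (nbhs (x, p, X))).

Definition F_lower (R : realType) (n : nat) (A : set 'rV[R]_n) (c : R)
  (x p : 'rV[R]_n) (X : 'M[R]_n) : \bar R :=
  limf_einf (fun z => (Fop c z)%:E) (within (F_dom A) (nbhs (x, p, X))).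

Definition cyl (R : realType) (n : nat) (A : set 'rV[R]_n) :
  set ('rV[R]_n * R) := A `*` [set t | 0 < t].

Definition cyl_bar (R : realType) (n : nat) (A : set 'rV[R]_n) :
  set ('rV[R]_n * R) := closure A `*` [set t | 0 <= t].

(* [dt], [Dx] and [Dxx] are derivatives of phi extended to the closed cylinder;
   the boundary conditions evaluate these extensions. *)
Definition dt (R : realType) (n : nat) (A : set 'rV[R]_n)
  (phi : 'rV[R]_n * R -> R) (z : 'rV[R]_n * R) : R :=
  closure_ext (cyl A) ('D_((0, 1) : 'rV[R]_n * R) phi) z.

Definition Dx (R : realType) (n : nat) (A : set 'rV[R]_n)
  (phi : 'rV[R]_n * R -> R) (z : 'rV[R]_n * R) : 'rV[R]_n :=
  \row_i closure_ext (cyl A) ('D_((evec R i, 0) : 'rV[R]_n * R) phi) z.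

Definition Dxx (R : realType) (n : nat) (A : set 'rV[R]_n)
  (phi : 'rV[R]_n * R -> R) (z : 'rV[R]_n * R) : 'M[R]_n :=
  \matrix_(i, j) closure_ext (cyl A)
    ('D_((evec R j, 0) : 'rV[R]_n * R)
       ('D_((evec R i, 0) : 'rV[R]_n * R) phi)) z.

Definition lsc_on (R : realType) (T : topologicalType) (A : set T)
  (u : T -> R) : Prop :=
  lower_semicontinuous (fun z : subspace A => (u z)%:E).

Definition usc_on (R : realType) (T : topologicalType) (A : set T)
  (u : T -> R) : Prop := lsc_on A (fun z => - u z).

Definition viscosity_subsolution (R : realType) (n : nat)
  (A : set 'rV[R]_n.+1) (c : R) (u0 : 'rV[R]_n.+1 -> R)
  (u : 'rV[R]_n.+1 * R -> R) : Prop :=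
  [/\ usc_on (cyl_bar A) u,
      forall x, closure A x -> u (x, 0) <= u0 x &
      forall phi : 'rV[R]_n.+1 * R -> R, C2_closure (cyl A) phi ->
      forall x t, closure A x -> 0 < t ->
      (forall z, cyl_bar A z -> u z - phi z <= u (x, t) - phi (x, t)) ->
      let E := ((dt A phi (x, t))%:E
                - F_upper A c x (Dx A phi (x, t)) (Dxx A phi (x, t)))%E in
      (A x -> (E <= 0)%E) /\
      (frontier A x -> forall nu, outward_unit_normal A x nu ->
        (Order.min E (dot (Dx A phi (x, t)) nu)%:E <= 0)%E)].

Definition viscosity_supersolution (R : realType) (n : nat)
  (A : set 'rV[R]_n.+1) (c : R) (u0 : 'rV[R]_n.+1 -> R)
  (u : 'rV[R]_n.+1 * R -> R) : Prop :=
  [/\ lsc_on (cyl_bar A) u,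
      forall x, closure A x -> u0 x <= u (x, 0) &
      forall phi : 'rV[R]_n.+1 * R -> R, C2_closure (cyl A) phi ->
      forall x t, closure A x -> 0 < t ->
      (forall z, cyl_bar A z -> u (x, t) - phi (x, t) <= u z - phi z) ->
      let E := ((dt A phi (x, t))%:E
                - F_lower A c x (Dx A phi (x, t)) (Dxx A phi (x, t)))%E in
      (A x -> (0 <= E)%E) /\
      (frontier A x -> forall nu, outward_unit_normal A x nu ->
        (0 <= Order.max E (dot (Dx A phi (x, t)) nu)%:E)%E)].

Definition viscosity_solution (R : realType) (n : nat)
  (A : set 'rV[R]_n.+1) (c : R) (u0 : 'rV[R]_n.+1 -> R)
  (u : 'rV[R]_n.+1 * R -> R) : Prop :=
  [/\ {within cyl_bar A, continuous u},
      viscosity_subsolution A c u0 u & viscosity_supersolution A c u0 u].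

Definition truncation (R : realType) (n : nat) (theta : R)
  (A : set 'rV[R]_n.+1) (R0 : R) (B : set 'rV[R]_n.+1) : Prop :=
  [/\ C2theta_domain theta B, bounded_set B, A `&` eball 0 R0 `<=` B &
      B `<=` A].

Definition unbounded_solution (R : realType) (n : nat)
  (A : set 'rV[R]_n.+1) (R0 : R) (B : set 'rV[R]_n.+1) (c : R)
  (u0 : 'rV[R]_n.+1 -> R) (u : 'rV[R]_n.+1 * R -> R) : Prop :=
  [/\ {within cyl_bar A, continuous u},
      exists alpha : R, forall x t, closure A x -> ~ eball 0 R0 x -> 0 <= t ->
        u (x, t) - alpha = 0 /\ u0 x - alpha = 0 &
      viscosity_solution B c u0 u].

Definition x1 (R : realType) (x : 'rV[R]_2) : R := x 0 0.
Definition x2 (R : realType) (x : 'rV[R]_2) : R := x 0 1.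

Definition fprofile (R : realType) (m k : R) (x : R) : R := m / 2 * x ^+ 2 + k.

Definition Omega (R : realType) (m k : R) : set 'rV[R]_2 :=
  [set x | `|x2 x| < fprofile m k (x1 x)].

Definition arc_radius (R : realType) (m k a : R) : R :=
  (a / 2 + k / (m * a)) * Num.sqrt (m ^+ 2 * a ^+ 2 + 1).

Definition rmin (R : realType) (m k : R) : R :=
  inf [set arc_radius m k a | a in [set a | 0 < a]].

Definition X1 (R : realType) (m k a vt : R) : R :=
  a / 2 - k / (m * a) + arc_radius m k a * cos vt.

Definition X2 (R : realType) (m k a vt : R) : R := arc_radius m k a * sin vt.

Definition Uarc (R : realType) (m k a : R) : set 'rV[R]_2 :=
  [set x | Omega m k x /\ exists vt : R,
     [/\ `|vt| < atan (m * a), `|x1 x| < X1 m k a vt & `|x2 x| < X2 m k a vt]].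

(* Main.v *)
(* The unstable behaviour at [a2] is never reached: for [a < a1] the arc of radius
   [r(a) > 1/c] moves outwards with speed [c - 1/r(a)], and for [a1 < a < a2] it moves
   inwards, so that [U(a1)] attracts both the region where [u0 = beta] and the one
   where [u0 = alpha].  This is turned into a proof without the comparison principle
   for viscosity solutions: a smooth strict barrier can itself be used as a test
   function, so it suffices to rule out contact points.  The barrier is
   [beta' - K (G + e)_+^3], where the level set [G = 0] is a circular arc through
   [(a(t), f (a(t)))] and [a(t)] moves slowly from [a0] to [A], both on the same side
   of [a1].  Moving the centre of the arc by a small [d] makes it meet the boundary of
   [Omega] with an angle different from [pi/2], which gives the strict sign of the
   normal derivative; the slack in [r(a) <> 1/c] pays for this and for the motion of
   [a(t)].  The upper and the lower bounds are the same statement, for [v = u] with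
   forcing [c] and for [v = - u] with forcing [- c]. *)

Require Import Defs.
From mathcomp Require Import all_boot all_order all_algebra.
From mathcomp Require Import all_classical all_reals all_analysis.
From mathcomp Require Import ring lra zify.
Import Order.TTheory GRing.Theory Num.Theory.
Import numFieldNormedType.Exports.
Local Open Scope classical_set_scope.
Local Open Scope ring_scope.

Set Implicit Arguments.
Unset Strict Implicit.
Unset Printing Implicit Defensive.

(** The truncated domain is arbitrary outside the ball, so its normal is computable only inside, and
    every contact has to be located there: outside the ball [u] equals [alpha], while for the lower
    bound the front stays within the circle of [a2], which the ball is chosen to contain. The bounds
    [alpha <= u <= beta] follow from the same comparison with a constant barrier. They confine
    contacts with a moving barrier to [G <= 0], because [K] makes the barrier drop by [beta - alpha]
    between [G = - e] and [G = 0]. Curvature thus matters only in the layer [- e < G <= 0], where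
    the level curves of [G] are nearly circles of radius [r(a)]; composing [G] with a cube is free,
    as the operator ignores second derivatives along the gradient. For small [e] the layer avoids a
    strip around [x1 = 0], so the smoothing of the absolute value there is felt only in the boundary
    condition, where a margin of [k / 2] absorbs it. Of the slack [s0] a quarter pays for the width
    [e] and a quarter for the shift [d]; the rest leaves [s0 / 4] for the time derivative of the
    front. *)

(* Certificates of regularity: [d1 v] and [d2 v w] are the derivatives of [f] along
   [v], respectively along [v] and then [w]. *)
Definition C2R (R : realType) (f f1 f2 : R -> R) : Prop :=
  [/\ forall x, is_derive x (1 : R) f (f1 x), forall x, is_derive x (1 : R) f1 (f2 x) &
      continuous f2].

Definition C2f (R : realType) (V : normedModType R) (f : V -> R)
    (d1 : V -> V -> R) (d2 : V -> V -> V -> R) : Prop :=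
  [/\ continuous f, forall v x, is_derive x v f (d1 v x),
      forall v, continuous (d1 v),
      forall v w x, is_derive x w (d1 v) (d2 v w x) &
      forall v w, continuous (d2 v w)].

(** * Functions with explicit second derivatives *)

Lemma continuous_add (R : realType) (T : topologicalType) (f g : T -> R) :
  continuous f -> continuous g -> continuous (fun z => f z + g z).
Proof. by move=> cf cg z; apply: cvgD; [exact: cf | exact: cg]. Qed.

Lemma continuous_mul (R : realType) (T : topologicalType) (f g : T -> R) :
  continuous f -> continuous g -> continuous (fun z => f z * g z).
Proof. by move=> cf cg z; apply: cvgM; [exact: cf | exact: cg]. Qed.

Lemma continuous_opp (R : realType) (T : topologicalType) (f : T -> R) :
  continuous f -> continuous (fun z => - f z).
Proof. by move=> cf z; apply: cvgN; exact: cf. Qed.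

Lemma continuous_fun_comp (S T U : topologicalType) (f : S -> T) (g : T -> U) :
  continuous f -> continuous g -> continuous (fun z => g (f z)).
Proof. by move=> cf cg z; apply: continuous_comp; [exact: cf|exact: cg]. Qed.

Lemma continuous_fst (S T : topologicalType) : continuous (fun z : S * T => z.1).
Proof. by move=> z; exact: cvg_fst. Qed.

Lemma continuous_snd (S T : topologicalType) : continuous (fun z : S * T => z.2).
Proof. by move=> z; exact: cvg_snd. Qed.

Lemma continuous_pair (S T U : topologicalType) (f : S -> T) (g : S -> U) :
  continuous f -> continuous g -> continuous (fun z => (f z, g z)).
Proof. by move=> cf cg z; exact: cvg_pair (cf z) (cg z). Qed.

Lemma is_derive_continuous (R : realType) (f f1 : R -> R) :
  (forall x, is_derive x (1 : R) f (f1 x)) -> continuous f.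
Proof.
move=> df x; apply: differentiable_continuous; apply/derivable1_diffP.
by have [] := df x.
Qed.

Lemma C2R_continuous (R : realType) (f f1 f2 : R -> R) :
  C2R f f1 f2 -> [/\ continuous f, continuous f1 & continuous f2].
Proof.
by move=> [h1 h2 h3]; split=> //; [exact: is_derive_continuous h1 | exact: is_derive_continuous h2].
Qed.

Lemma C2R_cst (R : realType) (a : R) : C2R (fun=> a) (fun=> 0) (fun=> 0).
Proof. by split=> [x|x|]; [exact: is_derive_cst|exact: is_derive_cst|exact: cst_continuous]. Qed.

Lemma C2R_id (R : realType) : C2R (fun x : R => x) (fun=> 1) (fun=> 0).
Proof. by split=> [x|x|]; [exact: is_derive_id|exact: is_derive_cst|exact: cst_continuous]. Qed.

Lemma C2R_add (R : realType) (f f1 f2 g g1 g2 : R -> R) :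
  C2R f f1 f2 -> C2R g g1 g2 ->
  C2R (fun x => f x + g x) (fun x => f1 x + g1 x) (fun x => f2 x + g2 x).
Proof.
move=> [a1 a2 a3] [b1 b2 b3]; split=> [x|x|x].
- exact: is_deriveD.
- exact: is_deriveD.
- by apply: cvgD; [exact: a3|exact: b3].
Qed.

Lemma C2R_mul (R : realType) (f f1 f2 g g1 g2 : R -> R) :
  C2R f f1 f2 -> C2R g g1 g2 ->
  C2R (fun x => f x * g x) (fun x => f1 x * g x + f x * g1 x)
    (fun x => f2 x * g x + 2 * (f1 x * g1 x) + f x * g2 x).
Proof.
move=> hf hg; have [cf cf1 cf2] := C2R_continuous hf.
have [cg cg1 cg2] := C2R_continuous hg.
move: hf hg => [a1 a2 a3] [b1 b2 b3]; split=> [x|x|].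
- apply: (is_derive_eq (is_deriveM (a1 x) (b1 x))).
  by rewrite -![_ *: _]/(_ * _) addrC (mulrC (g x)).
- apply: (is_derive_eq (is_deriveD (is_deriveM (a2 x) (b1 x))
    (is_deriveM (a1 x) (b2 x)))).
  by rewrite -![_ *: _]/(_ * _); ring.
- apply: (continuous_add (continuous_add (continuous_mul cf2 cg) _)
    (continuous_mul cf cg2)).
  exact: (continuous_mul (@cst_continuous _ _ _) (continuous_mul cf1 cg1)).
Qed.

Lemma C2R_inv (R : realType) (f f1 f2 : R -> R) :
  (forall x, f x != 0) -> C2R f f1 f2 ->
  C2R (fun x => (f x)^-1) (fun x => - f1 x / f x ^+ 2)
    (fun x => (2 * f1 x ^+ 2 - f x * f2 x) / f x ^+ 3).
Proof.
move=> f0 hf; have [cf cf1 cf2] := C2R_continuous hf.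
move: hf => [a1 a2 a3].
have dV x : is_derive x (1 : R) (fun x => (f x)^-1) (- f1 x / f x ^+ 2).
  apply: (@is_derive_eq _ _ _ _ _ _ _ _ (is_deriveV (f0 x) (a1 x))).
  by rewrite /GRing.scale /= mulNr mulNr mulrC.
split=> [x|x|]; first exact: dV.
- have -> : (fun x => - f1 x / f x ^+ 2) =
      (- f1) * ((fun x => (f x)^-1) * (fun x => (f x)^-1)).
    by apply/funext => y; rewrite -[RHS]/(- f1 y * ((f y)^-1 * (f y)^-1)) -invfM -expr2.
  apply: (is_derive_eq (is_deriveM (is_deriveN (a2 x)) (is_deriveM (dV x) (dV x)))).
  rewrite /GRing.scale /= -![(_ * _) x]/((f x)^-1 * (f x)^-1) -[(- f1) x]/(- f1 x).
  by field; exact: f0.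
- have h n : continuous (fun x => (f x ^+ n)^-1).
    move=> x; apply: cvgV; first by rewrite expf_neq0.
    exact: continuous_comp (cf x) (@exprn_continuous _ _ _).
  apply: (continuous_mul _ (h 3)).
  apply: (continuous_add _ (continuous_opp (continuous_mul cf cf2))).
  apply: (continuous_mul (@cst_continuous _ _ _)).
  exact: continuous_fun_comp cf1 (@exprn_continuous _ _).
Qed.

(** Only a directional derivative of [g] is given, so the one-variable chain rule is applied along
    the line [s *: v + x]. *)
Lemma is_derive_comp1 (R : realType) (V : normedModType R) (h : R -> R)
    (g : V -> R) (x v : V) (a b : R) :
  is_derive (g x) (1 : R) h a -> is_derive x v g b ->
  is_derive x v (fun z => h (g z)) (a * b).
Proof.
move=> dh dg.
pose l (s : R) := g (s *: v + x).
have dl : is_derive (0 : R) (1 : R) l b.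
  split.
    by apply/(derivable1P g x v); case: dg.
  rewrite /derive; case: dg => _ <-; rewrite /derive.
  set g1 := fun h => h^-1 *: _; set g2 := fun h => h^-1 *: _.
  suff -> : g1 = g2 by [].
  rewrite funeqE /g1 /g2 => s /=.
  by rewrite /l /= addr0 [_%:A]mulr1 scale0r add0r.
have dhl : is_derive (0 : R) (1 : R) (h \o l) (a * b).
  by apply: is_derive1_comp; rewrite /l scale0r add0r.
split.
  by apply/(derivable1P _ x v); case: dhl.
rewrite /derive; case: dhl => _ <-; rewrite /derive.
set g1 := fun h => h^-1 *: _; set g2 := fun h => h^-1 *: _.
suff -> : g1 = g2 by [].
rewrite funeqE /g1 /g2 => s /=.
by rewrite /l /= addr0 [_%:A]mulr1 scale0r add0r.
Qed.

Lemma C2f_cst (R : realType) (V : normedModType R) (a : R) :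
  C2f (fun _ : V => a) (fun _ _ => 0) (fun _ _ _ => 0).
Proof.
by split=> [|v x|v|v w x|v w]; try exact: cst_continuous; exact: is_derive_cst.
Qed.

Lemma C2f_add (R : realType) (V : normedModType R) (f : V -> R) d1 d2 g e1 e2 :
  C2f f d1 d2 -> C2f g e1 e2 ->
  C2f (fun z => f z + g z) (fun v z => d1 v z + e1 v z)
    (fun v w z => d2 v w z + e2 v w z).
Proof.
move=> [cf df cd1 dd1 cd2] [cg dg ce1 de1 ce2].
split=> [|v x|v|v w x|v w].
- exact: continuous_add.
- exact: is_deriveD.
- exact: continuous_add (cd1 v) (ce1 v).
- exact: is_deriveD.
- exact: continuous_add (cd2 v w) (ce2 v w).
Qed.

Lemma C2f_mul (R : realType) (V : normedModType R) (f : V -> R) d1 d2 g e1 e2 :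
  C2f f d1 d2 -> C2f g e1 e2 ->
  C2f (fun z => f z * g z) (fun v z => d1 v z * g z + f z * e1 v z)
    (fun v w z => d2 v w z * g z + d1 v z * e1 w z
       + (d1 w z * e1 v z + f z * e2 v w z)).
Proof.
move=> [cf df cd1 dd1 cd2] [cg dg ce1 de1 ce2].
split=> [|v x|v|v w x|v w].
- exact: continuous_mul.
- apply: (is_derive_eq (is_deriveM (df v x) (dg v x))).
  by rewrite -![_ *: _]/(_ * _) addrC (mulrC (g x)).
- exact: (continuous_add (continuous_mul (cd1 v) cg) (continuous_mul cf (ce1 v))).
- apply: (is_derive_eq (is_deriveD (is_deriveM (dd1 v w x) (dg w x))
    (is_deriveM (df w x) (de1 v w x)))).
  by rewrite -![_ *: _]/(_ * _); ring.
- exact: (continuous_add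
    (continuous_add (continuous_mul (cd2 v w) cg) (continuous_mul (cd1 v) (ce1 w)))
    (continuous_add (continuous_mul (cd1 w) (ce1 v)) (continuous_mul cf (ce2 v w)))).
Qed.

Lemma C2f_comp (R : realType) (V : normedModType R) (h h1 h2 : R -> R)
    (f : V -> R) d1 d2 :
  C2R h h1 h2 -> C2f f d1 d2 ->
  C2f (fun z => h (f z)) (fun v z => h1 (f z) * d1 v z)
    (fun v w z => h2 (f z) * d1 w z * d1 v z + h1 (f z) * d2 v w z).
Proof.
move=> Hh; have [ch ch1 ch2] := C2R_continuous Hh; case: Hh => dh dh1 _.
move=> [cf df cd1 dd1 cd2].
have c1 := continuous_fun_comp cf ch1; have c2 := continuous_fun_comp cf ch2.
split=> [|v x|v|v w x|v w].
- exact: continuous_fun_comp.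
- exact: is_derive_comp1.
- exact: continuous_mul c1 (cd1 v).
- have dk : is_derive x w (fun z => h1 (f z)) (h2 (f x) * d1 w x).
    exact: is_derive_comp1.
  apply: (is_derive_eq (is_deriveM dk (dd1 v w x))).
  by rewrite -![_ *: _]/(_ * _); ring.
- exact: (continuous_add (continuous_mul (continuous_mul c2 (cd1 w)) (cd1 v))
    (continuous_mul c1 (cd2 v w))).
Qed.

Lemma C2f_linear (R : realType) (V : normedModType R) (l : V -> R) :
  (forall (a : R) u v, l (a *: u + v) = a * l u + l v) -> continuous l ->
  C2f l (fun v _ => l v) (fun _ _ _ => 0).
Proof.
move=> ll cl; split=> [//|v x|v|v w x|v w]; try exact: cst_continuous;
  last exact: is_derive_cst.
have E : (fun h : R => h^-1 *: ((l \o shift x) (h *: v) - l x)) @ 0^' --> l v.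
  apply: (@cvg_trans _ ((fun _ : R => l v) @ 0^')); last exact: cvg_cst.
  apply: near_eq_cvg; near=> h.
  have h0 : h != 0 by near: h; exact: nbhs_dnbhs_neq.
  by rewrite /= ll addrK /GRing.scale /= mulrA mulVf// mul1r.
split; first by apply/cvg_ex; exists (l v).
exact: cvg_lim.
Unshelve. all: by end_near. Qed.

Lemma C2R_linear_comb (R : realType) (a b : R) :
  C2R (fun x => a * x + b) (fun=> a) (fun=> 0).
Proof.
split=> [x|x|]; last exact: cst_continuous; last exact: is_derive_cst.
apply: (@is_derive_eq _ _ _ ((cst a * id) + cst b)).
by rewrite /GRing.scale /=; ring.
Qed.

(** The cube is the lowest integer power of the positive part that is C^2. *)
Definition pos_cube (R : realType) (x : R) : R := Num.max x 0 ^+ 3.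

Lemma C2R_pos_cube (R : realType) :
  C2R (@pos_cube R) (fun x => 3 * Num.max x 0 ^+ 2) (fun x => 6 * Num.max x 0).
Proof.
have cm : continuous (fun x : R => Num.max x 0).
  by move=> x; apply: continuous_max; [exact: cvg_id|exact: cvg_cst].
have dpow n (x : R) : is_derive x (1 : R) (fun y => Num.max y 0 ^+ n.+2)
    (n.+2%:R * Num.max x 0 ^+ n.+1).
  have [x0|x0|->] := ltgtP x 0.
  - apply: (@near_eq_is_derive _ _ _ (cst 0)); last first.
      by rewrite expr0n mulr0; exact: is_derive_cst.
    near=> y; rewrite (max_idPr _) ?expr0n//; apply/ltW; near: y.
    exact: lt_nbhsl.
  - apply: (@near_eq_is_derive _ _ _ ((id : R -> R) ^+ n.+2)); last first.
      apply: (is_derive_eq (is_deriveX n.+2 (is_derive_id x (1 : R)))).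
      by rewrite [LHS]mulr1.
    near=> y; rewrite (max_idPl _) ?fctE//; apply/ltW; near: y.
    exact: lt_nbhsr.
  (* At the kink the difference quotient is itself the positive part of [h] to the power [n.+1],
     which tends to 0. *)
  - rewrite expr0n mulr0.
    have E : (fun h : R => h^-1 *: (((fun y : R => Num.max y 0 ^+ n.+2) \o shift 0)
        (h *: (1 : R)) - Num.max (0 : R) 0 ^+ n.+2)) @ 0^' --> (0 : R).
      apply: (@cvg_trans _ ((fun h : R => Num.max h 0 ^+ n.+1) @ 0^')).
        apply: near_eq_cvg; near=> h.
        have h0 : h != 0 by near: h; exact: nbhs_dnbhs_neq.
        rewrite /= addr0 [h%:A]mulr1 maxxx expr0n subr0 /GRing.scale /=.
        have [h1|h1] := leP h 0; first by rewrite !expr0n mulr0.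
        by rewrite [in RHS]exprS mulKf.
      have ck : continuous (fun h : R => Num.max h 0 ^+ n.+1).
        exact: continuous_fun_comp cm (@exprn_continuous R n.+1).
      have := ck 0.
      by rewrite /continuous_at maxxx expr0n => /cvg_within_filter; apply.
    by split; [apply/cvg_ex; exists 0|exact: cvg_lim].
split=> [x|x|].
- exact: (dpow 1%N).
- have D : is_derive x (1 : R) (fun y : R => (3 : R) * Num.max y 0 ^+ 2)
      (3 *: (2%:R * Num.max x 0 ^+ 1)).
    exact: (is_deriveZ (3 : R) (dpow 0%N x)).
  apply: (is_derive_eq D).
  by rewrite -![_ *: _]/(_ * _) expr1; ring.
- exact: (continuous_mul (@cst_continuous _ _ _) cm).
Unshelve. all: by end_near. Qed.

(** * Test functions *)

Lemma closure_within_proper (T : topologicalType) (A : set T) (x : T) :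
  closure A x -> ProperFilter (within A (nbhs x)).
Proof.
move=> Ax; apply: Build_ProperFilter_ex => B; rewrite withinE => -[C Cx CA].
have [y [Ay Cy]] := Ax C Cx; exists y.
by have : (C `&` A) y by []; rewrite -CA => -[].
Qed.

Lemma closure_ext_continuous (R : realType) (V : normedModType R) (A : set V)
    (g : V -> R) (x : V) :
  closure A x -> {for x, continuous g} -> closure_ext A g x = g x.
Proof.
move=> Ax cg; have pA := closure_within_proper Ax.
apply: cvg_lim => //.
exact: cvg_within_filter cg.
Qed.

Lemma C2f_derive (R : realType) (V : normedModType R) (f : V -> R) d1 d2 :
  C2f f d1 d2 ->
  (forall v, 'D_v f = d1 v) /\ (forall v w, 'D_w ('D_v f) = d2 v w).
Proof.
move=> [cf df cd1 dd1 cd2].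
have E v : 'D_v f = d1 v by apply/funext => x; have [] := df v x.
split=> // v w; rewrite E; apply/funext => x.
by have [] := dd1 v w x.
Qed.

Lemma C2f_C2_closure (R : realType) (V : normedModType R) (A : set V)
    (f : V -> R) d1 d2 : C2f f d1 d2 -> C2_closure A f.
Proof.
move=> Hf; have [E1 E2] := C2f_derive Hf.
move: Hf => [cf df cd1 dd1 cd2].
split=> [|v x _|v x _|v w x _|v w x _].
- exact: continuous_subspaceT.
- by have [] := df v x.
- by rewrite E1; apply/cvg_ex; exists (d1 v x); apply: cvg_within_filter; exact: cd1.
- by rewrite E1; have [] := dd1 v w x.
- by rewrite E2; apply/cvg_ex; exists (d2 v w x); apply: cvg_within_filter; exact: cd2.
Qed.

Lemma closure_cyl (R : realType) (n : nat) (B : set 'rV[R]_n) (x : 'rV[R]_n) (t : R) :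
  closure B x -> 0 < t -> closure (cyl B) (x, t).
Proof.
move=> Bx t0 C [[C1 C2] /= [C1x C2t] CC].
have [y [By C1y]] := Bx _ C1x.
exists (y, t); split; first by split.
by apply: CC; split => //=; exact: nbhs_singleton.
Qed.

Definition Dspace (R : realType) (d1 : 'rV[R]_2 * R -> 'rV[R]_2 * R -> R)
  (z : 'rV[R]_2 * R) : 'rV[R]_2 := \row_i d1 (evec R i, 0) z.

Definition D2space (R : realType)
  (d2 : 'rV[R]_2 * R -> 'rV[R]_2 * R -> 'rV[R]_2 * R -> R)
  (z : 'rV[R]_2 * R) : 'M[R]_2 :=
  \matrix_(i, j) d2 (evec R i, 0) (evec R j, 0) z.

(* Both halves of the definition of a viscosity solution in one shape: a
   supersolution [u] has it with forcing [c], and for a subsolution [u] the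
   function [- u] has it with forcing [- c]. *)
Definition touching_from_below (R : realType) (B : set 'rV[R]_2) (c : R)
    (v : 'rV[R]_2 * R -> R) : Prop :=
  forall phi d1 d2 (x : 'rV[R]_2) (t b : R),
    C2f phi d1 d2 -> closure B x -> 0 < t ->
    (forall z, cyl_bar B z -> v (x, t) - phi (x, t) <= v z - phi z) ->
    d1 (0, 1) (x, t) < b ->
    (\forall z \near (x, Dspace d1 (x, t), D2space d2 (x, t)),
      z.1.2 != 0 -> b <= Fop c z) ->
    ~ B x /\ (frontier B x -> forall nu, outward_unit_normal B x nu ->
      0 <= dot (Dspace d1 (x, t)) nu).

Lemma dot_oppl (R : realType) n (x y : 'rV[R]_n) : dot (- x) y = - dot x y.
Proof. by rewrite /dot mulNmx mxE. Qed.

Lemma dot_oppr (R : realType) n (x y : 'rV[R]_n) : dot x (- y) = - dot x y.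
Proof. by rewrite /dot linearN /= mulmxN mxE. Qed.

Lemma Fop_opp (R : realType) n (c : R) (x p : 'rV[R]_n) (X : 'M[R]_n) :
  Fop c (x, - p, - X) = - Fop (- c) (x, p, X).
Proof.
rewrite /Fop /enorm dot_oppl dot_oppr opprK.
have -> : (- p)^T *m - p = p^T *m p.
  have -> : (- p)^T = - p^T by apply/matrixP => i j; rewrite !mxE.
  by rewrite mulNmx mulmxN opprK.
by rewrite mulmxN [\tr (- _)]raddfN /= mulNr opprD opprK.
Qed.

Lemma C2f_Dt (R : realType) (B : set 'rV[R]_2) phi d1 d2 (x : 'rV[R]_2) (t : R) :
  C2f phi d1 d2 -> closure B x -> 0 < t ->
  [/\ dt B phi (x, t) = d1 (0, 1) (x, t), Dx B phi (x, t) = Dspace d1 (x, t) &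
      Dxx B phi (x, t) = D2space d2 (x, t)].
Proof.
move=> Hf Bx t0; have [E1 E2] := C2f_derive Hf.
have cB := closure_cyl Bx t0.
move: Hf => [cf df cd1 dd1 cd2]; split.
- by rewrite /dt E1 closure_ext_continuous//; exact: cd1.
- by apply/rowP => i; rewrite !mxE E1 closure_ext_continuous//; exact: cd1.
- by apply/matrixP => i j; rewrite !mxE E2 closure_ext_continuous//; exact: cd2.
Qed.

(** Since [F_dom] excludes zero gradients, a bound at nearby nonzero gradients controls the envelope
    even at [p = 0]. *)
Lemma F_lower_ge (R : realType) (B : set 'rV[R]_2) (c b : R) (x p : 'rV[R]_2) X :
  (\forall z \near (x, p, X), z.1.2 != 0 -> b <= Fop c z) ->
  (b%:E <= F_lower B c x p X)%E.
Proof.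
move=> H; rewrite /F_lower limf_einfE; apply: le_ereal_sup_tmp.
exists (ereal_inf [set (Fop c z)%:E | z in [set z : 'rV[R]_2 * 'rV[R]_2 * 'M[R]_2 | b <= Fop c z]]).
  exists [set z | b <= Fop c z] => //.
  by apply: filterS H => z /= hz [_ /hz].
by apply: le_ereal_inf_tmp => _ [z /= hz <-]; rewrite lee_fin.
Qed.

Lemma F_upper_le (R : realType) (B : set 'rV[R]_2) (c b : R) (x p : 'rV[R]_2) X :
  (\forall z \near (x, p, X), z.1.2 != 0 -> Fop c z <= b) ->
  (F_upper B c x p X <= b%:E)%E.
Proof.
move=> H; rewrite /F_upper limf_esupE.
apply: (@le_trans _ _ (ereal_sup [set (Fop c z)%:E | z in [set z | Fop c z <= b]])).
  apply: ereal_inf_lbound; exists [set z | Fop c z <= b] => //.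
  by apply: filterS H => z /= hz [_ /hz].
by apply: ge_ereal_sup => _ [z /= hz <-]; rewrite lee_fin.
Qed.

(** The bound [b] makes the equation part strictly negative, so of the maximum at the boundary only
    the normal derivative can be nonnegative. *)
Lemma supersolution_touching (R : realType) (B : set 'rV[R]_2) (c : R) u0
    (u : 'rV[R]_2 * R -> R) :
  viscosity_supersolution B c u0 u -> touching_from_below B c u.
Proof.
move=> [_ _ H] phi d1 d2 x t b Hf Bx t0 hmin hb hnear.
have [A1 A2] := H phi (C2f_C2_closure (cyl B) Hf) x t Bx t0 hmin.
move: A1 A2; rewrite /=; have [-> -> ->] := C2f_Dt Hf Bx t0.
have hF := F_lower_ge B hnear.
set E := ((_)%:E - _)%E.
have E0 : (E < 0)%E.
  by rewrite /E sube_lt0//; apply: lt_le_trans hF; rewrite lte_fin.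
move=> A1 A2; split=> [/A1|fx nu hnu].
  by rewrite leNgt E0.
have := A2 fx nu hnu; rewrite le_max leNgt E0 /=.
by rewrite lee_fin.
Qed.

(** The test function is [- phi], and the oddness in [Fop_opp] turns the lower bound for forcing
    [- c] into an upper bound for forcing [c]. *)
Lemma subsolution_touching (R : realType) (B : set 'rV[R]_2) (c : R) u0
    (u : 'rV[R]_2 * R -> R) :
  viscosity_subsolution B c u0 u -> touching_from_below B (- c) (fun z => - u z).
Proof.
move=> [_ _ H] phi d1 d2 x t b Hf Bx t0 hmin hb hnear.
have Hf' := C2f_mul (C2f_cst _ (-1)) Hf.
have hmax z : cyl_bar B z -> u z - (-1 * phi z) <= u (x, t) - (-1 * phi (x, t)).
  by move=> /hmin; rewrite !mulN1r; lra.
have [A1 A2] := H _ (C2f_C2_closure (cyl B) Hf') x t Bx t0 hmax.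
move: A1 A2; rewrite /=; have [-> -> ->] := C2f_Dt Hf' Bx t0.
rewrite mul0r add0r mulN1r.
set p := Dspace _ _; set X := D2space _ _.
have Ep : p = - Dspace d1 (x, t).
  by apply/rowP => i; rewrite !mxE mul0r add0r mulN1r.
have EX : X = - D2space d2 (x, t).
  by apply/matrixP => i j; rewrite !mxE !mul0r !add0r mulN1r.
have hF : (F_upper B c x p X <= (- b)%:E)%E.
  apply: F_upper_le; rewrite Ep EX.
  (* The hypothesis lives near the opposite gradient and Hessian; the continuous reflection [N]
     pulls it back. *)
  pose N (z : 'rV[R]_2 * 'rV[R]_2 * 'M[R]_2) := (z.1.1, - z.1.2, - z.2).
  have cN : continuous N.
    apply: continuous_pair; last by move=> z; apply: cvgN; exact: cvg_snd.
    have c1 := @continuous_fst ('rV[R]_2 * 'rV[R]_2)%type 'M[R]_2.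
    apply: continuous_pair; first exact: continuous_fun_comp c1 (@continuous_fst _ _).
    by move=> z; apply: cvgN; exact: (continuous_fun_comp c1 (@continuous_snd _ _)).
  have := cN (x, - Dspace d1 (x, t), - D2space d2 (x, t)).
  rewrite /continuous_at /N /= !opprK => /(_ _ hnear) hN.
  have {hN} : \forall z \near (x, - Dspace d1 (x, t), - D2space d2 (x, t)),
    (N z).1.2 != 0 -> b <= Fop (- c) (N z) := hN.
  apply: filterS => -[[y q] Y] h q0.
  rewrite -[q]opprK -[Y]opprK Fop_opp lerN2; apply: h.
  by rewrite oppr_eq0.
set E := ((_)%:E - _)%E.
have E0 : (0 < E)%E.
  rewrite /E sube_gt0; apply: (le_lt_trans hF); rewrite lte_fin ltrN2.
  exact: hb.
move=> A1 A2; split=> [/A1|fx nu hnu].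
  by rewrite leNgt E0.
have := A2 fx nu hnu; rewrite ge_min leNgt E0 /=.
by rewrite lee_fin Ep dot_oppl oppr_le0.
Qed.

(** * The operator in the plane *)

Lemma sum_ord2 (V : nmodType) (F : 'I_2 -> V) : \sum_i F i = F 0 + F 1.
Proof.
by rewrite !big_ord_recl big_ord0 addr0; congr (F _ + F _); apply/val_inj.
Qed.

Lemma dotE (R : realType) (p q : 'rV[R]_2) : dot p q = x1 p * x1 q + x2 p * x2 q.
Proof. by rewrite /dot mxE sum_ord2 !mxE. Qed.

Lemma enormE (R : realType) (p : 'rV[R]_2) :
  enorm p = Num.sqrt (x1 p ^+ 2 + x2 p ^+ 2).
Proof. by rewrite /enorm dotE -!expr2. Qed.

Lemma row2_eq0 (R : realType) (p : 'rV[R]_2) :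
  (p == 0) = (x1 p ^+ 2 + x2 p ^+ 2 == 0).
Proof.
rewrite paddr_eq0 ?sqr_ge0// !expf_eq0 /=; apply/eqP/andP => [->|[/eqP h1 /eqP h2]].
  by rewrite /x1 /x2 !mxE !eqxx.
apply/rowP => i; rewrite mxE.
case: i => -[|[|//]] hi; [rewrite -[RHS]h1|rewrite -[RHS]h2];
  by congr (p _ _); apply/val_inj.
Qed.

Lemma FopE (R : realType) (c : R) (x p : 'rV[R]_2) (X : 'M[R]_2) :
  Fop c (x, p, X) = X 0 0 + X 1 1
    - (x1 p ^+ 2 + x2 p ^+ 2)^-1 * (x1 p * x1 p * X 0 0 + x1 p * x2 p * X 1 0
      + (x2 p * x1 p * X 0 1 + x2 p * x2 p * X 1 1))
    + c * Num.sqrt (x1 p ^+ 2 + x2 p ^+ 2).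
Proof.
rewrite /Fop enormE sqr_sqrtr ?addr_ge0 ?sqr_ge0//; congr (_ + _).
rewrite mulmxBl mul1mx linearB /= -scalemxAl linearZ /=; congr (_ - _ * _).
  by rewrite /mxtrace sum_ord2.
rewrite /mxtrace sum_ord2 ![(_ *m X) _ _]mxE !sum_ord2 !mxE.
by rewrite !big_ord_recl !big_ord0 !mxE /x1 /x2; ring.
Qed.

Lemma continuous_grad_coord (R : realType) i :
  continuous (fun z : ('rV[R]_2 * 'rV[R]_2 * 'M[R]_2) => z.1.2 0 i).
Proof.
apply: (continuous_fun_comp _ (@coord_continuous R 1 2 0 i)).
exact: continuous_fun_comp (@continuous_fst _ _) (@continuous_snd _ _).
Qed.

Lemma continuous_hess_coord (R : realType) i j :
  continuous (fun z : ('rV[R]_2 * 'rV[R]_2 * 'M[R]_2) => z.2 i j).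
Proof. exact: continuous_fun_comp (@continuous_snd _ _) (@coord_continuous R 2 2 i j). Qed.

Lemma continuous_grad_sqr (R : realType) :
  continuous (fun z : ('rV[R]_2 * 'rV[R]_2 * 'M[R]_2) => x1 z.1.2 ^+ 2 + x2 z.1.2 ^+ 2).
Proof.
pose c i := @continuous_grad_coord R i.
exact: (continuous_add (continuous_mul (c 0) (c 0)) (continuous_mul (c 1) (c 1))).
Qed.

Lemma Fop_near (R : realType) (c b : R) (x p : 'rV[R]_2) (X : 'M[R]_2) :
  p != 0 -> b < Fop c (x, p, X) ->
  \forall z \near (x, p, X), z.1.2 != 0 -> b <= Fop c z.
Proof.
move=> p0 hb; pose T := ('rV[R]_2 * 'rV[R]_2 * 'M[R]_2)%type.
pose cP i := @continuous_grad_coord R i; pose cX i j := @continuous_hess_coord R i j.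
have cN := @continuous_grad_sqr R.
have hc : {for (x, p, X), continuous (Fop c : T -> R)}.
  have -> : (Fop c : T -> R) = fun z => z.2 0 0 + z.2 1 1
    - (x1 z.1.2 ^+ 2 + x2 z.1.2 ^+ 2)^-1 *
      (x1 z.1.2 * x1 z.1.2 * z.2 0 0 + x1 z.1.2 * x2 z.1.2 * z.2 1 0
      + (x2 z.1.2 * x1 z.1.2 * z.2 0 1 + x2 z.1.2 * x2 z.1.2 * z.2 1 1))
    + c * Num.sqrt (x1 z.1.2 ^+ 2 + x2 z.1.2 ^+ 2).
    by apply/funext => -[[y q] Y]; rewrite FopE.
  apply: cvgD; [apply: cvgD|].
  - by apply: cvgD; exact: cX.
  - apply: cvgN; apply: cvgM.
      by apply: cvgV; [rewrite -row2_eq0|exact: cN].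
    have cPPX i j k l : continuous (fun z : T => z.1.2 0 i * z.1.2 0 j * z.2 k l).
      exact: continuous_mul (continuous_mul (cP i) (cP j)) (cX k l).
    exact: (continuous_add (continuous_add (cPPX 0 0 0 0) (cPPX 0 1 1 0))
      (continuous_add (cPPX 1 0 0 1) (cPPX 1 1 1 1))).
  - apply: cvgM; first exact: cvg_cst.
    exact: (continuous_fun_comp cN (@sqrt_continuous R)).
have {hc} H : \forall z \near (x, p, X), b < Fop c z := hc _ (lt_nbhsr hb).
by apply: filterS H => z /ltW.
Qed.

Definition mxsum1 (R : realType) (X : 'M[R]_2) := `|X 0 0| + `|X 0 1| + `|X 1 0| + `|X 1 1|.

(** A lower bound for [Fop] that remains continuous at a vanishing gradient and is positively
    homogeneous, as needed where the barrier is flat. *)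
Definition Fop_lb (R : realType) (c : R) (p : 'rV[R]_2) (X : 'M[R]_2) : R :=
  - (2 * mxsum1 X + `|c| * Num.sqrt (x1 p ^+ 2 + x2 p ^+ 2)).

(** Products of two coordinates of [p] are at most [|p|^2], so the projection term costs at most one
    more copy of the sum of the entries. *)
Lemma Fop_ge (R : realType) (c : R) (x p : 'rV[R]_2) (X : 'M[R]_2) :
  p != 0 -> Fop_lb c p X <= Fop c (x, p, X).
Proof.
rewrite row2_eq0 FopE /Fop_lb /mxsum1 => p0.
set a := x1 p; set d := x2 p; set n := a ^+ 2 + d ^+ 2.
have n0 : 0 < n by rewrite lt_neqAle eq_sym p0 addr_ge0 ?sqr_ge0.
have q s t Y : `|s * t| <= n -> n^-1 * (s * t * Y) <= `|Y|.
  move=> h; rewrite ler_pdivrMl//; apply: (le_trans (ler_norm _)).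
  by rewrite normrM ler_wpM2r.
have := ler_norm (- (c * Num.sqrt n)); rewrite normrN normrM (ger0_norm (sqrtr_ge0 _)) => hc.
have h1 : n^-1 * (a * a * X 0 0) <= `|X 0 0|.
  by apply: q; rewrite ger0_norm -expr2 ?sqr_ge0// /n lerDl sqr_ge0.
have h4 : n^-1 * (d * d * X 1 1) <= `|X 1 1|.
  by apply: q; rewrite ger0_norm -expr2 ?sqr_ge0// /n lerDr sqr_ge0.
have had : `|a * d| <= n.
  by rewrite ler_norml /n; apply/andP; split; nra.
have h2 : n^-1 * (a * d * X 1 0) <= `|X 1 0| by exact: q.
have h3 : n^-1 * (d * a * X 0 1) <= `|X 0 1| by apply: q; rewrite mulrC.
have := ler_norm (- X 0 0); have := ler_norm (- X 1 1); rewrite !normrN.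
have := normr_ge0 (X 0 1); have := normr_ge0 (X 1 0).
rewrite !mulrDr; lra.
Qed.

Lemma Fop_lb_near (R : realType) (c b : R) (x p : 'rV[R]_2) (X : 'M[R]_2) :
  b < Fop_lb c p X ->
  \forall z \near (x, p, X), z.1.2 != 0 -> b <= Fop c z.
Proof.
move=> hb; pose T := ('rV[R]_2 * 'rV[R]_2 * 'M[R]_2)%type.
pose cP i := @continuous_grad_coord R i; pose cX i j := @continuous_hess_coord R i j.
have cN := @continuous_grad_sqr R.
have cabs i j : continuous (fun z : T => `|z.2 i j|).
  exact: continuous_fun_comp (cX i j) (@norm_continuous _ _).
have hc : continuous (fun z : T => Fop_lb c z.1.2 z.2).
  apply: continuous_opp; apply: continuous_add.
    apply: (continuous_mul (@cst_continuous _ _ _)).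
    exact: (continuous_add (continuous_add (continuous_add (cabs _ _) (cabs _ _))
      (cabs _ _)) (cabs _ _)).
  apply: (continuous_mul (@cst_continuous _ _ _)).
  exact: (continuous_fun_comp cN (@sqrt_continuous R)).
have {hc} H : \forall z \near (x, p, X), b < Fop_lb c z.1.2 z.2 :=
  hc (x, p, X) _ (lt_nbhsr hb).
apply: filterS H => -[[y q] Y] h q0.
exact: le_trans (ltW h) (Fop_ge c y Y q0).
Qed.

(** The equation is geometric: the projection orthogonal to [p] kills the rank-one term, and the
    rest is homogeneous of degree 1. A decreasing function of [G] therefore satisfies the same
    inequality as [- G], up to the factor [l]. *)
Lemma Fop_scale (R : realType) (c l mu : R) (x p : 'rV[R]_2) (X : 'M[R]_2) :
  0 < l -> p != 0 ->
  Fop c (x, - l *: p, - l *: X - mu *: (p^T *m p)) = l * Fop c (x, - p, - X).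
Proof.
rewrite row2_eq0 => l0 p0; rewrite !FopE.
have -> : x1 (- l *: p) = - l * x1 p by rewrite /x1 mxE.
have -> : x2 (- l *: p) = - l * x2 p by rewrite /x2 mxE.
have -> : x1 (- p) = - x1 p by rewrite /x1 mxE.
have -> : x2 (- p) = - x2 p by rewrite /x2 mxE.
have -> : Num.sqrt ((- l * x1 p) ^+ 2 + (- l * x2 p) ^+ 2)
    = l * Num.sqrt ((- x1 p) ^+ 2 + (- x2 p) ^+ 2).
  rewrite (_ : _ + _ = l ^+ 2 * ((- x1 p) ^+ 2 + (- x2 p) ^+ 2)); last by ring.
  by rewrite sqrtrM ?sqr_ge0// sqrtr_sqr gtr0_norm.
set r := Num.sqrt _.
rewrite !mxE !big_ord_recl !big_ord0 !mxE -![p 0 0]/(x1 p) -![p 0 1]/(x2 p).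
field.
by rewrite !exprMn !sqrrN -mulrDr p0 mulf_neq0// expf_neq0// gt_eqF.
Qed.

(** * Localisation of regularity and a smooth majorant of a sequence *)

Lemma C2R_shift (R : realType) (f f1 f2 : R -> R) (a : R) :
  C2R f f1 f2 ->
  C2R (fun t => f (t + a)) (fun t => f1 (t + a)) (fun t => f2 (t + a)).
Proof.
move=> Hf; have [_ _ cf2] := C2R_continuous Hf; case: Hf => df df1 _.
have ds (x : R) : is_derive x (1 : R) (fun t : R => t + a) 1.
  exact: (is_derive_shift x 1 a).
have dc (h h1 : R -> R) x : (forall y, is_derive y (1 : R) h (h1 y)) ->
    is_derive x (1 : R) (fun t : R => h (t + a)) (h1 (x + a)).
  move=> dh; rewrite -[h1 _]mulr1.
  exact: (@is_derive_comp1 _ _ h (fun t : R => t + a) x 1 _ _ (dh (x + a)) (ds x)).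
split=> [x|x|].
- exact: dc df.
- exact: dc df1.
- apply: (continuous_fun_comp _ cf2).
  by apply: continuous_add; [move=> x; exact: cvg_id|exact: cst_continuous].
Qed.

Lemma C2R_local (R : realType) (f f1 f2 : R -> R) :
  (forall t : R, exists F F1 F2, C2R F F1 F2 /\
     (\forall s \near nbhs t, [/\ F s = f s, F1 s = f1 s & F2 s = f2 s])) ->
  C2R f f1 f2.
Proof.
move=> H; split=> t; have [F [F1 [F2 [[dF dF1 cF2] E]]]] := H t.
- have [_ <- _] := nbhs_singleton E.
  by apply: near_eq_is_derive (dF t); apply: filterS E => s [].
- have [_ _ <-] := nbhs_singleton E.
  by apply: near_eq_is_derive (dF1 t); apply: filterS E => s [].
- have [_ _ E2] := nbhs_singleton E.
  rewrite /continuous_at -E2.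
  apply: cvg_trans (cF2 t); apply: near_eq_cvg.
  by apply: filterS E => s [].
Qed.

Lemma C2R_sum (R : realType) (n : nat) (f f1 f2 : nat -> R -> R) :
  (forall i, C2R (f i) (f1 i) (f2 i)) ->
  C2R (fun t => \sum_(i < n) f i t) (fun t => \sum_(i < n) f1 i t)
    (fun t => \sum_(i < n) f2 i t).
Proof.
move=> H; elim: n => [|n IH].
  have -> : (fun t => \sum_(i < 0) f i t) = (fun=> 0).
    by apply/funext => t; rewrite big_ord0.
  have -> : (fun t => \sum_(i < 0) f1 i t) = (fun=> 0).
    by apply/funext => t; rewrite big_ord0.
  have -> : (fun t => \sum_(i < 0) f2 i t) = (fun=> 0).
    by apply/funext => t; rewrite big_ord0.
  exact: C2R_cst.
have E (g : nat -> R -> R) :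
    (fun t => \sum_(i < n.+1) g i t) = fun t => \sum_(i < n) g i t + g n t.
  by apply/funext => t; rewrite big_ord_recr.
by rewrite !E; apply: C2R_add.
Qed.

(** The function is the locally finite sum of the terms [M i * pos_cube (t - (N + i))]: each of them
    reaches [M i] one unit of time after it starts to grow. *)
Lemma C2R_majorant (R : realType) (M : nat -> R) (N : nat) :
  (forall i, 0 <= M i) ->
  exists chi chi1 chi2 : R -> R,
    [/\ C2R chi chi1 chi2, forall t, 0 <= chi t, forall t, 0 <= chi1 t,
        forall t, t <= N%:R -> chi t = 0 &
        forall i t, (N + i).+1%:R <= t -> M i <= chi t].
Proof.
move=> M0.
(* The number of terms depends on [t], but the missing ones vanish at [t]; near each point the sum
   may thus be taken with a fixed length. *)
pose S (g : R -> R) t := \sum_(i < (Num.truncn t).+1) M i * g (t - (N + i)%:R).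
pose SL (g : R -> R) (L : nat) t := \sum_(i < L) M i * g (t - (N + i)%:R).
have SE (g : R -> R) (L : nat) t : (forall s, s <= 0 -> g s = 0) -> t < L%:R ->
    (0 < L)%N -> SL g L t = S g t.
  move=> g0 tL L0.
  have leL : ((Num.truncn t).+1 <= L)%N.
    by case: L tL L0 => [//|L] tL _; rewrite ltnS truncn_le_nat.
  rewrite /SL /S -(subnKC leL) big_split_ord /= [X in _ + X]big1 ?addr0// => i _.
  rewrite g0 ?mulr0// subr_le0.
  have : t < (Num.truncn t).+1%:R by exact: truncnS_gt.
  move/ltW/le_trans; apply; rewrite ler_nat; lia.
have mx0 (s : R) : s <= 0 -> Num.max s 0 = 0 by move=> s0; exact/max_idPr.
exists (S (@pos_cube R)), (S (fun x => 3 * Num.max x 0 ^+ 2)),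
  (S (fun x => 6 * Num.max x 0)).
have t1 t : (0 <= Num.max t 0 :> R) by rewrite le_max lexx orbT.
split.
- apply: C2R_local => t.
  set L := (Num.truncn t).+2.
  have tL : t < L%:R.
    by apply: (lt_le_trans (truncnS_gt t)); rewrite ler_nat.
  exists (SL (@pos_cube R) L), (SL (fun x => 3 * Num.max x 0 ^+ 2) L),
    (SL (fun x => 6 * Num.max x 0) L); split.
    pose F (g : R -> R) i t := M i * g (t - (N + i)%:R).
    apply: (@C2R_sum _ L (F (@pos_cube R)) (F _) (F _)) => i; rewrite /F.
    have := C2R_mul (C2R_cst (M i)) (C2R_shift (- (N + i)%:R) (C2R_pos_cube R)).
    congr C2R; apply/funext => s; rewrite !mul0r ?mulr0 ?add0r //.
  near=> s.
  have sL : s < L%:R by near: s; exact: lt_nbhsl.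
  split; apply: SE => // r r0; rewrite /pos_cube mx0// ?expr0n /= ?mulr0//.
- by move=> t; apply: sumr_ge0 => i _; rewrite mulr_ge0// /pos_cube exprn_ge0.
- by move=> t; apply: sumr_ge0 => i _; rewrite !mulr_ge0// exprn_ge0.
- move=> t tN; apply: big1 => i _.
  rewrite /pos_cube mx0 ?expr0n ?mulr0// subr_le0 (le_trans tN)// ler_nat leq_addr//.
- move=> i t ht.
  have ti : (i < (Num.truncn t).+1)%N.
    have : (N + i < Num.truncn t)%N by rewrite truncn_gt_nat.
    by lia.
  rewrite /S (bigD1 (Ordinal ti)) //=.
  have h1 : 1 <= pos_cube (t - (N + i)%:R).
    have : 1 <= t - (N + i)%:R by move: ht; rewrite -natr1; lra.
    move=> h; rewrite /pos_cube (max_idPl _) ?exprn_ege1//; lra.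
  rewrite -[leLHS]addr0; apply: lerD.
    by rewrite -[leLHS]mulr1 ler_wpM2l.
  by apply: sumr_ge0 => j _; rewrite mulr_ge0// /pos_cube exprn_ge0.
Unshelve. all: by end_near. Qed.

(** * Comparison with a smooth barrier *)

Lemma compact_norm_bound (R : realType) (T : topologicalType) (A : set T)
    (f : T -> R) :
  compact A -> {within A, continuous f} ->
  exists2 M : R, 0 <= M & forall z, A z -> `|f z| <= M.
Proof.
move=> cA cf; have [[z0 Az0]|A0] := pselect (A !=set0); last first.
  by exists 0 => // z Az; exfalso; apply: A0; exists z.
have cn : {within A, continuous (fun z => `|f z|)}.
  exact: (continuous_fun_comp cf (@norm_continuous _ _)).
have [z _ hz] := compact_EVT_max (ex_intro _ z0 Az0) cA cn.
by exists `|f z| => // y Ay; apply: hz; rewrite inE.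
Qed.

Lemma C2f_snd (R : realType) (V : normedModType R) :
  C2f (fun z : V * R => z.2) (fun v _ => v.2) (fun _ _ _ => 0).
Proof.
apply: (@C2f_linear _ _ (fun z : V * R => z.2)) => //.
exact: continuous_snd.
Qed.

Definition barrier (R : realType) (b K e : R) (G : 'rV[R]_2 * R -> R)
  (z : 'rV[R]_2 * R) : R := b - K * pos_cube (G z + e).

(** What a small multiple of [G] in the test function can cost in the equation, valid also where the
    gradient of [G] vanishes. *)
Definition slope_bound (R : realType) (c : R)
    (d1 : 'rV[R]_2 * R -> 'rV[R]_2 * R -> R)
    (d2 : 'rV[R]_2 * R -> 'rV[R]_2 * R -> 'rV[R]_2 * R -> R) z : R :=
  `|d1 (0, 1) z| - Fop_lb c (Dspace d1 z) (D2space d2 z).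

Lemma slope_bound_continuous (R : realType) c (G : 'rV[R]_2 * R -> R) d1 d2 :
  C2f G d1 d2 -> continuous (slope_bound c d1 d2).
Proof.
move=> [_ _ cd1 _ cd2].
have cn (f : 'rV[R]_2 * R -> R) : continuous f -> continuous (fun z => `|f z|).
  by move=> cf; exact: (continuous_fun_comp cf (@norm_continuous _ _)).
apply: continuous_add; first exact: cn.
apply: continuous_opp; apply: continuous_opp; apply: continuous_add.
  apply: (continuous_mul (@cst_continuous _ _ _)).
  have c2 i j : continuous (fun z => `|D2space d2 z i j|).
    apply: cn; have -> : (fun z => D2space d2 z i j) = d2 (evec R i, 0) (evec R j, 0).
      by apply/funext => z; rewrite mxE.
    exact: cd2.
  exact: (continuous_add (continuous_add (continuous_add (c2 _ _) (c2 _ _)) (c2 _ _)) (c2 _ _)).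
apply: (continuous_mul (@cst_continuous _ _ _)).
apply: (continuous_fun_comp _ (@sqrt_continuous R)).
have c1 i : continuous (fun z => Dspace d1 z 0 i).
  have -> : (fun z => Dspace d1 z 0 i) = d1 (evec R i, 0).
    by apply/funext => z; rewrite mxE.
  exact: cd1.
exact: (continuous_add (continuous_mul (c1 0) (c1 0)) (continuous_mul (c1 1) (c1 1))).
Qed.

Lemma slope_bound_ge0 (R : realType) (c : R) d1 d2 z : 0 <= slope_bound c d1 d2 z.
Proof.
rewrite /slope_bound /Fop_lb opprK; apply: addr_ge0 => //.
by rewrite addr_ge0 ?mulr_ge0 ?sqrtr_ge0// /mxsum1 !addr_ge0.
Qed.

Lemma Fop_lb_scale (R : realType) (c l : R) (p : 'rV[R]_2) (X : 'M[R]_2) :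
  0 <= l -> Fop_lb c (- l *: p) (- l *: X) = l * Fop_lb c p X.
Proof.
move=> l0; rewrite /Fop_lb /mxsum1 !mxE !normrM normrN (ger0_norm l0).
have -> : x1 (- l *: p) = - l * x1 p by rewrite /x1 mxE.
have -> : x2 (- l *: p) = - l * x2 p by rewrite /x2 mxE.
have -> : (- l * x1 p) ^+ 2 + (- l * x2 p) ^+ 2 = l ^+ 2 * (x1 p ^+ 2 + x2 p ^+ 2).
  by ring.
rewrite sqrtrM ?sqr_ge0// sqrtr_sqr (ger0_norm l0); ring.
Qed.

Lemma dot_scalel (R : realType) n (a : R) (x y : 'rV[R]_n) : dot (a *: x) y = a * dot x y.
Proof. by rewrite /dot -scalemxAl mxE. Qed.

(* The test function is the barrier lowered by [kap * (G + C) + eta * t + chi t].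
   In the region where the barrier is flat, its gradient is of size [kap] and the
   slope [eta] provides the strict inequality; the term in [kap] makes the normal
   derivative strictly negative there.  As [v] is not known to be bounded, the
   fast growing [chi] is what makes the minimum of [v - phi] global. *)
Lemma comparison (R : realType) (B : set 'rV[R]_2) (c : R)
    (v G : 'rV[R]_2 * R -> R) d1 d2 (b K e : R) :
  touching_from_below B c v -> compact (closure B) ->
  {within cyl_bar B, continuous v} -> C2f G d1 d2 -> 0 <= K ->
  (forall x t, closure B x -> 0 < t -> v (x, t) < barrier b K e G (x, t) ->
     0 < K -> 0 < G (x, t) + e -> Dspace d1 (x, t) != 0 /\
     - d1 (0, 1) (x, t) <= Fop c (x, - Dspace d1 (x, t), - D2space d2 (x, t))) ->
  (forall x t, frontier B x -> 0 < t -> v (x, t) < barrier b K e G (x, t) ->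
     exists2 nu, outward_unit_normal B x nu & 0 < dot (Dspace d1 (x, t)) nu) ->
  (forall x, closure B x -> barrier b K e G (x, 0) <= v (x, 0)) ->
  forall x t, closure B x -> 0 <= t -> barrier b K e G (x, t) <= v (x, t).
Proof.
move=> touch cB cv HG K0 Hint Hbd Hinit x0 t0 Bx0 t00.
rewrite leNgt; apply/negP => gap.
set psi := barrier b K e G in gap Hinit Hint Hbd *.
set g := psi (x0, t0) - v (x0, t0).
have g0 : 0 < g by rewrite subr_gt0.
have cG : continuous G by case: HG.
have cpsi : continuous psi.
  apply: continuous_add; first exact: cst_continuous.
  apply: continuous_opp; apply: (continuous_mul (@cst_continuous _ _ _)).
  have [cc _ _] := C2R_continuous (C2R_pos_cube R).
  by apply: (continuous_fun_comp _ cc); apply: continuous_add => //; exact: cst_continuous.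
pose Q (T : R) : set ('rV[R]_2 * R) := closure B `*` `[0, T].
have cQ T : compact (Q T) by apply: compact_setX => //; exact: segment_compact.
have subQ T : Q T `<=` cyl_bar B.
  by move=> [x t] [/= Bx]; rewrite in_itv /= => /andP[h _].
have QE x t T : closure B x -> 0 <= t -> t <= T -> Q T (x, t).
  by move=> Bx h1 h2; split => //=; rewrite in_itv /= h1 h2.
(* The growing term [chi] vanishes up to time [N], hence does not affect the gap at [t0]. *)
set N := (Num.truncn t0).+1.
have t0N : t0 <= N%:R by apply/ltW/truncnS_gt.
have cGn : continuous (fun z => `|G z|).
  exact: (continuous_fun_comp cG (@norm_continuous _ _)).
have cW : continuous (slope_bound c d1 d2) by exact: slope_bound_continuous HG.
have [C C0 HC] := compact_norm_bound (cQ N.+1%:R)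
  (continuous_subspaceT (continuous_add cGn cW)).
have W0 z : 0 <= slope_bound c d1 d2 z by exact: slope_bound_ge0.
have HC1 z : Q N.+1%:R z -> `|G z| <= C /\ slope_bound c d1 d2 z <= C.
  move=> /HC; rewrite ger0_norm; last exact: addr_ge0.
  by move=> h; have := W0 z; have := normr_ge0 (G z); split; lra.
(* At [(x0, t0)] the term in [eta] costs at most [g / 4], and the term in [kap] at most
   [2 * ee <= g / 4], so the value of [w] there stays negative. *)
set eta := g / (4 * (t0 + 1)).
have eta0 : 0 < eta by rewrite divr_gt0 ?mulr_gt0//; lra.
(* The bound by 1 gives [kap <= 1], which [wfar] uses; the bound by [eta] gives [kap * C < eta], the
   strict inequality in the flat region. *)
set ee := Num.min 1 (Num.min (g / 8) eta).
have ee0 : 0 < ee by rewrite !lt_min ltr01 eta0 divr_gt0.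
have ee1 : ee <= 1 by rewrite ge_min lexx.
have ee2 : ee <= g / 8 by rewrite !ge_min lexx orbT.
have ee3 : ee <= eta by rewrite !ge_min lexx !orbT.
set kap := ee / (C + 1).
have kap0 : 0 < kap by rewrite divr_gt0//; lra.
have kapC : kap * (C + 1) = ee by rewrite divfK// gt_eqF//; lra.
have kap1 : kap <= 1 by nra.
(* The constant for index [i] serves the times between [N + i + 1] and [N + i + 2]: at the former
   [chi] has already reached it. *)
have MH i : exists2 M : R, 0 <= M & forall z, Q (N + i).+2%:R z ->
    `|v z - psi z| + `|G z| <= M.
  have cvi : {within Q (N + i).+2%:R, continuous v}.
    by apply: continuous_subspaceW cv.
  have c1 : {within Q (N + i).+2%:R, continuous (fun z => v z - psi z)}.
    by apply: (continuous_add cvi); apply: continuous_subspaceT; exact: continuous_opp.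
  have c2 : {within Q (N + i).+2%:R, continuous (fun z => `|v z - psi z| + `|G z|)}.
    apply: (continuous_add (continuous_fun_comp c1 (@norm_continuous _ _))).
    exact: continuous_subspaceT.
  have [M M0 HM] := compact_norm_bound (cQ _) c2.
  by exists M => // z /HM; rewrite ger0_norm ?addr_ge0.
have [M HM] := choice (fun i => let: ex_intro2 M h1 h2 := MH i in ex_intro _ M (conj h1 h2)).
have [chi [chi1 [chi2 [Hchi chi_ge0 chi1_ge0 chiN chiM]]]] :=
  C2R_majorant N (fun i => (HM i).1).
pose T t := eta * t + chi t.
have HT := C2R_mul (C2R_cst (-1)) (C2R_add (C2R_mul (C2R_cst eta) (C2R_id R)) Hchi).
have Hh := C2R_add (C2R_cst b) (C2R_add
  (C2R_mul (C2R_cst (- K)) (C2R_shift e (C2R_pos_cube R)))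
  (C2R_mul (C2R_cst (- kap)) (C2R_shift C (C2R_id R)))).
have Hphi := C2f_add (C2f_comp Hh HG) (C2f_comp HT (C2f_snd 'rV[R]_2)).
set phi := (fun z => _ + _) in Hphi.
have phiE z : phi z = psi z - kap * (G z + C) - eta * z.2 - chi z.2.
  by rewrite /phi /psi /barrier; ring.
have cphi : continuous phi by case: Hphi.
pose w z := v z - phi z.
have wE z : w z = (v z - psi z) + kap * (G z + C) + eta * z.2 + chi z.2.
  by rewrite /w phiE; ring.
have Qz0 : Q N.+1%:R (x0, t0).
  by apply: QE => //; apply: (le_trans t0N); rewrite ler_nat.
have w0 : w (x0, t0) < 0.
  rewrite wE /= chiN// addr0.
  have [h _] := HC1 _ Qz0.
  have := ler_norm (G (x0, t0)) => h'.
  have : kap * (G (x0, t0) + C) <= kap * (C + C) by rewrite ler_pM2l//; lra.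
  have : eta * t0 <= g / 4.
    rewrite /eta mulrAC ler_pdivrMr; last by lra.
    by nra.
  move: ee2 kapC; rewrite -/g => ? ? ? ?.
  have -> : v (x0, t0) - psi (x0, t0) = - g by rewrite /g; ring.
  nra.
have wfar x t : closure B x -> N.+1%:R <= t -> 0 <= w (x, t).
  move=> Bx tN.
  set i := (Num.truncn t - N.+1)%N.
  have hN : (N.+1 <= Num.truncn t)%N by rewrite truncn_gt_nat.
  have ti : (N + i).+1 = Num.truncn t by rewrite /i -addSn subnKC.
  have t0' : 0 <= t by apply: le_trans tN.
  have h1 : (N + i).+1%:R <= t by rewrite ti truncn_le.
  have h2 : t <= (N + i).+2%:R by rewrite ti; exact/ltW/truncnS_gt.
  have := chiM i t h1; have := (HM i).2 _ (QE _ _ _ Bx t0' h2).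
  rewrite wE /=.
  have := ler_norm (- (v (x, t) - psi (x, t))); rewrite normrN.
  have hG : - (kap * G (x, t)) <= `|G (x, t)|.
    rewrite -mulrN; apply: (@le_trans _ _ (kap * `|G (x, t)|)).
      by rewrite ler_pM2l// -normrN ler_norm.
    by rewrite ler_piMl.
  have : 0 <= kap * C by apply: mulr_ge0 => //; exact: ltW.
  have : 0 <= eta * t by apply: mulr_ge0 => //; exact: ltW.
  move: hG; rewrite mulrDr; lra.
have cw : {within Q N.+1%:R, continuous w}.
  apply: continuous_add; first exact: continuous_subspaceW cv.
  by apply: continuous_subspaceT; exact: continuous_opp.
(* The minimum over the compact cylinder is negative whereas [w] is nonnegative at later times, so
   it is a global minimum. *)
have [[x t] + hmin] := compact_EVT_min (ex_intro _ _ Qz0) (cQ _) cw.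
rewrite inE => Qxt.
have wxt : w (x, t) < 0 by apply: le_lt_trans w0; apply: hmin; rewrite inE.
have [Bx tge0] : closure B x /\ 0 <= t by have [] := subQ _ _ Qxt.
have [GC WC] := HC1 _ Qxt.
have GC0 : 0 <= kap * (G (x, t) + C).
  apply: mulr_ge0; first exact: ltW.
  by have := ler_norm (- G (x, t)); rewrite normrN; lra.
have vpsi : v (x, t) < psi (x, t).
  move: wxt; rewrite wE /=; have := chi_ge0 t.
  have : 0 <= eta * t by apply: mulr_ge0 => //; exact: ltW.
  lra.
have tpos : 0 < t.
  rewrite lt_neqAle tge0 andbT eq_sym; apply/eqP => te.
  by move: vpsi; rewrite te ltNge Hinit.
have gmin z : cyl_bar B z -> v (x, t) - phi (x, t) <= v z - phi z.
  case: z => y s [/= By s0].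
  have [sN|sN] := leP s N.+1%:R.
    by apply: hmin; rewrite inE; exact: QE.
  apply: (@le_trans _ _ 0); first exact: ltW.
  by apply: wfar => //; exact: ltW.
set p := Dspace d1 (x, t); set X := D2space d2 (x, t).
set s := Num.max (G (x, t) + e) 0.
have s0 : 0 <= s by rewrite le_max lexx orbT.
(* Minus the derivative, at the contact point, of the function of [G] occurring in [phi]; the term
   [kap] keeps it positive where the barrier is flat. *)
set lam := 3 * K * s ^+ 2 + kap.
have lam0 : 0 < lam by rewrite /lam; apply: ltr_wpDl => //; rewrite !mulr_ge0 ?sqr_ge0.
have touch' := touch phi _ _ x t _ Hphi Bx tpos gmin.
set e1 := (fun v0 z => _) in Hphi touch'.
set e2 := (fun v0 w0 z => _) in Hphi touch'.
have Ep : Dspace e1 (x, t) = - lam *: p.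
  apply/rowP => i; rewrite !mxE /e1 /= -/s; rewrite mulr0 addr0.
  by rewrite /lam; ring.
have EX : D2space e2 (x, t) = - lam *: X - (6 * K * s) *: (p^T *m p).
  apply/matrixP => i j; rewrite !mxE big_ord_recl big_ord0 addr0 !mxE /e2 /= -/s.
  by rewrite /lam; ring.
have Et : e1 (0, 1) (x, t) = - lam * d1 (0, 1) (x, t) - eta - chi1 t.
  by rewrite /e1 /= -/s /lam; ring.
(* Once the equation fails strictly, the contact can only lie on the frontier, and there the normal
   derivative [- lam * dot p nu] is negative. *)
suff [b' hb' hnear] : exists2 b', e1 (0, 1) (x, t) < b' &
    \forall z \near (x, Dspace e1 (x, t), D2space e2 (x, t)),
      z.1.2 != 0 -> b' <= Fop c z.
  have [nB fr] := touch' b' hb' hnear.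
  have frx : frontier B x by split=> // /interior_subset.
  have [nu hnu hdot] := Hbd x t frx tpos vpsi.
  have := fr frx nu hnu; rewrite Ep dot_scalel => h.
  by nra.
have c1 := chi1_ge0 t.
have mid (y z : R) : y < z -> exists2 b', y < b' & b' < z.
  by move=> /midf_lt[h1 h2]; exists ((y + z) / 2).
(* Where the barrier is not flat, [Hint] scaled by [lam] gives a weak inequality and [eta] makes it
   strict. Where it is flat, [lam = kap] and the bound [kap * C < eta] suffices. *)
have [/andP[K1 G1]|flat] := boolP ((0 < K) && (0 < G (x, t) + e)).
  have [p0 hF] := Hint x t Bx tpos vpsi K1 G1.
  have lt1 : e1 (0, 1) (x, t) < Fop c (x, Dspace e1 (x, t), D2space e2 (x, t)).
    rewrite Ep EX Fop_scale// Et.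
    have : lam * - d1 (0, 1) (x, t) <= lam * Fop c (x, - p, - X) by rewrite ler_pM2l.
    lra.
  have [b' h1 h2] := mid _ _ lt1; exists b' => //.
  apply: Fop_near h2; rewrite Ep scaler_eq0 oppr_eq0 gt_eqF//=.
have Ks : K * s = 0.
  move: flat; rewrite negb_and -!leNgt => /orP[K1|G1].
    have -> : K = 0 by apply/eqP; rewrite eq_le K1 K0.
    by rewrite mul0r.
  by rewrite /s (max_idPr G1) mulr0.
have lamE : lam = kap by rewrite /lam expr2 mulrA -(mulrA 3) Ks mulr0 mul0r add0r.
have lt1 : e1 (0, 1) (x, t) < Fop_lb c (Dspace e1 (x, t)) (D2space e2 (x, t)).
  rewrite Et Ep EX -(mulrA 6) Ks mulr0 scale0r subr0 lamE Fop_lb_scale ?ltW//.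
  move: WC; rewrite /slope_bound -/p -/X => WC.
  have := ler_norm (- d1 (0, 1) (x, t)); rewrite normrN => h.
  have : kap * (`|d1 (0, 1) (x, t)| - Fop_lb c p X) <= kap * C by rewrite ler_pM2l.
  have : kap * - d1 (0, 1) (x, t) <= kap * `|d1 (0, 1) (x, t)| by rewrite ler_pM2l.
  lra.
have [b' h1 h2] := mid _ _ lt1; exists b' => //.
exact: Fop_lb_near h2.
Qed.

(** * The boundary of the domain *)

Lemma x1_continuous (R : realType) : continuous (@x1 R).
Proof. exact: (@coord_continuous R 1 2 0 0). Qed.

Lemma x2_continuous (R : realType) : continuous (@x2 R).
Proof. exact: (@coord_continuous R 1 2 0 1). Qed.

Lemma x1_lin (R : realType) (a : R) (u v : 'rV[R]_2) : x1 (a *: u + v) = a * x1 u + x1 v.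
Proof. by rewrite /x1 !mxE. Qed.

Lemma x2_lin (R : realType) (a : R) (u v : 'rV[R]_2) : x2 (a *: u + v) = a * x2 u + x2 v.
Proof. by rewrite /x2 !mxE. Qed.

Lemma rV2_eq (R : realType) (p q : 'rV[R]_2) : x1 p = x1 q -> x2 p = x2 q -> p = q.
Proof.
move=> h1 h2; apply/rowP => i.
case: i => -[|[|//]] hi.
  by rewrite (_ : Ordinal hi = 0) //; apply/val_inj.
by rewrite (_ : Ordinal hi = 1) //; apply/val_inj.
Qed.

Lemma closure_pos_ge0 (R : realType) (T : topologicalType) (h : T -> R) (A : set T) x :
  continuous h -> (forall y, A y -> 0 < h y) -> closure A x -> 0 <= h x.
Proof.
move=> ch hA Ax; rewrite leNgt; apply/negP => hx.
have H : \forall y \near x, h y < 0 := ch x _ (lt_nbhsl hx).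
have [y [Ay hy]] := Ax _ H.
by have := hA y Ay; rewrite ltNge ltW.
Qed.

Definition Omega_gap (R : realType) (m k : R) (x : 'rV[R]_2) : R :=
  fprofile m k (x1 x) - `|x2 x|.

Lemma OmegaE (R : realType) (m k : R) x : Omega m k x <-> 0 < Omega_gap m k x.
Proof. by rewrite /Omega_gap subr_gt0. Qed.

Lemma fprofile_continuous (R : realType) (m k : R) : continuous (fprofile m k).
Proof.
apply: continuous_add; last exact: cst_continuous.
exact: (continuous_mul (@cst_continuous _ _ _) (@exprn_continuous R 2)).
Qed.

Lemma Omega_gap_continuous (R : realType) (m k : R) : continuous (Omega_gap m k).
Proof.
apply: continuous_add.
  exact: (continuous_fun_comp (@x1_continuous R) (@fprofile_continuous R m k)).
apply: continuous_opp.
exact: (continuous_fun_comp (@x2_continuous R) (@norm_continuous _ _)).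
Qed.

Lemma closure_Omega_le (R : realType) (m k : R) x :
  closure (Omega m k) x -> `|x2 x| <= fprofile m k (x1 x).
Proof.
move=> h; rewrite -subr_ge0.
by apply: (closure_pos_ge0 (@Omega_gap_continuous R m k) _ h) => y /OmegaE.
Qed.

Lemma enorm_continuous (R : realType) : continuous (@enorm R 2).
Proof.
have -> : @enorm R 2 = fun p => Num.sqrt (x1 p ^+ 2 + x2 p ^+ 2).
  by apply/funext => p; rewrite enormE.
apply: (continuous_fun_comp _ (@sqrt_continuous R)).
exact: (continuous_add (continuous_mul (@x1_continuous R) (@x1_continuous R))
  (continuous_mul (@x2_continuous R) (@x2_continuous R))).
Qed.

Lemma near_eball (R : realType) (r : R) (x : 'rV[R]_2) :
  eball 0 r x -> \forall y \near x, eball 0 r y.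
Proof.
move=> hx'; have hx : enorm x < r by move: hx'; rewrite /eball /= subr0.
have H : \forall y \near x, enorm y < r := enorm_continuous (lt_nbhsl hx).
by apply: filterS H => y hy; rewrite /eball /= subr0.
Qed.

Lemma near_Omega (R : realType) (m k : R) (x : 'rV[R]_2) :
  Omega m k x -> \forall y \near x, Omega m k y.
Proof.
move=> /OmegaE hx.
have H : \forall y \near x, 0 < Omega_gap m k y := Omega_gap_continuous (lt_nbhsr hx).
by apply: filterS H => y /OmegaE.
Qed.

(** A point of the ball strictly below the profile has a neighbourhood in the intersection of
    [Omega] with the ball, hence is interior to [B]. *)
Lemma frontier_profile (R : realType) (m k r : R) (B : set 'rV[R]_2) x :
  Omega m k `&` eball 0 r `<=` B -> B `<=` Omega m k ->
  frontier B x -> eball 0 r x -> `|x2 x| = fprofile m k (x1 x).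
Proof.
move=> sub1 sub2 [cx nix] bx; apply/eqP; rewrite eq_le.
rewrite closure_Omega_le /=; last exact: closureS cx.
rewrite leNgt; apply/negP => h; apply: nix.
by apply: filterS2 (near_Omega h) (near_eball bx) => y hy by_; exact: sub1.
Qed.

Lemma graph_fun_line (R : realType) (x w : 'rV[R]_2) (Q : 'M[R]_2)
    (gamma : 'rV[R]_1 -> R) (s : R) :
  graph_fun x Q gamma (s *: w + x) =
    gamma ((s * (w *m Q) 0 1) *: const_mx 1) - s * (w *m Q) 0 0.
Proof.
rewrite /graph_fun addrK -scalemxAl; congr (gamma _ - _); last by rewrite mxE.
apply/rowP => i; rewrite !mxE mulr1; congr (s * _).
by apply: eq_bigr => j _; congr (_ * Q _ _); apply/val_inj; rewrite /= ord1.
Qed.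

(** In the plane [gamma] depends on one real variable, so its derivative along [const_mx 1]
    determines those of the chart function at the base point. *)
Lemma graph_fun_is_derive (R : realType) (x w : 'rV[R]_2) (Q : 'M[R]_2)
    (gamma : 'rV[R]_1 -> R) :
  derivable gamma 0 (const_mx 1) ->
  is_derive x w (graph_fun x Q gamma)
    ('D_(const_mx 1) gamma 0 * (w *m Q) 0 1 - (w *m Q) 0 0).
Proof.
move=> dg; set e : 'rV[R]_1 := const_mx 1 in dg *; set d := 'D_e gamma 0.
pose gl (s : R) := gamma (s *: e).
have dgl : is_derive (0 : R) (1 : R) gl d.
  have E : gl = (fun h : R => gamma (h *: e + 0)) by apply/funext => h; rewrite addr0.
  split; first by rewrite E; apply/(derivable1P gamma 0 e).
  rewrite E /d /derive.
  set g1 := fun h => h^-1 *: _; set g2 := fun h => h^-1 *: _.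
  suff -> : g1 = g2 by [].
  by rewrite funeqE /g1 /g2 => h /=; rewrite !addr0 scale0r [_%:A]mulr1.
set a := (w *m Q) 0 1; set b := (w *m Q) 0 0.
have dl : is_derive (0 : R) (1 : R) (fun s : R => gl (s * a) - s * b) (d * a - b).
  have da (q : R) : is_derive (0 : R) (1 : R) (fun s : R => s * q) q.
    have := C2R_mul (C2R_id R) (C2R_cst q) => -[+ _ _] => /(_ 0).
    by rewrite mul1r mulr0 addr0.
  have dg0 : is_derive (0 * a) (1 : R) gl d by rewrite mul0r.
  exact: (is_deriveB (@is_derive_comp1 _ _ gl (fun s : R => s * a) 0 1 _ _ dg0 (da a)) (da b)).
have E : (fun s : R => gl (s * a) - s * b) = (fun h => graph_fun x Q gamma (h *: w + x)).
  by apply/funext => s; rewrite graph_fun_line.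
rewrite E in dl.
split; first by apply/(derivable1P _ x w); case: dl.
case: dl => _ <-; rewrite /derive.
set g1 := fun h => h^-1 *: _; set g2 := fun h => h^-1 *: _.
suff -> : g1 = g2 by [].
by rewrite funeqE /g1 /g2 => h /=; rewrite !addr0 scale0r add0r [_%:A]mulr1.
Qed.

(** Testing with [- n] plus [s] times the rotated vector [n] bounds [s * t] by [q] for every [s].
    This forces the cross product [t] to vanish, and [s = 0] gives the sign of [q]. *)
Lemma halfplane_normal (R : realType) (n1 n2 g1 g2 : R) :
  n1 ^+ 2 + n2 ^+ 2 != 0 -> g1 ^+ 2 + g2 ^+ 2 != 0 ->
  (forall w1 w2, n1 * w1 + n2 * w2 < 0 -> g1 * w1 + g2 * w2 <= 0) ->
  exists2 l, 0 < l & g1 = l * n1 /\ g2 = l * n2.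
Proof.
move=> n0 g0 H; set N := n1 ^+ 2 + n2 ^+ 2 in n0 *.
have N0 : 0 < N by rewrite lt_neqAle eq_sym n0 addr_ge0 ?sqr_ge0.
set t := g2 * n1 - g1 * n2; set q := g1 * n1 + g2 * n2.
have Ht s : s * t <= q.
  have := H (- n1 - s * n2) (- n2 + s * n1).
  have -> : n1 * (- n1 - s * n2) + n2 * (- n2 + s * n1) = - N by rewrite /N; ring.
  rewrite oppr_lt0 N0 => /(_ isT).
  by rewrite /t /q; nra.
have t0 : t = 0.
  apply/eqP; apply: contraT => tn0.
  by have := Ht ((q + 1) / t); rewrite divfK//; lra.
have E1 : N * g1 = q * n1.
  by transitivity (q * n1 - n2 * t); [rewrite /N /q /t; ring|rewrite t0 mulr0 subr0].
have E2 : N * g2 = q * n2.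
  by transitivity (q * n2 + n1 * t); [rewrite /N /q /t; ring|rewrite t0 mulr0 addr0].
have q0 : 0 <= q by have := Ht 0; rewrite mul0r.
have G1 : g1 = q / N * n1 by rewrite mulrAC -E1 mulrAC mulfV ?mul1r// gt_eqF.
have G2 : g2 = q / N * n2 by rewrite mulrAC -E2 mulrAC mulfV ?mul1r// gt_eqF.
exists (q / N) => //; rewrite divr_gt0// lt_neqAle q0 andbT eq_sym.
apply: contraNneq g0 => q00.
by rewrite G1 G2 q00 !mul0r expr0n addr0.
Qed.

(** The chart of [B] is unrelated to the formula for [Omega]. The two normals are compared through
    the inward directions: moving strictly into [Omega] means entering [B], along which the chart
    function cannot increase. *)
Lemma frontier_normal (R : realType) (m k r theta : R) (B : set 'rV[R]_2) x :
  0 < m -> 0 < k -> C2theta_domain theta B ->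
  Omega m k `&` eball 0 r `<=` B -> B `<=` Omega m k ->
  frontier B x -> eball 0 r x ->
  exists nu l, [/\ outward_unit_normal B x nu, 0 < l,
    x1 nu = l * (- (m * x1 x)) & x2 nu = l * Num.sg (x2 x)].
Proof.
move=> m0 k0 [oB _ _ chart] sub1 sub2 fx bx.
have [Q [gamma [[QQ Bchart] [C2g _]]]] := chart x fx.
have fE := frontier_profile sub1 sub2 fx bx.
have f0 : 0 < fprofile m k (x1 x).
  by rewrite /fprofile ltr_wpDl// mulr_ge0 ?sqr_ge0// divr_ge0// ltW.
have x2n0 : x2 x != 0 by rewrite -normr_gt0 fE.
have nBx : ~ B x.
  by move=> Bx; case: fx => _; apply; exact: open_nbhs_nbhs.
have dg : derivable gamma 0 (const_mx 1) by case: C2g => _ + _ _ _; apply.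
have dgr w := graph_fun_is_derive x w Q dg.
set d := 'D_(const_mx 1) gamma 0 in dgr.
pose L (w : 'rV[R]_2) := d * (w *m Q) 0 1 - (w *m Q) 0 0.
have {}dgr w : is_derive x w (graph_fun x Q gamma) (L w) := dgr w.
have gx0 : 0 <= graph_fun x Q gamma x.
  rewrite leNgt; apply/negP => h; apply: nBx.
  exact: (nbhs_singleton Bchart).2.
(* directions pointing strictly into [Omega] point weakly into [B] *)
have inward w : - (m * x1 x) * x1 w + Num.sg (x2 x) * x2 w < 0 -> L w <= 0.
  move=> hw; rewrite leNgt; apply/negP => Lw.
  have line : {for 0, continuous (fun s : R => s *: w + x)}.
    by apply: cvgD; [apply: cvgZr_tmp; exact: cvg_id|exact: cvg_cst].
  have line0 : (fun s : R => s *: w + x) @ (0 : R) --> x.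
    have l1 : (fun s : R => s *: w + x) @ (0 : R) --> 0 *: w + x := line.
    by move: l1; rewrite scale0r add0r.
  have [dd dv] := dgr w.
  have quot : (fun h : R => h^-1 *: ((graph_fun x Q gamma \o shift x) (h *: w)
      - graph_fun x Q gamma x)) @ 0^' --> L w.
    by rewrite -dv; exact: dd.
  have Hq : \forall h \near 0^'+, 0 < h^-1 *: ((graph_fun x Q gamma \o shift x) (h *: w)
      - graph_fun x Q gamma x).
    have : \forall h \near (0 : R)^', 0 < h^-1 *: ((graph_fun x Q gamma \o shift x) (h *: w)
      - graph_fun x Q gamma x) := quot _ (lt_nbhsr Lw).
    by rewrite !near_withinE; apply: filterS => h hh h0; apply: hh; rewrite gt_eqF.
  have Hb : \forall h \near (0 : R)^'+, eball 0 r (h *: w + x).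
    by apply: cvg_within; exact: (line0 _ (near_eball bx)).
  have Hc : \forall h \near (0 : R)^'+, B (h *: w + x) <-> graph_fun x Q gamma (h *: w + x) < 0.
    by apply: cvg_within; exact: (line0 _ Bchart).
  (* This keeps the sign of the second coordinate along the segment, so that its absolute value is
     affine there. *)
  have Hs : \forall h \near (0 : R)^'+, `|h * x2 w| < `|x2 x|.
    apply: cvg_within.
    have cm : continuous (fun h : R => `|h * x2 w|).
      apply: (continuous_fun_comp _ (@norm_continuous _ _)).
      by apply: continuous_mul; [move=> h; exact: cvg_id|exact: cst_continuous].
    by apply: (cm 0 _ (lt_nbhsl _)); rewrite mul0r normr0 fE.
  have : \forall h \near (0 : R)^'+, False.
    near=> h.
    have h0 : 0 < h by near: h; exact: nbhs_right_gt.
    have q : 0 < h^-1 *: ((graph_fun x Q gamma \o shift x) (h *: w)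
      - graph_fun x Q gamma x) by near: h.
    have hb : eball 0 r (h *: w + x) by near: h.
    have hc : B (h *: w + x) <-> graph_fun x Q gamma (h *: w + x) < 0 by near: h.
    have hs : `|h * x2 w| < `|x2 x| by near: h.
    have : B (h *: w + x).
      apply: sub1; split => //; rewrite /Omega /= x1_lin x2_lin.
      (* The quadratic remainder of the profile is nonnegative as [m > 0], so the first-order
         inequality already places the point in [Omega]. *)
      have key : fprofile m k (h * x1 w + x1 x) = `|x2 x|
          - h * (- (m * x1 x) * x1 w + Num.sg (x2 x) * x2 w)
          + h * (Num.sg (x2 x) * x2 w) + m / 2 * (h * x1 w) ^+ 2.
        by rewrite fE /fprofile; field.
      have key2 : h * (- (m * x1 x) * x1 w + Num.sg (x2 x) * x2 w) < 0.
        by rewrite pmulr_rlt0.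
      have key3 : 0 <= m / 2 * (h * x1 w) ^+ 2.
        by rewrite mulr_ge0 ?sqr_ge0// divr_ge0// ltW.
      move: key2 key3; rewrite {}key; set q2 := m / 2 * _; set q3 := h * (- _ * _ + _).
      move: hs; rewrite ltr_norml.
      case: (ltgtP (x2 x) 0) x2n0 => // hx _.
        rewrite (ltr0_sg hx) (ltr0_norm hx) => /andP[? ?] ? ?.
        by rewrite ltr_norml; apply/andP; split; lra.
      rewrite (gtr0_sg hx) (gtr0_norm hx) => /andP[? ?] ? ?.
      by rewrite ltr_norml; apply/andP; split; lra.
    move=> /hc h1; move: q; rewrite /= /GRing.scale /= pmulr_rgt0 ?invr_gt0//.
    by lra.
  by move=> /filter_ex[].
set g := \row_i 'D_(evec R i) (graph_fun x Q gamma) x.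
have LE i : L (evec R i) = d * Q i 1 - Q i 0.
  by rewrite /L /evec -!rowE !mxE.
have gL i : g 0 i = L (evec R i) by rewrite mxE; have [_ ->] := dgr (evec R i).
have G1 : x1 g = d * Q 0 1 - Q 0 0 by rewrite /x1 gL LE.
have G2 : x2 g = d * Q 1 1 - Q 1 0 by rewrite /x2 gL LE.
have gE w : L w = x1 g * x1 w + x2 g * x2 w.
  by rewrite G1 G2 /L ![(w *m Q) _ _]mxE !sum_ord2 /x1 /x2; ring.
(* By orthogonality of [Q] the product of [g] with the first column of [Q] is -1. *)
have g0 : x1 g ^+ 2 + x2 g ^+ 2 != 0.
  have QQ' := mulmx1C QQ.
  have q00 := congr1 (fun M : 'M[R]_2 => M 0 0) QQ'.
  have q01 := congr1 (fun M : 'M[R]_2 => M 0 1) QQ'.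
  move: q00 q01; rewrite !mxE !sum_ord2 !mxE /= => q00 q01.
  rewrite paddr_eq0 ?sqr_ge0// !sqrf_eq0; apply/negP => /andP[/eqP h1 /eqP h2].
  have : x1 g * Q 0 0 + x2 g * Q 1 0 = -1.
    rewrite G1 G2; transitivity (d * (Q 0 0 * Q 0 1 + Q 1 0 * Q 1 1)
      - (Q 0 0 * Q 0 0 + Q 1 0 * Q 1 0)).
      by ring.
    by rewrite q01 q00 mulr0 sub0r.
  by rewrite h1 h2 !mul0r addr0 => /eqP; rewrite eq_sym oppr_eq0 oner_eq0.
have [l l0 [E1 E2]] : exists2 l, 0 < l & x1 g = l * (- (m * x1 x)) /\ x2 g = l * Num.sg (x2 x).
  apply: halfplane_normal => //.
    by rewrite sqrrN paddr_eq0 ?sqr_ge0// negb_and !sqrf_eq0 sgr_eq0 x2n0 orbT.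
  move=> w1 w2 hw.
  pose w : 'rV[R]_2 := \row_j (if j == 0 then w1 else w2).
  have W1 : x1 w = w1 by rewrite /x1 mxE.
  have W2 : x2 w = w2 by rewrite /x2 mxE.
  by have := inward w; rewrite gE W1 W2; apply.
exists ((enorm g)^-1 *: g), ((enorm g)^-1 * l); split.
- by exists Q, gamma; split.
- rewrite mulr_gt0// invr_gt0 enormE sqrtr_gt0 lt_neqAle eq_sym g0.
  by rewrite addr_ge0 ?sqr_ge0.
- by rewrite -mulrA -E1 /x1 mxE.
- by rewrite -mulrA -E2 /x2 mxE.
Unshelve. all: by end_near. Qed.

(** * Circular fronts *)

Definition arc_center (R : realType) (m k a : R) : R := a / 2 - k / (m * a).

(* [front m k a d y s = 0] is the circle through [(a, f a)] centred at
   [(arc_center m k a + d, 0)]; it is the arc of the paper for [d = 0]. *)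
Definition front (R : realType) (m k a d y s : R) : R :=
  s ^+ 2 - fprofile m k a ^+ 2 + (y - a) * (y + 2 * (k / (m * a)) - 2 * d).

Section front_theory.
Variables (R : realType) (m k : R).
Hypotheses (m0 : 0 < m) (k0 : 0 < k).

Lemma arc_radius_sqr a : arc_radius m k a ^+ 2 =
  (a / 2 + k / (m * a)) ^+ 2 * (m ^+ 2 * a ^+ 2 + 1).
Proof.
rewrite /arc_radius exprMn sqr_sqrtr//.
by rewrite addr_ge0// mulr_ge0 ?sqr_ge0.
Qed.

Lemma arc_radius_tangent a : 0 < a -> arc_radius m k a ^+ 2 =
  (a - arc_center m k a) ^+ 2 + fprofile m k a ^+ 2.
Proof.
move=> a0; rewrite arc_radius_sqr /arc_center /fprofile.
by field; rewrite !gt_eqF.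
Qed.

Lemma front_dist a d y s : front m k a d y s =
  (y - (arc_center m k a + d)) ^+ 2 + s ^+ 2
  - ((a - (arc_center m k a + d)) ^+ 2 + fprofile m k a ^+ 2).
Proof. by rewrite /front /arc_center; set q := k / (m * a); field. Qed.

Lemma front_circle a y s : 0 < a ->
  front m k a 0 y s = (y - arc_center m k a) ^+ 2 + s ^+ 2 - arc_radius m k a ^+ 2.
Proof. by move=> a0; rewrite front_dist arc_radius_tangent// !addr0. Qed.

Lemma fprofile_gt0 y : 0 < fprofile m k y.
Proof. by rewrite /fprofile ltr_wpDl// mulr_ge0 ?sqr_ge0// divr_ge0// ltW. Qed.

Lemma fprofile_norm y : fprofile m k `|y| = fprofile m k y.
Proof. by rewrite /fprofile real_normK// num_real. Qed.

Lemma fprofile_mono y z : 0 <= y -> y <= z -> fprofile m k y <= fprofile m k z.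
Proof.
move=> y_ge0 yz; rewrite /fprofile lerD2r ler_pM2l ?divr_gt0//.
by rewrite lerXn2r ?nnegrE// (le_trans y_ge0).
Qed.

Lemma fprofile_smono y z : 0 <= y -> y < z -> fprofile m k y < fprofile m k z.
Proof.
move=> y_ge0 yz; rewrite /fprofile ltrD2r ltr_pM2l ?divr_gt0//.
by rewrite ltrXn2r ?nnegrE//= (le_trans y_ge0)// ltW.
Qed.

Lemma fprofile_sqr_smono y z : 0 <= y -> y < z ->
  fprofile m k y ^+ 2 < fprofile m k z ^+ 2.
Proof.
move=> y_ge0 yz; rewrite ltrXn2r ?nnegrE//=; try exact: ltW (fprofile_gt0 _).
exact: fprofile_smono.
Qed.

Lemma sqr_le_profile s y : `|s| <= fprofile m k y -> s ^+ 2 <= fprofile m k y ^+ 2.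
Proof.
move=> h; rewrite -[s ^+ 2]real_normK ?num_real// lerXn2r ?nnegrE//.
exact: ltW (fprofile_gt0 _).
Qed.

Lemma front_le a d y s f0 : 0 <= y -> y <= a -> 2 * d <= 2 * (k / (m * a)) ->
  s ^+ 2 <= f0 -> front m k a d y s <= f0 - fprofile m k a ^+ 2.
Proof.
move=> y_ge0 ya ha hs; rewrite /front.
have : 0 <= (a - y) * (y + 2 * (k / (m * a)) - 2 * d) by apply: mulr_ge0; lra.
by lra.
Qed.

Lemma front_lt0 a d y s z : 0 <= y -> y <= a -> 2 * d <= 2 * (k / (m * a)) ->
  0 <= z -> z < a -> `|s| <= fprofile m k z -> front m k a d y s < 0.
Proof.
move=> y_ge0 ya ha z0 za hs.
have h := front_le y_ge0 ya ha (sqr_le_profile hs).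
by have := fprofile_sqr_smono z0 za; lra.
Qed.

Lemma front_gt0 a d y s : 0 < a -> a < y -> 2 * d <= 2 * (k / (m * a)) ->
  `|s| = fprofile m k y -> 0 < front m k a d y s.
Proof.
move=> a0 ay ha hs; rewrite /front -[s ^+ 2]real_normK ?num_real// hs.
have : 0 <= (y - a) * (y + 2 * (k / (m * a)) - 2 * d) by apply: mulr_ge0; lra.
by have := fprofile_sqr_smono (ltW a0) ay; lra.
Qed.

(** After cancellation of the terms in [k / m], the difference of the two fronts is a sum of
    nonnegative terms; the condition on [d - d'] controls the coefficient of [y]. *)
Lemma front_mono a a' d d' y s : 0 < a -> a < a' -> d' <= 0 -> 0 <= d ->
  2 * (d - d') <= a' - a -> 0 <= y ->
  front m k a' d' y s < front m k a d y s.
Proof.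
move=> a0 aa d'0 d0 hd y0; rewrite -subr_gt0.
have a'0 : 0 < a' := lt_trans a0 aa.
have E : front m k a d y s - front m k a' d' y s =
  (fprofile m k a' ^+ 2 - fprofile m k a ^+ 2)
  + y * (a' - a - 2 * (d - d')) + y * (2 * (k / (m * a)) - 2 * (k / (m * a')))
  + 2 * d * a - 2 * d' * a'.
  by rewrite /front; field; rewrite !gt_eqF.
rewrite E.
have h1 := fprofile_sqr_smono (ltW a0) aa.
have h2 : 0 <= y * (a' - a - 2 * (d - d')) by apply: mulr_ge0; lra.
have h3 : k / (m * a') <= k / (m * a).
  by rewrite ler_pM2l// lef_pV2 ?posrE ?mulr_gt0// ler_pM2l// ltW.
have h4 : 0 <= y * (2 * (k / (m * a)) - 2 * (k / (m * a'))) by apply: mulr_ge0; lra.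
have h5 : 0 <= d * a by apply: mulr_ge0 => //; exact: ltW.
have h6 : d' * a' <= 0 by apply: mulr_le0_ge0 => //; exact: ltW.
lra.
Qed.

(** The left-hand side is, up to a positive factor, the normal derivative of the front at a boundary
    point of abscissa [y]. For [d = 0] it vanishes at [y = a], which is the perpendicularity of the
    arc; the shift adds a term with the sign of [d]. *)
Lemma boundary_normal_front a d y : 0 < a ->
  fprofile m k y - m * y * (y - (arc_center m k a + d)) =
  (a - y) * (k / a + m * y / 2) + m * d * y.
Proof. by move=> a0; rewrite /fprofile /arc_center; field; rewrite !gt_eqF. Qed.

(** Near [x1 = 0], [w] and [P] stand for the smoothed absolute value and for [y] times its
    derivative. As [b] is at most half of [a], the subtracted term is at most [k / 2], while the
    profile is at least [k]. *)
Lemma boundary_normal_cap a d b y P w : 0 < b -> 2 * b <= a -> 0 < d ->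
  0 <= P -> P <= b -> 0 <= w -> w <= b ->
  0 < fprofile m k y - m * P * (w - (arc_center m k a + d)).
Proof.
move=> b0 ba d0 P0 Pb w0 wb.
have fk : k <= fprofile m k y.
  by rewrite /fprofile lerDr mulr_ge0 ?sqr_ge0// divr_ge0// ltW.
have a0 : 0 < a by lra.
have h : w - (arc_center m k a + d) <= k / (m * a).
  by rewrite /arc_center; lra.
have [wq|wq] := leP (w - (arc_center m k a + d)) 0.
  have : 0 <= m * P * (- (w - (arc_center m k a + d))).
    by rewrite mulr_ge0 ?oppr_ge0// mulr_ge0// ltW.
  by move: k0; lra.
have : m * P * (w - (arc_center m k a + d)) <= m * b * (k / (m * a)).
  apply: ler_pM => //; [by rewrite mulr_ge0// ltW|exact: ltW|by rewrite ler_pM2l].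
have -> : m * b * (k / (m * a)) = k * (b / a) by field; rewrite !gt_eqF.
have : b / a <= 2^-1 by rewrite ler_pdivrMr//; lra.
move=> hb; have : k * (b / a) <= k * 2^-1 by rewrite ler_pM2l.
by move: k0; lra.
Qed.

(* [a^2 (r(a)^2 - r(a1)^2)] is a cubic in [a^2] with the roots [a1^2], [a2^2]. *)
Lemma arc_radius_factor a a1 a2 : 0 < a -> 0 < a1 -> a1 < a2 ->
  arc_radius m k a1 = arc_radius m k a2 ->
  a ^+ 2 * (arc_radius m k a ^+ 2 - arc_radius m k a1 ^+ 2) =
  (a ^+ 2 - a1 ^+ 2) * (a ^+ 2 - a2 ^+ 2)
    * (m ^+ 2 / 4 * a ^+ 2 + k ^+ 2 / (m ^+ 2 * a1 ^+ 2 * a2 ^+ 2)).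
Proof.
move=> a0 a10 a12 E; have a20 : 0 < a2 := lt_trans a10 a12.
have {E} : arc_radius m k a2 ^+ 2 - arc_radius m k a1 ^+ 2 = 0.
  by rewrite E subrr.
rewrite !arc_radius_sqr.
have H (x : R) : 0 < x -> (x / 2 + k / (m * x)) ^+ 2 * (m ^+ 2 * x ^+ 2 + 1) =
    m ^+ 2 / 4 * (x ^+ 2) ^+ 2 + (m * k + 1 / 4) * x ^+ 2 + (k ^+ 2 + k / m)
    + k ^+ 2 / m ^+ 2 / x ^+ 2.
  by move=> x0; field; rewrite !gt_eqF.
rewrite !H//; set y := a ^+ 2; set y1 := a1 ^+ 2; set y2 := a2 ^+ 2.
have y0 : 0 < y by rewrite exprn_gt0.
have y10 : 0 < y1 by rewrite exprn_gt0.
have y20 : 0 < y2 by rewrite exprn_gt0.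
have y12 : y1 < y2 by rewrite ltrXn2r ?nnegrE// ltW.
set g := k ^+ 2 / m ^+ 2 => E.
have -> : k ^+ 2 / (m ^+ 2 * y1 * y2) = g / (y1 * y2).
  by rewrite /g; field; rewrite !gt_eqF.
(* The equality of the radii, divided by [y2 - y1], expresses the linear coefficient through the two
   roots; the factorisation is then an identity. *)
have E' : m * k + 1 / 4 = g / (y1 * y2) - m ^+ 2 / 4 * (y1 + y2).
  have d0 : y2 - y1 != 0 by rewrite subr_eq0 gt_eqF.
  apply: (mulfI d0); apply/eqP; rewrite -subr_eq0 -E; apply/eqP.
  by field; rewrite !gt_eqF.
rewrite E'; field; rewrite !gt_eqF//.
Qed.

(** Only the part of the factorisation proportional to [a^2] is kept; dividing by [a^2] makes the
    gap uniform down to [a = 0]. *)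
Lemma arc_radius_below a1 a2 hi a : 0 < a -> a <= hi -> hi < a1 -> a1 < a2 ->
  arc_radius m k a1 = arc_radius m k a2 ->
  m ^+ 2 / 4 * ((a1 ^+ 2 - hi ^+ 2) * (a2 ^+ 2 - hi ^+ 2))
    <= arc_radius m k a ^+ 2 - arc_radius m k a1 ^+ 2.
Proof.
move=> a0 ah h1 h2 E.
have hi0 : 0 < hi by apply: lt_le_trans ah.
have a10 : 0 < a1 := lt_trans hi0 h1.
have := arc_radius_factor a0 a10 h2 E.
set g := k ^+ 2 / _; set D := _ - _ => F.
have g0 : 0 <= g.
  by rewrite divr_ge0 ?sqr_ge0// mulr_ge0 ?sqr_ge0// mulr_ge0 ?sqr_ge0.
have y0 : 0 < a ^+ 2 by rewrite exprn_gt0.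
rewrite -(ler_pM2l y0) F.
have yh : a ^+ 2 <= hi ^+ 2 by rewrite lerXn2r ?nnegrE// ltW.
have h1' : hi ^+ 2 < a1 ^+ 2 by rewrite ltrXn2r ?nnegrE// ltW.
have h2' : a1 ^+ 2 < a2 ^+ 2 by rewrite ltrXn2r ?nnegrE// ltW// (lt_trans a10).
move: y0 yh h1' h2'; set y := a ^+ 2; set u := hi ^+ 2; set v := a1 ^+ 2; set w := a2 ^+ 2.
move=> y0 yu uv vw.
have m40 : 0 < m ^+ 2 / 4 by rewrite divr_gt0// exprn_gt0.
have P : (v - u) * (w - u) <= (y - v) * (y - w).
  by rewrite -(mulrNN (y - v)); apply: ler_pM; lra.
have P0 : 0 <= (v - u) * (w - u) by apply: mulr_ge0; lra.
have : 0 <= (y - v) * (y - w) * g by apply: mulr_ge0 => //; lra.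
have : m ^+ 2 / 4 * y * ((v - u) * (w - u)) <= m ^+ 2 / 4 * y * ((y - v) * (y - w)).
  by rewrite ler_pM2l// mulr_gt0.
lra.
Qed.

Lemma arc_radius_between a1 a2 lo hi a : 0 < a1 -> a1 < lo -> lo <= a -> a <= hi ->
  hi < a2 -> arc_radius m k a1 = arc_radius m k a2 ->
  m ^+ 2 / 4 * ((lo ^+ 2 - a1 ^+ 2) * (a2 ^+ 2 - hi ^+ 2))
    <= arc_radius m k a1 ^+ 2 - arc_radius m k a ^+ 2.
Proof.
move=> a10 h1 la ah h2 E.
have lo0 : 0 < lo := lt_trans a10 h1.
have a0 : 0 < a by apply: lt_le_trans la.
have a12 : a1 < a2 by lra.
have := arc_radius_factor a0 a10 a12 E.
set g := k ^+ 2 / _ => F.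
have g0 : 0 <= g.
  by rewrite divr_ge0 ?sqr_ge0// mulr_ge0 ?sqr_ge0// mulr_ge0 ?sqr_ge0.
have y0 : 0 < a ^+ 2 by rewrite exprn_gt0.
rewrite -(ler_pM2l y0).
have -> : a ^+ 2 * (arc_radius m k a1 ^+ 2 - arc_radius m k a ^+ 2) =
  - (a ^+ 2 * (arc_radius m k a ^+ 2 - arc_radius m k a1 ^+ 2)) by ring.
rewrite F.
have q (x z : R) : 0 < x -> x < z -> x ^+ 2 < z ^+ 2.
  by move=> x0 xz; rewrite ltrXn2r ?nnegrE// ltW// (lt_trans x0).
have q' (x z : R) : 0 < x -> x <= z -> x ^+ 2 <= z ^+ 2.
  by move=> x0 xz; rewrite lerXn2r ?nnegrE// ltW// (lt_le_trans x0).
have := q' _ _ a0 ah; have := q' _ _ lo0 la; have := q _ _ a10 h1.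
have := q _ _ (lt_le_trans a0 ah) h2.
move: y0; set y := a ^+ 2; set u := hi ^+ 2; set v := a1 ^+ 2; set w := a2 ^+ 2.
set l := lo ^+ 2 => y0 uw vl ly yu.
have m40 : 0 < m ^+ 2 / 4 by rewrite divr_gt0// exprn_gt0.
have P : (l - v) * (w - u) <= (y - v) * (w - y) by apply: ler_pM; lra.
have P0 : 0 <= (l - v) * (w - u) by apply: mulr_ge0; lra.
have : 0 <= (y - v) * (w - y) * g by apply: mulr_ge0 => //; lra.
have : m ^+ 2 / 4 * y * ((l - v) * (w - u)) <= m ^+ 2 / 4 * y * ((y - v) * (w - y)).
  by rewrite ler_pM2l// mulr_gt0.
lra.
Qed.

End front_theory.

(* A [C^2] even function equal to the absolute value outside of [`]-b, b[].  It
   removes the kink at [x1 = 0] of the pair of symmetric arcs. *)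
Definition sabs (R : realType) (b x : R) : R :=
  (pos_cube (x + b) + -2 * pos_cube x + pos_cube (x - b)) * (3 * b ^+ 2)^-1 - x.

(** Away from []-b, b[] the second difference of the cube is either [6 * b ^+ 2 * x] or 0, which
    gives [x] or [- x] after normalisation. *)
Lemma sabs_C2R (R : realType) (b : R) : 0 < b -> exists w1 w2 : R -> R,
  [/\ C2R (sabs b) w1 w2,
      forall x, b <= `|x| -> [/\ sabs b x = `|x|, w1 x ^+ 2 = 1, x * w1 x = `|x| & w2 x = 0] &
      forall x, `|x| <= b -> [/\ 0 <= sabs b x, sabs b x <= b, 0 <= x * w1 x & x * w1 x <= b]].
Proof.
move=> b0.
have H1 := C2R_add (C2R_add (C2R_shift b (C2R_pos_cube R))
  (C2R_mul (C2R_cst (-2)) (C2R_pos_cube R))) (C2R_shift (- b) (C2R_pos_cube R)).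
have H2 := C2R_add (C2R_mul H1 (C2R_cst (3 * b ^+ 2)^-1)) (C2R_linear_comb (-1) 0).
pose w1 x : R := (Num.max (x + b) 0 ^+ 2 - 2 * Num.max x 0 ^+ 2
  + Num.max (x - b) 0 ^+ 2) / b ^+ 2 - 1.
pose w2 x : R := 2 * (Num.max (x + b) 0 - 2 * Num.max x 0 + Num.max (x - b) 0) / b ^+ 2.
have bn0 : b != 0 by rewrite gt_eqF.
have H : C2R (sabs b) w1 w2.
  move: H2; congr C2R; apply/funext => x.
  - by rewrite /sabs mulN1r addr0.
  - by rewrite /w1; field.
  - by rewrite /w2; field.
have mp (x : R) : 0 <= x -> Num.max x 0 = x by move=> ?; exact/max_idPl.
have mn (x : R) : x <= 0 -> Num.max x 0 = 0 by move=> ?; exact/max_idPr.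
exists w1, w2; split => // x.
  have [x0|x0] := leP 0 x.
    rewrite ger0_norm// => bx.
    rewrite /sabs /w1 /w2 /pos_cube !mp//; try lra.
    by split; field.
  rewrite ltr0_norm// => bx.
  rewrite /sabs /w1 /w2 /pos_cube !mn//; try lra.
  by split; field.
have b2 : 0 < b ^+ 2 by rewrite exprn_gt0.
(* By evenness both signs of [x] reduce to the same two polynomials in [z], the absolute value of
   [x]. *)
have P (z : R) : 0 <= z -> z <= b ->
    let s := (b ^+ 3 + 3 * b * z ^+ 2 - z ^+ 3) / (3 * b ^+ 2) in
    let t := z * (2 * b * z - z ^+ 2) / b ^+ 2 in
    [/\ 0 <= s, s <= b, 0 <= t & t <= b].
  move=> z0 zb; have z2 := sqr_ge0 z.
  have bz : 0 <= b * z by rewrite mulr_ge0// ltW.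
  have zz : z ^+ 2 <= b * z by rewrite expr2 ler_wpM2r.
  have zz2 : z * z ^+ 2 <= b * z ^+ 2 by rewrite ler_wpM2r.
  have b3 : 0 < b ^+ 3 by rewrite exprn_gt0.
  have bz2 : 0 <= b * z ^+ 2 by rewrite mulr_ge0// ltW.
  split.
  - by rewrite divr_ge0 ?mulr_ge0 ?ltW// exprS; lra.
  - rewrite ler_pdivrMr ?mulr_gt0// -subr_ge0.
    have -> : b * (3 * b ^+ 2) - (b ^+ 3 + 3 * b * z ^+ 2 - z ^+ 3) =
      (b - z) * (2 * b ^+ 2 + 2 * (b * z) - z ^+ 2) by ring.
    by apply: mulr_ge0; lra.
  - apply: divr_ge0; last exact: ltW.
    by apply: mulr_ge0 => //; lra.
  - rewrite ler_pdivrMr// -subr_ge0.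
    have -> : b * b ^+ 2 - z * (2 * b * z - z ^+ 2) =
      (b - z) * (b ^+ 2 + b * z - z ^+ 2) by ring.
    by apply: mulr_ge0; lra.
have [x0|x0] := leP 0 x.
  rewrite ger0_norm// => bx.
  have E1 : sabs b x = (b ^+ 3 + 3 * b * x ^+ 2 - x ^+ 3) / (3 * b ^+ 2).
    rewrite /sabs /pos_cube (mp x)// (mp (x + b)) ?(mn (x - b)); try lra.
    by field.
  have E2 : x * w1 x = x * (2 * b * x - x ^+ 2) / b ^+ 2.
    rewrite /w1 (mp x)// (mp (x + b)) ?(mn (x - b)); try lra.
    by field.
  by rewrite E1 E2; exact: P.
rewrite ltr0_norm// => bx.
have E1 : sabs b x = (b ^+ 3 + 3 * b * (- x) ^+ 2 - (- x) ^+ 3) / (3 * b ^+ 2).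
  rewrite /sabs /pos_cube (mn x) ?(mp (x + b)) ?(mn (x - b)); try lra.
  by field.
have E2 : x * w1 x = (- x) * (2 * b * (- x) - (- x) ^+ 2) / b ^+ 2.
  rewrite /w1 (mn x) ?(mp (x + b)) ?(mn (x - b)); try lra.
  by field.
by rewrite E1 E2; apply: P; lra.
Qed.

(** * Moving fronts: derivatives, speed and curvature slack *)

Lemma C2f_x1 (R : realType) :
  C2f (fun z : 'rV[R]_2 * R => x1 z.1) (fun v _ => x1 v.1) (fun _ _ _ => 0).
Proof.
apply: (@C2f_linear _ _ (fun z : 'rV[R]_2 * R => x1 z.1)).
  by move=> a u v; rewrite -x1_lin.
exact: continuous_fun_comp (@continuous_fst _ _) (@x1_continuous R).
Qed.

Lemma C2f_x2 (R : realType) :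
  C2f (fun z : 'rV[R]_2 * R => x2 z.1) (fun v _ => x2 v.1) (fun _ _ _ => 0).
Proof.
apply: (@C2f_linear _ _ (fun z : 'rV[R]_2 * R => x2 z.1)).
  by move=> a u v; rewrite -x2_lin.
exact: continuous_fun_comp (@continuous_fst _ _) (@x2_continuous R).
Qed.

Lemma x1_evec0 (R : realType) : x1 (evec R (0 : 'I_2)) = 1.
Proof. by rewrite /x1 mxE. Qed.
Lemma x1_evec1 (R : realType) : x1 (evec R (1 : 'I_2)) = 0.
Proof. by rewrite /x1 mxE. Qed.
Lemma x2_evec0 (R : realType) : x2 (evec R (0 : 'I_2)) = 0.
Proof. by rewrite /x2 mxE. Qed.
Lemma x2_evec1 (R : realType) : x2 (evec R (1 : 'I_2)) = 1.
Proof. by rewrite /x2 mxE. Qed.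

(** Expanding [front] in powers of the first coordinate separates time from space: [A] is twice the
    abscissa of the centre and [B] collects the constant terms. *)
Lemma moving_front_C2f (R : realType) (sg : R) (w w1 w2 A A1 A2 B B1 B2 : R -> R) :
  C2R w w1 w2 -> C2R A A1 A2 -> C2R B B1 B2 ->
  exists d1 d2,
    C2f (fun z : 'rV[R]_2 * R =>
      sg * (x2 z.1 ^+ 2 + w (x1 z.1) ^+ 2 - A z.2 * w (x1 z.1) - B z.2)) d1 d2 /\
    forall z : 'rV[R]_2 * R,
    [/\ x1 (Dspace d1 z) = sg * (w1 (x1 z.1) * (2 * w (x1 z.1) - A z.2)),
        x2 (Dspace d1 z) = sg * (2 * x2 z.1),
        d1 (0, 1) z = - sg * (A1 z.2 * w (x1 z.1) + B1 z.2) &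
        [/\ D2space d2 z 0 0 =
              sg * (2 * w1 (x1 z.1) ^+ 2 + w2 (x1 z.1) * (2 * w (x1 z.1) - A z.2)),
            D2space d2 z 0 1 = 0, D2space d2 z 1 0 = 0 & D2space d2 z 1 1 = sg * 2]].
Proof.
move=> Hw HA HB.
have h2 := C2f_mul (C2f_x2 R) (C2f_x2 R).
have hw := C2f_comp Hw (C2f_x1 R).
have hA := C2f_comp HA (C2f_snd 'rV[R]_2).
have hB := C2f_comp HB (C2f_snd 'rV[R]_2).
have hm := C2f_cst ('rV[R]_2 * R)%type (-1).
have H := C2f_mul (C2f_cst _ sg) (C2f_add (C2f_add (C2f_add h2 (C2f_mul hw hw))
  (C2f_mul hm (C2f_mul hA hw))) (C2f_mul hm hB)).
have E : (fun z : 'rV[R]_2 * R => sg * (x2 z.1 ^+ 2 + w (x1 z.1) ^+ 2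
    - A z.2 * w (x1 z.1) - B z.2)) = (fun z => sg * (x2 z.1 * x2 z.1
    + w (x1 z.1) * w (x1 z.1) + -1 * (A z.2 * w (x1 z.1)) + -1 * B z.2)).
  by apply/funext => z; ring.
rewrite E; eexists; eexists; split; first exact: H.
move=> z; split.
- by rewrite {1}/x1 mxE /= x1_evec0 x2_evec0; ring.
- by rewrite {1}/x2 mxE /= x1_evec1 x2_evec1; ring.
- by rewrite /= /x1 /x2 !mxE; ring.
- by split; rewrite mxE /= ?x1_evec0 ?x2_evec0 ?x1_evec1 ?x2_evec1; ring.
Qed.

(* The square keeps the denominator positive for negative times too, where test
   functions are also required to be smooth. *)
Definition arc_position (R : realType) (A D nu t : R) : R :=
  A - D * (1 + nu * t * (nu * t))^-1.

Lemma arc_position_denom (R : realType) (nu t : R) : 1 <= 1 + nu * t * (nu * t).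
Proof. by rewrite lerDl -expr2 sqr_ge0. Qed.

Lemma arc_position_weight (R : realType) (nu t : R) :
  0 <= (1 + nu * t * (nu * t))^-1 <= 1.
Proof.
have h := arc_position_denom nu t.
by rewrite invr_ge0 (le_trans ler01)//= invf_le1// (lt_le_trans ltr01).
Qed.

Lemma arc_position_range (R : realType) (A D nu t lo hi : R) :
  lo <= A -> A <= hi -> lo <= A - D -> A - D <= hi ->
  lo <= arc_position A D nu t <= hi.
Proof.
move=> h1 h2 h3 h4; rewrite /arc_position.
by have /andP[] := arc_position_weight nu t; set q := _^-1 => q0 q1; apply/andP; split; nra.
Qed.

Lemma arc_position0 (R : realType) (A D nu : R) : arc_position A D nu 0 = A - D.
Proof. by rewrite /arc_position !mulr0 addr0 invr1 mulr1. Qed.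

(** The bound on the derivative is proportional to [nu], so the motion can be made as slow as the
    slack requires. *)
Lemma arc_position_C2R (R : realType) (A D nu : R) : 0 < nu ->
  exists a1 a2, C2R (arc_position A D nu) a1 a2 /\ forall t, `|a1 t| <= `|D| * nu.
Proof.
move=> nu0.
have n0 t : 1 + nu * t * (nu * t) != 0.
  by rewrite gt_eqF// (lt_le_trans ltr01)// arc_position_denom.
have hl := C2R_mul (C2R_cst nu) (C2R_id R).
have H := C2R_add (C2R_cst A) (C2R_mul (C2R_cst (- D))
  (C2R_inv n0 (C2R_add (C2R_cst 1) (C2R_mul hl hl)))).
have E : arc_position A D nu = (fun t => A + - D * (1 + nu * t * (nu * t))^-1).
  by apply/funext => t; rewrite /arc_position mulNr.
rewrite E; eexists; eexists; split; first exact: H.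
move=> t /=.
set q := 1 + nu * t * (nu * t).
have q1 : 1 <= q := arc_position_denom nu t.
have q0 : 0 < q := lt_le_trans ltr01 q1.
have -> : 0 + (0 * q^-1 + - D *
    (- (0 + ((0 * t + nu * 1) * (nu * t) + nu * t * (0 * t + nu * 1))) / q ^+ 2))
   = D * (nu * (2 * (nu * t) / q ^+ 2)) by field; rewrite gt_eqF.
rewrite normrM (normrM nu) (gtr0_norm nu0) ler_wpM2l// ler_piMr//; first exact: ltW.
rewrite normrM normfV (gtr0_norm (exprn_gt0 2 q0)) ler_pdivrMr ?exprn_gt0// mul1r.
(* With [q] equal to 1 plus the square of [nu * t], twice [nu * t] is at most [q] in absolute value,
   and [q <= q ^+ 2]. *)
apply: (@le_trans _ _ q); last by rewrite expr2 ler_peMr// ltW.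
have := sqr_ge0 (1 - nu * t); have := sqr_ge0 (1 + nu * t).
by rewrite ler_norml /q => ? ?; apply/andP; split; lra.
Qed.

Lemma arc_position_cvg (R : realType) (A D nu : R) : 0 < nu ->
  arc_position A D nu t @[t --> +oo] --> A.
Proof.
move=> nu0.
have inv0 : (1 + nu * t * (nu * t))^-1 @[t --> +oo] --> (0 : R).
  apply/cvgrPdist_lt => e e0; near=> t.
  have h := arc_position_denom nu t.
  have h0 : 0 < 1 + nu * t * (nu * t) := lt_le_trans ltr01 h.
  rewrite sub0r normrN gtr0_norm ?invr_gt0// invf_plt ?posrE//.
  have t1 : 1 <= nu * t.
    by rewrite mulrC -ler_pdivrMr//; near: t; apply: nbhs_pinfty_ge; exact: num_real.
  have t2 : e^-1 <= nu * t.
    by rewrite mulrC -ler_pdivrMr//; near: t; apply: nbhs_pinfty_ge; exact: num_real.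
  have : nu * t <= nu * t * (nu * t) by rewrite ler_peMr// (le_trans ler01).
  by lra.
have : (fun t => A - D * (1 + nu * t * (nu * t))^-1) @ +oo --> A - D * 0.
  by apply: cvgB; [exact: cvg_cst|apply: cvgM; [exact: cvg_cst|exact: inv0]].
by rewrite mulr0 subr0.
Unshelve. all: by end_near. Qed.

(** Here [X] is [c] times a distance to the centre: slack is available for squared radii, but the
    operator involves the distance itself. *)
Lemma slack_linear (R : realType) (sg s0 X : R) : sg = 1 \/ sg = -1 ->
  0 < s0 -> s0 <= 1 -> 0 <= X -> s0 / 2 <= sg * (X ^+ 2 - 1) -> s0 / 8 <= sg * (X - 1).
Proof. by case=> -> s00 s01 X0 h; nra. Qed.

(* For a circular front [`|p|] is twice the distance [rho] to the centre, and the
   right-hand side is [2 sg (c rho - 1)]. *)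
Lemma Fop_circle (R : realType) (sg c : R) (x p : 'rV[R]_2) (X : 'M[R]_2) :
  sg = 1 \/ sg = -1 -> x1 p ^+ 2 + x2 p ^+ 2 != 0 ->
  X 0 0 = sg * 2 -> X 0 1 = 0 -> X 1 0 = 0 -> X 1 1 = sg * 2 ->
  Fop (sg * c) (x, - p, - X) =
    2 * (sg * (c * (Num.sqrt (x1 p ^+ 2 + x2 p ^+ 2) / 2) - 1)).
Proof.
move=> hs n0 E00 E01 E10 E11; rewrite FopE !mxE E00 E01 E10 E11.
have -> : x1 (- p) = - x1 p by rewrite /x1 mxE.
have -> : x2 (- p) = - x2 p by rewrite /x2 mxE.
rewrite !sqrrN; set r := Num.sqrt _.
by field.
Qed.

Lemma front_mono_sg (R : realType) (m k sg a a' d y s : R) : 0 < m -> 0 < k ->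
  sg = 1 \/ sg = -1 -> 0 < a -> 0 < a' -> 0 < sg * (a' - a) ->
  0 <= d -> 2 * d <= sg * (a' - a) -> 0 <= y ->
  sg * front m k a' 0 y s < sg * front m k a (sg * d) y s.
Proof.
move=> m0 k0 [->|->] a0 a'0; rewrite ?mul1r ?mulN1r => h d0 hd y0.
  by apply: front_mono => //; lra.
by rewrite ltrN2; apply: front_mono => //; lra.
Qed.

Lemma front_time_C2R (R : realType) (m k d : R) (a a1 a2 : R -> R) : 0 < m ->
  (forall t, 0 < a t) -> C2R a a1 a2 ->
  exists A1 A2 B1 B2,
  [/\ C2R (fun t => a t - 2 * (k / (m * a t)) + 2 * d) A1 A2,
      C2R (fun t => fprofile m k (a t) ^+ 2 + 2 * (k / m) - 2 * d * a t) B1 B2 &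
      forall t, A1 t = a1 t * (1 + 2 * (k / m) / a t ^+ 2) /\
        B1 t = a1 t * (2 * m * a t * fprofile m k (a t) - 2 * d)].
Proof.
move=> m0 apos Ha.
have an0 t : a t != 0 by rewrite gt_eqF.
have HA := C2R_add (C2R_add Ha (C2R_mul (C2R_cst (- (2 * (k / m)))) (C2R_inv an0 Ha)))
  (C2R_cst (2 * d)).
have Hf := C2R_add (C2R_mul (C2R_cst (m / 2)) (C2R_mul Ha Ha)) (C2R_cst k).
have HB := C2R_add (C2R_add (C2R_mul Hf Hf) (C2R_cst (2 * (k / m))))
  (C2R_mul (C2R_cst (- (2 * d))) Ha).
have EA : (fun t => a t - 2 * (k / (m * a t)) + 2 * d) =
    (fun t => a t + - (2 * (k / m)) * (a t)^-1 + 2 * d).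
  by apply/funext => t; field; rewrite an0 gt_eqF.
have EB : (fun t => fprofile m k (a t) ^+ 2 + 2 * (k / m) - 2 * d * a t) =
    (fun t => (m / 2 * (a t * a t) + k) * (m / 2 * (a t * a t) + k) + 2 * (k / m)
      + - (2 * d) * a t).
  by apply/funext => t; rewrite /fprofile; ring.
rewrite EA EB; do 4 eexists; split; [exact: HA|exact: HB|].
move=> t; split; first by field; rewrite an0 gt_eqF.
by rewrite /fprofile; field.
Qed.

Lemma front_slack (R : realType) (m k c sg a d y s e s0 Lp : R) :
  0 < a -> 0 < c -> sg = 1 \/ sg = -1 -> 0 <= d -> 0 < s0 -> s0 <= 1 ->
  s0 <= sg * (c ^+ 2 * arc_radius m k a ^+ 2 - 1) ->
  0 < m -> a - arc_center m k a <= Lp ->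
  c ^+ 2 * e <= s0 / 4 -> c ^+ 2 * (2 * d * Lp + d ^+ 2) <= s0 / 4 ->
  - e <= sg * front m k a (sg * d) y s ->
  s0 / 8 <= sg * (c * (Num.sqrt ((2 * y - (a - 2 * (k / (m * a)) + 2 * (sg * d))) ^+ 2
    + (2 * s) ^+ 2) / 2) - 1).
Proof.
move=> a0 c0 hsg d0 s00 s01 hs m0 hL he hd hfront.
apply: slack_linear => //.
  by apply: mulr_ge0; [exact: ltW|apply: divr_ge0 => //; exact: sqrtr_ge0].
rewrite exprMn expr_div_n sqr_sqrtr ?addr_ge0 ?sqr_ge0//.
set q := _ / 2 ^+ 2.
have c2 : 0 < c ^+ 2 by rewrite exprn_gt0.
(* [q] is the squared distance to the shifted centre. It differs from the squared radius of the
   perpendicular arc by the value of [front] and by terms of order [d]; each error uses up a quarter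
   of [s0]. *)
have E : q = arc_radius m k a ^+ 2 + (front m k a (sg * d) y s
    - 2 * (sg * d) * (a - arc_center m k a) + (sg * d) ^+ 2).
  rewrite /q front_dist arc_radius_tangent// /arc_center.
  by set z := k / (m * a); field.
have sg2 : sg * sg = 1 by case: hsg => ->; ring.
have -> : sg * (c ^+ 2 * q - 1) = sg * (c ^+ 2 * arc_radius m k a ^+ 2 - 1)
   + c ^+ 2 * (sg * front m k a (sg * d) y s - (sg * sg) * (2 * d * (a - arc_center m k a))
     + (sg * sg) * (sg * d ^+ 2)).
  by rewrite E; ring.
rewrite sg2 !mul1r.
have h1 : d * (a - arc_center m k a) <= d * Lp by rewrite ler_wpM2l.
have h2 : - d ^+ 2 <= sg * d ^+ 2.
  by case: hsg => ->; have := sqr_ge0 d; lra.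
have : c ^+ 2 * (- e - (2 * d * Lp + d ^+ 2)) <= c ^+ 2 * (sg * front m k a (sg * d) y s
    - 2 * d * (a - arc_center m k a) + sg * d ^+ 2).
  by rewrite ler_pM2l//; lra.
by move: hs he hd; lra.
Qed.

(** * Values of the barrier and choice of small parameters *)

Lemma bounded_closure_compact (R : realType) (B : set 'rV[R]_2) :
  bounded_set B -> compact (closure B).
Proof.
move=> bB; apply: bounded_closed_compact; last exact: closed_closure.
have [M M0 HM] := ex_strict_bound_gt0 bB.
exists M; split; first exact: num_real.
move=> N MN y By; apply: (le_trans _ (ltW MN)).
rewrite -subr_ge0; apply: (closure_pos_ge0 (h := fun z => M - `|z|) _ _ By).
  by apply: continuous_add; [exact: cst_continuous|apply: continuous_opp; exact: norm_continuous].
by move=> z Bz; rewrite subr_gt0; exact: HM.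
Qed.

Lemma pos_cube_le (R : realType) (x y : R) : x <= y -> pos_cube x <= pos_cube y.
Proof.
move=> xy; have q (z : R) : 0 <= Num.max z 0 by rewrite le_max lexx orbT.
by rewrite /pos_cube lerXn2r ?nnegrE// ge_max !le_max xy lexx !orbT.
Qed.

Lemma barrier_le (R : realType) (b K e : R) G z : 0 <= K -> barrier b K e G z <= b.
Proof.
move=> K0; rewrite /barrier lerBlDr lerDl mulr_ge0// /pos_cube exprn_ge0//.
by rewrite le_max lexx orbT.
Qed.

(** The constant is such that the barrier falls from [be] to [al] as [G] rises from [- e] to 0. A
    function bounded below by [al] can then be touched only where [G <= 0]. *)
Lemma barrier_low (R : realType) (al be e : R) G z : 0 < e -> al <= be ->
  0 <= G z -> barrier be ((be - al) / e ^+ 3) e G z <= al.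
Proof.
move=> e0 ab G0; rewrite /barrier.
have : e ^+ 3 <= pos_cube (G z + e).
  apply: le_trans (@pos_cube_le _ e _ _); last by rewrite lerDr.
  by rewrite /pos_cube (max_idPl (ltW e0)).
have e3 : 0 < e ^+ 3 by rewrite exprn_gt0.
move=> h; have : (be - al) / e ^+ 3 * e ^+ 3 <= (be - al) / e ^+ 3 * pos_cube (G z + e).
  by apply: ler_wpM2l => //; apply: divr_ge0; [lra|exact: ltW].
by rewrite divfK ?gt_eqF//; lra.
Qed.

Lemma pos_lower_bound (R : realDomainType) (M : seq R) : all (fun q => 0 < q) M ->
  exists2 d : R, 0 < d & forall q, q \in M -> d <= q.
Proof.
elim: M => [|q M IH] /=; first by exists 1.
move=> /andP[q0 /IH[d d0 hd]]; exists (Num.min q d); first by rewrite lt_min q0.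
move=> z; rewrite inE => /orP[/eqP ->|/hd h]; first by rewrite ge_min lexx.
by rewrite ge_min h orbT.
Qed.

Lemma small_shift (R : realType) (q1 q2 q3 q4 q5 c Lp s0 : R) :
  0 < q1 -> 0 < q2 -> 0 < q3 -> 0 < q4 -> 0 < q5 -> 0 < c -> 0 < Lp -> 0 < s0 ->
  exists2 d, 0 < d &
  [/\ d <= 1, d <= q1, 2 * d <= q2, 2 * d <= q3 &
   [/\ 2 * d <= q4, d <= q5 & c ^+ 2 * (2 * d * Lp + d ^+ 2) <= s0 / 4]].
Proof.
move=> p1 p2 p3 p4 p5 c0 L0 s00.
have c2 : 0 < c ^+ 2 by rewrite exprn_gt0.
have L1 : 0 < 2 * Lp + 1 by lra.
have p6 : 0 < s0 / (4 * c ^+ 2 * (2 * Lp + 1)) by rewrite divr_gt0// !mulr_gt0.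
have p7 (z : R) : 0 < z -> 0 < z / 2 by move=> ?; rewrite divr_gt0.
have [|d d0 hd] := @pos_lower_bound R [:: 1; q1; q2 / 2; q3 / 2; q4 / 2; q5;
    s0 / (4 * c ^+ 2 * (2 * Lp + 1))].
  by rewrite /= ltr01 p1 p5 p6 !p7.
have h1 : d <= 1 by apply: hd; rewrite !inE eqxx.
have h2 : d <= q1 by apply: hd; rewrite !inE eqxx ?orbT.
have h3 : d <= q2 / 2 by apply: hd; rewrite !inE eqxx ?orbT.
have h4 : d <= q3 / 2 by apply: hd; rewrite !inE eqxx ?orbT.
have h5 : d <= q4 / 2 by apply: hd; rewrite !inE eqxx ?orbT.
have h7 : d <= q5 by apply: hd; rewrite !inE eqxx ?orbT.
have h6 : d <= s0 / (4 * c ^+ 2 * (2 * Lp + 1)) by apply: hd; rewrite !inE eqxx ?orbT.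
exists d => //; split=> //; [by lra|by lra|split=> //; first by lra].
move: h6; rewrite ler_pdivlMr; last by rewrite !mulr_gt0.
have : d ^+ 2 <= d by rewrite expr2 ler_piMl// ltW.
move=> dd; have : c ^+ 2 * (2 * d * Lp + d ^+ 2) <= c ^+ 2 * (2 * d * Lp + d).
  by rewrite ler_pM2l//; lra.
by lra.
Qed.

Lemma sign_between (R : realType) (sg h lo hi a d : R) : sg = 1 \/ sg = -1 ->
  lo <= a -> a <= hi -> d <= sg * (h - lo) -> d <= sg * (h - hi) -> d <= sg * (h - a).
Proof. by case=> ->; lra. Qed.

Lemma sign_between_lt (R : realType) (sg h lo hi a : R) : sg = 1 \/ sg = -1 ->
  lo <= a -> a <= hi -> 0 < sg * (h - lo) -> 0 < sg * (h - hi) -> 0 < sg * (h - a).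
Proof. by case=> ->; lra. Qed.

Lemma shift_admissible (R : realType) (m k hi a d sg : R) : 0 < m -> 0 < k ->
  sg = 1 \/ sg = -1 -> 0 < a -> a <= hi -> 0 < d -> d <= k / (m * hi) ->
  2 * (sg * d) <= 2 * (k / (m * a)).
Proof.
move=> m0 k0 hsg a0 ahi d0 hd.
have : k / (m * hi) <= k / (m * a).
  by rewrite ler_pM2l// lef_pV2 ?posrE ?mulr_gt0// ?ler_pM2l// (lt_le_trans a0).
by case: hsg => ->; lra.
Qed.

Lemma front_speed_bound (R : realType) (m k lo hi a a1 d w W V : R) :
  0 < m -> 0 < k -> 0 < lo -> lo <= a -> a <= hi -> `|a1| <= V -> 0 <= w -> w <= W ->
  `|d| <= 1 ->
  `|a1 * (1 + 2 * (k / m) / a ^+ 2) * w + a1 * (2 * m * a * fprofile m k a - 2 * d)|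
   <= V * ((1 + 2 * (k / m) / lo ^+ 2) * W + (2 * m * hi * fprofile m k hi + 2)).
Proof.
move=> m0 k0 lo0 loa ahi ha1 w0 wW hd.
have a0 : 0 < a := lt_le_trans lo0 loa.
have hi0 : 0 < hi := lt_le_trans a0 ahi.
rewrite -mulrA -mulrDr normrM; apply: ler_pM => //.
apply: (le_trans (ler_normD _ _)); apply: lerD.
  have h2 : 0 <= 2 * (k / m) by rewrite mulr_ge0// divr_ge0// ltW.
  have h1 : 0 <= 2 * (k / m) / a ^+ 2 by rewrite divr_ge0 ?sqr_ge0.
  rewrite ger0_norm; last by apply: mulr_ge0 => //; exact: addr_ge0.
  apply: ler_pM => //; first exact: addr_ge0.
  rewrite lerD2l; apply: ler_wpM2l => //.
  by rewrite lef_pV2 ?posrE ?exprn_gt0// lerXn2r ?nnegrE// ltW.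
apply: (le_trans (ler_normB _ _)); apply: lerD; last by rewrite normrM ger0_norm//; lra.
have h3 : fprofile m k a <= fprofile m k hi by apply: fprofile_mono => //; exact: ltW.
have h4 := fprofile_gt0 m0 k0 a.
have h5 : 0 <= 2 * m * a by rewrite !mulr_ge0// ltW.
rewrite ger0_norm; last by apply: mulr_ge0 => //; exact: ltW.
by apply: ler_pM => //; [exact: ltW|rewrite ler_pM2l// mulr_gt0].
Qed.

(** * Estimates for fronts in the smoothed coordinate *)

Definition abs_smoothing (R : realType) (b : R) (w w1 w2 : R -> R) : Prop :=
  [/\ C2R w w1 w2,
      forall x, b <= `|x| -> [/\ w x = `|x|, w1 x ^+ 2 = 1, x * w1 x = `|x| & w2 x = 0] &
      forall x, `|x| <= b -> [/\ 0 <= w x, w x <= b, 0 <= x * w1 x & x * w1 x <= b]].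

Section smoothed_front.
Variables (R : realType) (m k b sg : R) (w w1 w2 : R -> R).
Hypotheses (m0 : 0 < m) (k0 : 0 < k) (b0 : 0 < b) (hsg : sg = 1 \/ sg = -1).
Hypothesis Hw : abs_smoothing b w w1 w2.

Lemma smoothing_ge0 y : 0 <= w y.
Proof.
have [_ wfar wnear] := Hw.
have [h|h] := leP b `|y|; first by have [-> _ _ _] := wfar y h.
by have [] := wnear y (ltW h).
Qed.

Lemma smoothing_le a y : b <= a -> `|y| <= a -> w y <= a.
Proof.
have [_ wfar wnear] := Hw => ba ya.
have [h|h] := leP b `|y|; first by have [-> _ _ _] := wfar y h.
by have [_ h1 _ _] := wnear y (ltW h); exact: le_trans ba.
Qed.

Lemma smoothed_front_lt0 a d y s : b <= a -> 2 * d <= 2 * (k / (m * a)) ->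
  `|s| <= fprofile m k y -> `|y| < a -> front m k a d (w y) s < 0.
Proof.
move=> ba hd hs ya.
apply: (front_lt0 m0 k0 (smoothing_ge0 _) _ hd (normr_ge0 y) ya).
  by apply: smoothing_le => //; exact: ltW.
by rewrite fprofile_norm.
Qed.

(** In the strip [|y| <= b] the height is at most the profile at [b], so the front lies below 0 by a
    gap independent of its position. *)
Lemma smoothed_front_cap a lo d y s : b < lo -> lo <= a -> 2 * d <= 2 * (k / (m * a)) ->
  `|s| <= fprofile m k y -> `|y| <= b ->
  front m k a d (w y) s <= - (fprofile m k lo ^+ 2 - fprofile m k b ^+ 2).
Proof.
move=> blo loa hd hs yb.
have h : `|s| <= fprofile m k b.
  by apply: (le_trans hs); rewrite -fprofile_norm; exact: fprofile_mono.
have ba : b <= a by apply: ltW; exact: lt_le_trans loa.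
have wa : w y <= a by apply: smoothing_le => //; exact: le_trans ba.
have := front_le (smoothing_ge0 y) wa hd (sqr_le_profile m0 k0 h).
have lo0 : 0 <= lo by apply: ltW; exact: lt_trans blo.
have : fprofile m k lo ^+ 2 <= fprofile m k a ^+ 2.
  rewrite lerXn2r ?nnegrE//; try exact: ltW (fprofile_gt0 m0 k0 _).
  exact: fprofile_mono.
lra.
Qed.

(** For [sg = 1] the gap of the strip exceeds [e], and for [sg = -1] the sign is wrong there. The
    layer thus meets only points where the smoothing coincides with the absolute value. *)
Lemma smoothed_front_far a lo d e y s : b < lo -> lo <= a ->
  2 * (sg * d) <= 2 * (k / (m * a)) -> 0 < e ->
  e < fprofile m k lo ^+ 2 - fprofile m k b ^+ 2 ->
  `|s| <= fprofile m k y -> - e < sg * front m k a (sg * d) (w y) s ->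
  sg * front m k a (sg * d) (w y) s <= 0 -> b <= `|y|.
Proof.
move=> blo loa hd e0 he hs h1 h2; rewrite leNgt; apply/negP => /ltW yb.
have := smoothed_front_cap blo loa hd hs yb.
move: h1 h2 he e0; set F := front _ _ _ _ _ _.
by case: hsg => ->; lra.
Qed.

(** Compares the smoothed and shifted front with an exact arc [a'], for which the initial data and
    the ball are known. For [sg = -1] the strip is excluded by sign. *)
Lemma smoothed_front_neg a a' d y s : b <= a -> 2 * (sg * d) <= 2 * (k / (m * a)) ->
  0 < a' -> 0 < sg * (a' - a) -> 0 <= d -> 2 * d <= sg * (a' - a) ->
  `|s| <= fprofile m k y -> sg * front m k a (sg * d) (w y) s <= 0 ->
  sg * front m k a' 0 `|y| s < 0.
Proof.
move=> ba hd a'0 h1 d0 h2 hs h3.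
have a0 : 0 < a := lt_le_trans b0 ba.
have [yb|yb] := leP b `|y|.
  have [_ /(_ _ yb)[wE _ _ _] _] := Hw.
  by apply: lt_le_trans h3; rewrite wE; exact: front_mono_sg.
have ya := lt_le_trans yb ba.
have hn := smoothed_front_lt0 ba hd hs ya.
case: hsg h1 h2 h3 => E; rewrite E ?mul1r => h1 h2 h3.
  apply: (front_lt0 m0 k0 (normr_ge0 _) _ _ (normr_ge0 y)); try lra.
    by rewrite mulr0 mulr_ge0// divr_ge0 ?mulr_ge0 ?ltW.
  by rewrite fprofile_norm.
by exfalso; move: hn; rewrite E; lra.
Qed.

(** The shift costs at most [2 * d * hi], that is half of the margin [g], and [e] takes at most
    another quarter. *)
Lemma smoothed_front_perturb lo hi A d e g y s : b < lo -> lo <= A -> A <= hi ->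
  2 * (sg * d) <= 2 * (k / (m * A)) -> 0 <= d -> `|s| <= fprofile m k y ->
  g = - (sg * front m k A 0 `|y| s) -> 0 < g -> 4 * (d * hi) <= g -> e <= g / 4 ->
  e < fprofile m k lo ^+ 2 - fprofile m k b ^+ 2 ->
  sg * front m k A (sg * d) (w y) s < - e.
Proof.
move=> blo loA Ahi hd d0 hs gE g0 hg he1 he2.
have bA : b < A := lt_le_trans blo loA.
have A0 : 0 < A := lt_trans b0 bA.
have sg2 : sg * sg = 1 by case: hsg => ->; ring.
have [yb|yb] := leP b `|y|.
  have [_ /(_ _ yb)[wE _ _ _] _] := Hw; rewrite wE.
  have -> : sg * front m k A (sg * d) `|y| s = - g - sg * sg * (2 * d * (`|y| - A)).
    by rewrite gE /front; set z := k / _; ring.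
  rewrite sg2 mul1r.
  have h1 : 0 <= d * `|y| by rewrite mulr_ge0.
  have h2 : d * A <= d * hi by rewrite ler_wpM2l.
  by move: g0 hg he1; lra.
have h := smoothed_front_cap blo loA hd hs (ltW yb).
case: hsg => E; first by rewrite E mul1r in h *; lra.
exfalso; have h2 : front m k A 0 `|y| s < 0.
  apply: (front_lt0 m0 k0 (normr_ge0 _) _ _ (normr_ge0 y) (lt_trans yb bA)).
  - exact: ltW (lt_trans yb bA).
  - by rewrite mulr0 mulr_ge0// divr_ge0 ?mulr_ge0 ?ltW.
  - by rewrite fprofile_norm.
by move: g0; rewrite gE E; lra.
Qed.

(** The curvature slack [s0 / 8] enters the operator with a factor 2, which covers the time
    derivative bounded by [s0 / 4]. *)
Lemma level_condition (c a d e s0 Lp y s sp pt : R) (x p : 'rV[R]_2) (X : 'M[R]_2) :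
  0 < a -> 0 < c -> 0 <= d -> 0 < s0 -> s0 <= 1 ->
  s0 <= sg * (c ^+ 2 * arc_radius m k a ^+ 2 - 1) ->
  a - arc_center m k a <= Lp ->
  c ^+ 2 * e <= s0 / 4 -> c ^+ 2 * (2 * d * Lp + d ^+ 2) <= s0 / 4 ->
  b <= `|y| -> - e <= sg * front m k a (sg * d) (w y) s ->
  sg * front m k a (sg * d) (w y) s <= 0 ->
  x1 p = sg * (w1 y * (2 * w y - (a - 2 * (k / (m * a)) + 2 * (sg * d)))) ->
  x2 p = sg * (2 * s) ->
  X 0 0 = sg * (2 * w1 y ^+ 2 + w2 y * (2 * w y - (a - 2 * (k / (m * a)) + 2 * (sg * d)))) ->
  X 0 1 = 0 -> X 1 0 = 0 -> X 1 1 = sg * 2 ->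
  pt = - sg * sp -> `|sp| <= s0 / 4 ->
  p != 0 /\ - pt <= Fop (sg * c) (x, - p, - X).
Proof.
move=> a0 c0 d0 s00 s01 hs hL he hd yb h1 h2 p1 p2 X00 X01 X10 X11 ptE hsp.
have [_ /(_ _ yb)[_ w1E _ w2E] _] := Hw.
rewrite w1E w2E mul0r addr0 mulr1 in X00.
have sg2 : sg ^+ 2 = 1 by case: hsg => ->; rewrite ?expr1n// sqrrN expr1n.
have nE : x1 p ^+ 2 + x2 p ^+ 2 =
    (2 * w y - (a - 2 * (k / (m * a)) + 2 * (sg * d))) ^+ 2 + (2 * s) ^+ 2.
  by rewrite p1 p2 !exprMn w1E sg2 !mul1r.
have hsl := front_slack a0 c0 hsg d0 s00 s01 hs m0 hL he hd h1.
rewrite -nE in hsl.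
(* For [sg = 1] a zero gradient would contradict the positive slack. For [sg = -1] the point is on
   or outside the circle, whose radius is at least the profile. *)
have n0 : x1 p ^+ 2 + x2 p ^+ 2 != 0.
  case: hsg => E.
    apply/eqP => n00; move: hsl; rewrite n00 sqrtr0 mul0r mulr0 E; move: s00; lra.
  have : x1 p ^+ 2 + x2 p ^+ 2 = 4 * (front m k a (sg * d) (w y) s +
     ((a - (arc_center m k a + sg * d)) ^+ 2 + fprofile m k a ^+ 2)).
    by rewrite nE front_dist /arc_center; set z := k / (m * a); field.
  move=> ->; apply: lt0r_neq0; rewrite mulr_gt0//.
  have f2 : 0 < fprofile m k a ^+ 2 by rewrite exprn_gt0// fprofile_gt0.
  have := sqr_ge0 (a - (arc_center m k a + sg * d)).
  by move: h2; rewrite {1}E mulN1r; move: f2; lra.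
split; first by rewrite row2_eq0.
rewrite Fop_circle// ptE.
have : - (- sg * sp) <= `|sp|.
  rewrite mulNr opprK; case: hsg => ->; first by rewrite mul1r ler_norm.
  by rewrite mulN1r -normrN ler_norm.
by move: hsl hsp; lra.
Qed.

(** A boundary point with [sg * front <= 0] has [|y| <= a] for [sg = 1] and [|y| >= a] for
    [sg = -1]. Outside the strip both terms of [boundary_normal_front] then have the sign of [sg];
    inside it only [sg = 1] is possible. *)
Lemma boundary_condition a d y s : 0 < d -> 2 * b <= a ->
  2 * (sg * d) <= 2 * (k / (m * a)) -> `|s| = fprofile m k y ->
  sg * front m k a (sg * d) (w y) s <= 0 ->
  0 < sg * (fprofile m k y - m * (y * w1 y) * (w y - (arc_center m k a + sg * d))).
Proof.
move=> d0 ba hd hs hF.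
have a0 : 0 < a by move: b0; lra.
have ba' : b <= a by move: b0; lra.
have hs' : `|s| <= fprofile m k y by rewrite hs.
have [_ wfar wnear] := Hw.
have [yb|yb] := leP b `|y|; last first.
  have [W0 Wb P0 Pb] := wnear _ (ltW yb).
  have hn := smoothed_front_lt0 ba' hd hs' (lt_le_trans yb ba').
  have E : sg = 1.
    by case: hsg => // E; exfalso; move: hF hn; rewrite E mulN1r; lra.
  by rewrite E !mul1r; apply: (@boundary_normal_cap _ m k m0 k0 a d b).
have [wE _ yw _] := wfar _ yb; rewrite wE yw -fprofile_norm boundary_normal_front//.
have hy0 : 0 < `|y| := lt_le_trans b0 yb.
have c1 : 0 < k / a + m * `|y| / 2 by rewrite addr_gt0 ?divr_gt0 ?mulr_gt0.
have c2 : 0 < m * d * `|y| by rewrite !mulr_gt0.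
rewrite wE in hF.
case: hsg => E.
  rewrite E !mul1r in hF hd *.
  have ya : `|y| <= a.
    rewrite leNgt; apply/negP => ay.
    have hn : `|s| = fprofile m k `|y| by rewrite fprofile_norm.
    by have := front_gt0 m0 k0 a0 ay hd hn; lra.
  have : 0 <= (a - `|y|) * (k / a + m * `|y| / 2) by rewrite mulr_ge0 ?subr_ge0// ltW.
  by move: c2; lra.
have ya : a <= `|y|.
  rewrite leNgt; apply/negP => ay.
  have := smoothed_front_lt0 ba' hd hs' ay.
  by rewrite wE; move: hF; rewrite {1}E; lra.
have : 0 <= (`|y| - a) * (k / a + m * `|y| / 2) by rewrite mulr_ge0 ?subr_ge0// ltW.
by rewrite E; move: c2; lra.
Qed.

End smoothed_front.

(* [sg = 1] is used for [v = u], with a front growing from [a0] to [A < a1], and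
   [sg = -1] for [v = - u], with a front shrinking from [a0] to [A > a1].  The arcs
   [ap] and [ah] control the initial data and the distance to the origin. *)
Lemma front_barrier (R : realType) (m k c r theta : R) (B : set 'rV[R]_2)
    (v : 'rV[R]_2 * R -> R) (sg lo hi A a0 ap ah al be s0 : R) :
  0 < m -> 0 < k -> 0 < c -> C2theta_domain theta B -> bounded_set B ->
  Omega m k `&` eball 0 r `<=` B -> B `<=` Omega m k ->
  touching_from_below B (sg * c) v -> {within cyl_bar B, continuous v} ->
  sg = 1 \/ sg = -1 -> 0 < lo -> lo <= A -> A <= hi -> lo <= a0 -> a0 <= hi ->
  0 < s0 -> s0 <= 1 ->
  (forall a, lo <= a -> a <= hi -> s0 <= sg * (c ^+ 2 * arc_radius m k a ^+ 2 - 1)) ->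
  al < be -> (forall x t, closure B x -> 0 <= t -> al <= v (x, t)) ->
  0 < ah -> 0 < sg * (ah - lo) -> 0 < sg * (ah - hi) ->
  (forall x t, closure B x -> 0 < t -> v (x, t) < be ->
    sg * front m k ah 0 `|x1 x| (x2 x) < 0 -> eball 0 r x) ->
  0 < ap -> 0 < sg * (ap - a0) ->
  (forall x, closure B x -> sg * front m k ap 0 `|x1 x| (x2 x) < 0 -> be <= v (x, 0)) ->
  forall x, closure B x -> sg * front m k A 0 `|x1 x| (x2 x) < 0 ->
  exists T, forall t, T <= t -> be <= v (x, t).
Proof.
move=> m0 k0 c0 domB bB sub1 sub2 touch cv hsg lo0 loA Ahi loa0 a0hi s00 s01 slack
  ab vlow ah0 ahlo ahhi hball ap0 apa hinit x Bx hx.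
have hi0 : 0 < hi by lra.
have cB := bounded_closure_compact bB.
have clO y : closure B y -> `|x2 y| <= fprofile m k (x1 y).
  by move=> By; apply: closure_Omega_le; exact: closureS By.
have [Rb Rb0 HRb] := compact_norm_bound cB (continuous_subspaceT (@x1_continuous R)).
(* Half of [lo] ensures [2 * b <= a] for all positions, as the boundary condition in the strip
   requires. *)
pose b := lo / 2.
have b0 : 0 < b by rewrite /b; lra.
have blo : b < lo by rewrite /b; lra.
have [w1 [w2 [Hw wfar wnear]]] := sabs_C2R b0.
pose w := sabs b.
have Hsm : abs_smoothing b w w1 w2 by [].
pose g2 := fprofile m k lo ^+ 2 - fprofile m k b ^+ 2.
have g20 : 0 < g2 by rewrite subr_gt0; exact: fprofile_sqr_smono (ltW b0) blo.
pose gx := - (sg * front m k A 0 `|x1 x| (x2 x)).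
have gx0 : 0 < gx by rewrite oppr_gt0.
pose Lp := hi / 2 + k / (m * lo).
have Lp0 : 0 < Lp by rewrite addr_gt0// divr_gt0// mulr_gt0.
have q10 : 0 < k / (m * hi) by rewrite divr_gt0// mulr_gt0.
have q50 : 0 < gx / (4 * hi) by rewrite divr_gt0// mulr_gt0.
(* The bounds serve, in this order: admissibility of the shift, comparison with the initial arc
   [ap], comparison with [ah] at both ends of the range, the margin at [x], and the share of the
   slack. *)
have [d d0 [hd1 hd2 hd3 hd4 [hd5 hd7 hd6]]] := small_shift q10 apa ahlo ahhi q50 c0 Lp0 s00.
have c2 : 0 < c ^+ 2 by rewrite exprn_gt0.
(* The three bounds are the margin at [x], the gap of the strip around [x1 = 0], and a quarter of
   the slack. *)
have [e e0 he] := @pos_lower_bound R [:: gx / 4; g2 / 2; s0 / (4 * c ^+ 2)]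
  ltac:(by rewrite /= !divr_gt0// mulr_gt0).
have he1 : e <= gx / 4 by apply: he; rewrite !inE eqxx.
have he2 : e < g2.
  apply: (@le_lt_trans _ _ (g2 / 2)); first by apply: he; rewrite !inE eqxx ?orbT.
  by rewrite ltr_pdivrMr// ltr_pMr// ltr1n.
have he3 : c ^+ 2 * e <= s0 / 4.
  have h : e <= s0 / (4 * c ^+ 2) by apply: he; rewrite !inE eqxx ?orbT.
  apply: le_trans (_ : c ^+ 2 * (s0 / (4 * c ^+ 2)) <= _); first by rewrite ler_pM2l.
  by rewrite le_eqVlt; apply/orP; left; apply/eqP; field; rewrite gt_eqF.
pose K := (be - al) / e ^+ 3.
have K0 : 0 < K by rewrite divr_gt0 ?exprn_gt0// subr_gt0.
pose W := Rb + b.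
pose C1 := (1 + 2 * (k / m) / lo ^+ 2) * W + (2 * m * hi * fprofile m k hi + 2).
have fhi0 : 0 < fprofile m k hi by exact: fprofile_gt0.
have C10 : 0 < C1.
  rewrite ltr_wpDl//.
    rewrite mulr_ge0//; last by rewrite addr_ge0// ltW.
    by rewrite addr_ge0// divr_ge0 ?sqr_ge0// mulr_ge0// divr_ge0// ltW.
  by rewrite addr_gt0// !mulr_gt0.
(* [C1] bounds the time derivative of the front per unit speed of [a], so this choice keeps it below
   [s0 / 4]; the [+ 1] keeps the denominator positive. *)
pose nu := s0 / (4 * ((`|A - a0| + 1) * C1)).
have D0 : 0 < `|A - a0| + 1 by rewrite ltr_wpDl.
have nu0 : 0 < nu by rewrite divr_gt0// !mulr_gt0.
have nuC : `|A - a0| * nu * C1 <= s0 / 4.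
  apply: (@le_trans _ _ ((`|A - a0| + 1) * nu * C1)).
    by rewrite ler_pM2r// ler_pM2r// lerDl.
  by rewrite le_eqVlt; apply/orP; left; apply/eqP; rewrite /nu; field; rewrite !gt_eqF.
pose a := arc_position A (A - a0) nu.
have AA0 : A - (A - a0) = a0 by ring.
have arange t : lo <= a t /\ a t <= hi.
  by apply/andP; apply: arc_position_range; rewrite ?AA0.
have apos t : 0 < a t by have [h _] := arange t; exact: lt_le_trans h.
have ba t : b <= a t by have [h _] := arange t; apply: le_trans h; exact: ltW.
have [a1 [a2 [Ha a1bound]]] := arc_position_C2R A (A - a0) nu0.
rewrite -/a in Ha.
have [A1 [A2 [B1 [B2 [HA HB A1B1]]]]] := front_time_C2R k (sg * d) m0 apos Ha.
have [d1 [d2 [HG Gder]]] := moving_front_C2f sg Hw HA HB.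
set G := (fun z => _) in HG.
have GE y t : G (y, t) = sg * front m k (a t) (sg * d) (w (x1 y)) (x2 y).
  by rewrite /G /front /w /=; field; rewrite !gt_eqF.
have dsg t : 2 * (sg * d) <= 2 * (k / (m * a t)).
  by apply: (@shift_admissible _ m k hi) => //; case: (arange t).
have Gle0 y t : closure B y -> 0 <= t -> v (y, t) < barrier be K e G (y, t) -> G (y, t) <= 0.
  move=> By t0 h; rewrite leNgt; apply/negP => G0.
  have h1 := barrier_low e0 (ltW ab) (ltW G0).
  by have := lt_le_trans h h1; rewrite ltNge vlow.
have Wb y : closure B y -> w (x1 y) <= W.
  move=> By; apply: (smoothing_le Hsm); first by rewrite lerDr.
  by apply: le_trans (HRb y By) _; rewrite lerDl ltW.
have sgnorm : `|sg * d| <= 1.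
  by rewrite normrM (gtr0_norm d0); case: hsg => ->; rewrite ?normrN normr1 mul1r.
have main y t : closure B y -> 0 <= t -> barrier be K e G (y, t) <= v (y, t).
  move: y t; apply: (comparison touch cB cv HG (ltW K0)).
  - move=> y t By t0 hv _ Ge.
    have G0 := Gle0 y t By (ltW t0) hv.
    have Ge' : - e < G (y, t) by rewrite -subr_gt0 opprK.
    move: Ge' G0; rewrite !GE => Ge' G0.
    have [ta1 ta2] := arange t.
    have yb := smoothed_front_far m0 k0 b0 hsg Hsm blo ta1 (dsg t) e0 he2 (clO y By) Ge' G0.
    have [p1 p2 pt [X00 X01 X10 X11]] := Gder (y, t).
    have [EA EB] := A1B1 t.
    have hL : a t - arc_center m k (a t) <= Lp.
      have -> : a t - arc_center m k (a t) = a t / 2 + k / (m * a t).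
        by rewrite /arc_center; set z := k / _; field.
      apply: lerD; first by rewrite ler_pM2r.
      by rewrite ler_pM2l// lef_pV2 ?posrE ?mulr_gt0// ler_pM2l.
    have hsp : `|A1 t * w (x1 y) + B1 t| <= s0 / 4.
      rewrite EA EB; apply: le_trans nuC.
      by apply: front_speed_bound => //; [exact: smoothing_ge0 Hsm _|exact: Wb].
    have := level_condition m0 k0 hsg Hsm y (apos t) c0 (ltW d0) s00 s01
      (slack _ ta1 ta2) hL he3 hd6 yb (ltW Ge') G0 p1 p2 X00 X01 X10 X11 pt hsp.
    by apply.
  - move=> y t fy t0 hv.
    have By : closure B y by case: fy.
    have G0 := Gle0 y t By (ltW t0) hv.
    have vbe : v (y, t) < be by apply: (lt_le_trans hv); apply: barrier_le; exact: ltW.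
    have [ta1 ta2] := arange t.
    rewrite GE in G0.
    have yball : eball 0 r y.
      apply: (hball y t By t0 vbe).
      apply: (smoothed_front_neg m0 k0 b0 hsg Hsm (ba t) (dsg t) ah0 _ (ltW d0) _ (clO y By) G0).
        exact: sign_between_lt hsg ta1 ta2 ahlo ahhi.
      exact: sign_between hsg ta1 ta2 hd4 hd5.
    have [nu' [l [hnu l0 n1 n2]]] := frontier_normal m0 k0 domB sub1 sub2 fy yball.
    have fE := frontier_profile sub1 sub2 fy yball.
    exists nu' => //.
    have [p1 p2 _ _] := Gder (y, t).
    rewrite dotE p1 p2 n1 n2 /= -/w.
    have xsg : fprofile m k (x1 y) = x2 y * Num.sg (x2 y) by rewrite mulrC -normrEsg.
    have -> : sg * (w1 (x1 y) * (2 * w (x1 y) - (a t - 2 * (k / (m * a t)) + 2 * (sg * d))))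
        * (l * - (m * x1 y)) + sg * (2 * x2 y) * (l * Num.sg (x2 y)) =
      2 * l * (sg * (fprofile m k (x1 y) - m * (x1 y * w1 (x1 y)) *
        (w (x1 y) - (arc_center m k (a t) + sg * d)))).
      by rewrite xsg /arc_center; set z := k / _; field.
    rewrite pmulr_rgt0; last by rewrite mulr_gt0.
    apply: (boundary_condition m0 k0 b0 hsg Hsm d0 _ (dsg t) fE G0).
    by rewrite /b mulrC divfK.
  - move=> y By; rewrite leNgt; apply/negP => hv.
    have G0 := Gle0 y 0 By (lexx _) hv.
    have a00 : a 0 = a0 by rewrite /a arc_position0.
    have [ta1 ta2] := arange 0.
    rewrite GE in G0.
    have : be <= v (y, 0).
      apply: hinit => //.
      by apply: (smoothed_front_neg m0 k0 b0 hsg Hsm (ba 0) (dsg 0) ap0 _ (ltW d0) _ (clO y By) G0);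
        rewrite a00.
    by rewrite leNgt (lt_le_trans hv)//; apply: barrier_le; exact: ltW.
have A0 : 0 < A := lt_le_trans lo0 loA.
(* The limiting front lies more than [e] beyond [x], so from some time on [x] is in the region where
   the barrier equals [be]. *)
have limx : sg * front m k A (sg * d) (w (x1 x)) (x2 x) < - e.
  apply: (smoothed_front_perturb m0 k0 b0 hsg Hsm blo loA Ahi _ (ltW d0) (clO x Bx)
    (erefl gx) gx0 _ he1 he2).
    exact: (@shift_admissible _ m k hi).
  by move: hd7; rewrite ler_pdivlMr ?mulr_gt0// mulrCA.
have ca : a t @[t --> +oo] --> A by exact: arc_position_cvg.
have cF : sg * front m k (a t) (sg * d) (w (x1 x)) (x2 x) @[t --> +oo] -->
    sg * front m k A (sg * d) (w (x1 x)) (x2 x).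
  apply: cvgM; first exact: cvg_cst.
  have cf : fprofile m k (a t) @[t --> +oo] --> fprofile m k A.
    exact: (continuous_cvg _ (@fprofile_continuous R m k A) ca).
  apply: cvgD.
    by apply: cvgB; [exact: cvg_cst|apply: cvgM; exact: cf].
  apply: cvgM; first by apply: cvgB; [exact: cvg_cst|exact: ca].
  apply: cvgB; last exact: cvg_cst.
  apply: cvgD; first exact: cvg_cst.
  apply: cvgM; first exact: cvg_cst.
  apply: cvgM; first exact: cvg_cst.
  apply: cvgV; first by rewrite mulf_neq0// gt_eqF.
  by apply: cvgM; [exact: cvg_cst|exact: ca].
have ev : \forall t \near +oo, sg * front m k (a t) (sg * d) (w (x1 x)) (x2 x) < - e.
  exact: (cF _ (lt_nbhsl limx)).
have [T [Treal HT]] := ev.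
exists (Num.max 0 (T + 1)) => t; rewrite ge_max => /andP[t0 tT].
apply: le_trans (main x t Bx t0).
have Gt : G (x, t) + e < 0.
  by rewrite GE -ltrBrDr sub0r; apply: HT; apply: lt_le_trans tT; rewrite ltrDl.
by rewrite /barrier /pos_cube (max_idPr (ltW Gt)) expr0n mulr0 subr0.
Qed.

(** * The regions [U(a)] *)

Section Uarc_theory.
Variables (R : realType) (m k : R).
Hypotheses (m0 : 0 < m) (k0 : 0 < k).

Lemma shift0_admissible a : 0 < a -> 2 * 0 <= 2 * (k / (m * a)).
Proof. by move=> a0; rewrite mulr0 mulr_ge0// divr_ge0 ?mulr_ge0 ?ltW. Qed.

Lemma Omega_front_lt0 a (x : 'rV[R]_2) : 0 < a -> `|x2 x| <= fprofile m k (x1 x) ->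
  `|x1 x| < a -> front m k a 0 `|x1 x| (x2 x) < 0.
Proof.
move=> a0 hx xa.
apply: (front_lt0 m0 k0 (normr_ge0 _) (ltW xa) (shift0_admissible a0) (normr_ge0 (x1 x)) xa).
by rewrite fprofile_norm.
Qed.

Lemma arc_radius_gt0 a : 0 < a -> 0 < arc_radius m k a.
Proof.
move=> a0; rewrite /arc_radius mulr_gt0 ?addr_gt0 ?divr_gt0 ?mulr_gt0// sqrtr_gt0.
by rewrite ltr_wpDl// mulr_ge0 ?sqr_ge0.
Qed.

Lemma cos_arc a : 0 < a ->
  arc_radius m k a * cos (atan (m * a)) = a - arc_center m k a.
Proof.
move=> a0; rewrite cos_atan /arc_radius -mulrA exprMn (addrC 1) divff.
  by rewrite /arc_center mulr1; set z := k / _; field.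
rewrite gt_eqF// sqrtr_gt0 ltr_wpDl// mulr_ge0 ?sqr_ge0//.
Qed.

Lemma arc_center_lt a : 0 < a -> arc_center m k a < a.
Proof.
move=> a0; rewrite /arc_center.
have : 0 < k / (m * a) by rewrite divr_gt0// mulr_gt0.
lra.
Qed.

(** Turns the union over angles into one inequality. Points with [|x1| < a] satisfy it because the
    profile increases; beyond [a] a point of the rectangle of angle [vt] is inside the circle. *)
Lemma Uarc_front a x : 0 < a ->
  Uarc m k a x <-> Omega m k x /\ front m k a 0 `|x1 x| (x2 x) < 0.
Proof.
move=> a0; have pa := arc_center_lt a0; have r0 := arc_radius_gt0 a0.
set p := arc_center m k a in pa; set r := arc_radius m k a in r0.
split.
  move=> [Ox [vt [_ h1 h2]]]; split=> //.
  have [xa|xa] := ltP `|x1 x| a; first by apply: Omega_front_lt0 => //; exact: ltW.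
  rewrite front_circle// -/p -/r.
  have {}h1 : `|x1 x| - p < r * cos vt by rewrite ltrBlDl; exact: h1.
  have h3 : 0 < `|x1 x| - p by lra.
  have h4 : (`|x1 x| - p) ^+ 2 < (r * cos vt) ^+ 2.
    by rewrite ltr_pXn2r ?nnegrE ?(ltW h3) ?(ltW (lt_trans h3 h1)).
  have h5 : x2 x ^+ 2 < (r * sin vt) ^+ 2.
    rewrite -[x2 x ^+ 2]real_normK ?num_real// ltr_pXn2r ?nnegrE//.
    exact: (le_trans (normr_ge0 (x2 x)) (ltW h2)).
  have : (r * cos vt) ^+ 2 + (r * sin vt) ^+ 2 = r ^+ 2.
    by rewrite !exprMn -mulrDr cos2Dsin2 mulr1.
  lra.
move=> [Ox hF]; split=> //.
(* The angle must stay below [atan (m * a)], that is the first coordinate of the point of the arc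
   must exceed [a] as well as [|x1|]. *)
set y := Num.max `|x1 x| a.
have ya : a <= y by rewrite le_max lexx orbT.
have yx : `|x1 x| <= y by rewrite le_max lexx.
have hy : (y - p) ^+ 2 + x2 x ^+ 2 < r ^+ 2.
  rewrite -subr_lt0 -front_circle// /y.
  have [xa|xa] := leP `|x1 x| a; last by [].
  have h : x2 x ^+ 2 < fprofile m k a ^+ 2.
    have h1 : `|x2 x| < fprofile m k a.
      by apply: (lt_le_trans Ox); rewrite -fprofile_norm; exact: fprofile_mono.
    rewrite -[x2 x ^+ 2]real_normK ?num_real// ltr_pXn2r ?nnegrE//.
    exact: ltW (fprofile_gt0 m0 k0 a).
  by rewrite /front subrr mul0r; lra.
have yp : 0 < y - p by lra.
(* The midpoint of the squares gives an arc point strictly to the right of [y] and strictly above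
   [|x2|]. *)
set q := ((y - p) ^+ 2 + (r ^+ 2 - x2 x ^+ 2)) / 2.
have q1 : (y - p) ^+ 2 < q by rewrite /q; lra.
have q2 : q + x2 x ^+ 2 < r ^+ 2 by rewrite /q; lra.
have q0 : 0 <= q by apply: le_trans (ltW q1); exact: sqr_ge0.
set z := Num.sqrt q.
have z2 : z ^+ 2 = q by rewrite sqr_sqrtr.
have zy : y - p < z.
  by rewrite -(@ltr_pXn2r _ 2) ?nnegrE ?sqrtr_ge0 ?z2//; exact: ltW.
have z0 : 0 < z by lra.
have zr : z < r.
  rewrite -(@ltr_pXn2r _ 2) ?nnegrE ?z2//; [|exact: ltW|exact: ltW].
  by have := sqr_ge0 (x2 x); lra.
have zr1 : 0 < z / r < 1 by rewrite divr_gt0//= ltr_pdivrMr// mul1r.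
have zr2 : -1 <= z / r <= 1.
  by case/andP: zr1 => h1 h2; rewrite (ltW h2) andbT (le_trans _ (ltW h1))// oppr_le0.
have cosE : cos (acos (z / r)) = z / r by rewrite acosK// in_itv.
exists (acos (z / r)); split.
- rewrite ger0_norm ?acos_ge0// ltNge; apply/negP => h.
  have : cos (acos (z / r)) <= cos (atan (m * a)).
    have pi0 := pi_gt0 R.
    have at0 : 0 <= atan (m * a) by rewrite -atan0 le_atan// mulr_ge0// ltW.
    have at1 := atan_ltpi2 (m * a).
    rewrite leNgt ltr_cos ?in_itv/= ?acos_ge0 ?acos_lepi ?at0//; last by lra.
    by rewrite -leNgt.
  rewrite cosE ler_pdivrMr// mulrC cos_arc// -/p; lra.
- rewrite -[X1 _ _ _ _]/(p + r * cos (acos (z / r))) cosE (mulrC r) divfK ?gt_eqF//.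
  by lra.
- rewrite /X2 -/r sin_acos//.
  rewrite -(@ltr_pXn2r _ 2) ?nnegrE//; last first.
    by apply: mulr_ge0; [exact: ltW|exact: sqrtr_ge0].
  rewrite real_normK ?num_real// exprMn sqr_sqrtr; last first.
    case/andP: zr1 => zr3 zr4.
    by rewrite subr_ge0 -(expr1n R 2) ler_pXn2r ?nnegrE ?ler01 ?(ltW zr3) ?(ltW zr4).
  rewrite expr_div_n z2 mulrBr mulr1 mulrC divfK ?expf_neq0 ?gt_eqF//; lra.
Qed.

Lemma front_continuous a : continuous (fun x : 'rV[R]_2 => front m k a 0 `|x1 x| (x2 x)).
Proof.
have ca : continuous (fun x : 'rV[R]_2 => `|x1 x|).
  exact: (continuous_fun_comp (@x1_continuous R) (@norm_continuous _ _)).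
have c2 := @x2_continuous R.
apply: continuous_add.
  by apply: continuous_add; [exact: (continuous_mul c2 c2)|exact: cst_continuous].
apply: continuous_mul.
  by apply: continuous_add; [exact: ca|exact: cst_continuous].
apply: continuous_add; last exact: cst_continuous.
by apply: continuous_add; [exact: ca|exact: cst_continuous].
Qed.

Lemma closure_Uarc_le a x : 0 < a -> closure (Uarc m k a) x ->
  front m k a 0 `|x1 x| (x2 x) <= 0.
Proof.
move=> a0 h; rewrite -oppr_ge0.
apply: (closure_pos_ge0 (h := fun y => - front m k a 0 `|x1 y| (x2 y)) _ _ h).
  by apply: continuous_opp; exact: front_continuous.
by move=> y /(Uarc_front _ a0)[_]; rewrite oppr_gt0.
Qed.

(* The point is approached along a path shrinking [|x1|], hence the profile
   [f x1], and scaling [x2] slightly more than the profile. *)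
Lemma closure_Uarc_front a x : 0 < a -> closure (Omega m k) x ->
  front m k a 0 `|x1 x| (x2 x) <= 0 -> closure (Uarc m k a) x.
Proof.
move=> a0 /closure_Omega_le Ox hF N Nx.
pose sc (s : R) := (1 - s) * (fprofile m k ((1 - s) * x1 x) / fprofile m k (x1 x)).
pose path (s : R) : 'rV[R]_2 :=
  ((1 - s) * x1 x) *: evec R 0 + (sc s * x2 x) *: evec R 1.
have P1 s : x1 (path s) = (1 - s) * x1 x.
  by rewrite /path x1_lin x1_evec0 /x1 !mxE mulr1 mulr0 addr0.
have P2 s : x2 (path s) = sc s * x2 x.
  by rewrite /path x2_lin x2_evec0 /x2 !mxE mulr1 mulr0 add0r.
have f0 y := fprofile_gt0 m0 k0 y.
have path0 : path 0 = x.
  apply: rV2_eq; rewrite ?P1 ?P2 /sc subr0 !mul1r// divff ?mul1r// gt_eqF//.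
have cid : continuous (fun s : R => 1 - s).
  by apply: continuous_add; [exact: cst_continuous|apply: continuous_opp => s; exact: cvg_id].
have c1 : continuous (fun s : R => (1 - s) * x1 x).
  by apply: continuous_mul; [exact: cid|exact: cst_continuous].
have csc : continuous (fun s : R => sc s * x2 x).
  apply: continuous_mul; last exact: cst_continuous.
  apply: continuous_mul; first exact: cid.
  apply: continuous_mul; last exact: cst_continuous.
  exact: (continuous_fun_comp c1 (@fprofile_continuous R m k)).
have cpath : path @ (0 : R) --> x.
  by rewrite -[in X in _ --> X]path0; apply: cvgD; apply: cvgZr_tmp; [exact: c1|exact: csc].
have N1 : \forall s \near (0 : R)^'+, N (path s) by apply: cvg_within; exact: cpath.
have N2 : \forall s \near (0 : R)^'+, N (path s) /\ 0 < s < 1.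
  near=> s; split; first by near: s.
  by apply/andP; split; near: s; [exact: nbhs_right_gt|exact: nbhs_right_lt].
have [s [Ns /andP[s0 s1]]] : exists s, N (path s) /\ 0 < s < 1.
  by apply: (@filter_ex _ ((0 : R)^'+)) N2; exact: at_right_proper_filter.
exists (path s); split=> //.
have t0 : 0 < 1 - s by lra.
have t1 : 1 - s < 1 by lra.
have nx1 : `|x1 (path s)| = (1 - s) * `|x1 x| by rewrite P1 normrM gtr0_norm.
have ff : fprofile m k (x1 (path s)) <= fprofile m k (x1 x).
  rewrite -fprofile_norm nx1 -(fprofile_norm _ _ (x1 x)).
  by apply: fprofile_mono => //; [rewrite mulr_ge0// ltW|rewrite ler_piMl// ltW].
have nx2 : `|x2 (path s)| = (1 - s) * (fprofile m k (x1 (path s)) / fprofile m k (x1 x)) * `|x2 x|.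
  rewrite P2 normrM /sc -P1 ger0_norm// mulr_ge0 ?(ltW t0)// divr_ge0// ltW//.
have Op : Omega m k (path s).
  rewrite /Omega /= nx2.
  apply: (@le_lt_trans _ _ ((1 - s) * fprofile m k (x1 (path s)))); last by rewrite gtr_pMl.
  rewrite -mulrA ler_pM2l// mulrAC ler_pdivrMr// ler_pM2l//.
apply/(Uarc_front _ a0); split=> //.
have [ya|ya] := ltP `|x1 (path s)| a; first by apply: Omega_front_lt0 => //; exact: ltW.
(* Beyond [a] both terms of the squared distance to the centre decrease, the first one strictly
   since [x1] is nonzero. *)
apply: lt_le_trans hF; rewrite !front_circle// ltrD2r.
have pa := arc_center_lt a0.
have x10 : 0 < `|x1 x|.
  rewrite normr_gt0; apply/eqP => x10; move: ya; rewrite nx1 x10 normr0 mulr0; lra.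
have h1 : `|x1 (path s)| < `|x1 x| by rewrite nx1 gtr_pMl.
apply: ltr_leD.
  by rewrite ltr_pXn2r ?nnegrE//; lra.
rewrite -[x2 (path s) ^+ 2]real_normK ?num_real// -[x2 x ^+ 2]real_normK ?num_real//.
rewrite ler_pXn2r ?nnegrE// nx2 ler_piMl//.
apply: mulr_ile1; rewrite ?(ltW t0) ?(ltW t1)//; first by rewrite divr_ge0// ltW.
by rewrite ler_pdivrMr// mul1r.
Unshelve. all: by end_near. Qed.

Lemma front_eball a x : 0 < a -> front m k a 0 `|x1 x| (x2 x) <= 0 ->
  eball 0 (`|arc_center m k a| + 2 * arc_radius m k a + 1) x.
Proof.
move=> a0; rewrite front_circle// => h; have r0 := arc_radius_gt0 a0.
move: h; set p := arc_center m k a; set r := arc_radius m k a in r0 * => h.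
rewrite /eball /= subr0 enormE.
have h1 : `| `|x1 x| - p| <= r.
  rewrite -(@ler_pXn2r _ 2) ?nnegrE ?(ltW r0)// real_normK ?num_real//.
  by have := sqr_ge0 (x2 x); lra.
have h2 : `|x2 x| <= r.
  rewrite -(@ler_pXn2r _ 2) ?nnegrE ?(ltW r0)// real_normK ?num_real//.
  by have := sqr_ge0 (`|x1 x| - p); lra.
have h3 : Num.sqrt (x1 x ^+ 2 + x2 x ^+ 2) <= `|x1 x| + `|x2 x|.
  rewrite -(@ler_pXn2r _ 2) ?nnegrE ?sqrtr_ge0 ?addr_ge0// sqr_sqrtr ?addr_ge0 ?sqr_ge0//.
  rewrite sqrrD !real_normK ?num_real//.
  by have := mulr_ge0 (normr_ge0 (x1 x)) (normr_ge0 (x2 x)); lra.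
have := ler_norm (`|x1 x| - p); have := ler_norm p; lra.
Qed.

End Uarc_theory.

(** * Constant bounds and limits on both sides of the front *)

Lemma within_closure_eq (R : realType) (T : topologicalType) (D A : set T)
    (f : T -> R) (b : R) (y : T) :
  {within D, continuous f} -> A `<=` D -> (forall z, A z -> f z = b) ->
  D y -> closure A y -> f y = b.
Proof.
move=> /subspace_continuousP cf AD fA Dy Ay; apply/eqP; apply: contraT => fy.
have cfy : f @ within D (nbhs y) --> f y := cf y Dy.
have N : nbhs (f y) [set q | q != b].
  have [fb|fb|/eqP] := ltgtP (f y) b; last by rewrite (negbTE fy).
    by apply: filterS (lt_nbhsl fb) => q qb; rewrite /= lt_eqF.
  by apply: filterS (lt_nbhsr fb) => q qb; rewrite /= gt_eqF.
have H : \forall z \near within D (nbhs y), f z != b := cfy _ N.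
have [z [Az /= hz]] := Ay _ H.
by have := hz (AD _ Az); rewrite fA// eqxx.
Qed.

(** The barrier is constant, with [K = 0]. The function [x2^2] is only there to provide a strictly
    positive normal derivative, equal on the profile to a positive multiple of [f]. *)
Lemma constant_bound (R : realType) (m k c r theta : R) (B : set 'rV[R]_2)
    (v : 'rV[R]_2 * R -> R) (b : R) :
  0 < m -> 0 < k -> C2theta_domain theta B -> bounded_set B ->
  Omega m k `&` eball 0 r `<=` B -> B `<=` Omega m k ->
  touching_from_below B c v -> {within cyl_bar B, continuous v} ->
  (forall x t, closure B x -> 0 < t -> v (x, t) < b -> eball 0 r x) ->
  (forall x, closure B x -> b <= v (x, 0)) ->
  forall x t, closure B x -> 0 <= t -> b <= v (x, t).
Proof.
move=> m0 k0 domB bB sub1 sub2 touch cv hball hinit x t Bx t0.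
have HG := C2f_mul (C2f_x2 R) (C2f_x2 R).
set G := (fun z => _) in HG.
have psiE z : barrier b 0 0 G z = b by rewrite /barrier mul0r subr0.
rewrite -(psiE (x, t)).
apply: (comparison touch (bounded_closure_compact bB) cv HG (lexx 0)) => //.
- by move=> y s _ _ _; rewrite ltxx.
- move=> y s fy s0; rewrite psiE => hv.
  have yball : eball 0 r y by apply: (hball y s) => //; case: fy.
  have [nu [l [hnu l0 n1 n2]]] := frontier_normal m0 k0 domB sub1 sub2 fy yball.
  have fE := frontier_profile sub1 sub2 fy yball.
  exists nu => //; set p := Dspace _ _.
  have p1 : x1 p = 0 by rewrite {1}/x1 mxE /= x2_evec0; ring.
  have p2 : x2 p = 2 * x2 y by rewrite {1}/x2 mxE /= x2_evec1; ring.
  rewrite dotE p1 p2 n1 n2 mul0r add0r mulrACA (mulrC (x2 y)) -normrEsg fE.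
  by rewrite !mulr_gt0// fprofile_gt0.
- by move=> y By; rewrite psiE; exact: hinit.
Qed.

Lemma closure_truncation (R : realType) (m k r : R) (B : set 'rV[R]_2) x :
  Omega m k `&` eball 0 r `<=` B -> closure (Omega m k) x -> eball 0 r x -> closure B x.
Proof.
move=> sub Ox bx N Nx.
have [y [Oy [Ny by_]]] := Ox _ (filterI Nx (near_eball bx)).
by exists y; split=> //; exact: sub.
Qed.

Lemma front_continuous_position (R : realType) (m k y s A : R) : 0 < m -> 0 < A ->
  {for A, continuous (fun a => front m k a 0 y s)}.
Proof.
move=> m0 A0; have cf := @fprofile_continuous R m k A.
apply: cvgD.
  by apply: cvgB; [exact: cvg_cst|apply: cvgM; exact: cf].
apply: cvgM; first by apply: cvgB; [exact: cvg_cst|exact: cvg_id].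
apply: cvgB; last exact: cvg_cst.
apply: cvgD; first exact: cvg_cst.
apply: cvgM; first exact: cvg_cst.
apply: cvgM; first exact: cvg_cst.
apply: cvgV; first by rewrite mulf_neq0// gt_eqF.
by apply: cvgM; [exact: cvg_cst|exact: cvg_id].
Qed.

Lemma eventually_eq_cvg (R : realType) (f : R -> R) (b T : R) :
  (forall t, T <= t -> f t = b) -> f t @[t --> +oo] --> b.
Proof.
move=> H; apply: (@cvg_trans _ ((fun _ : R => b) @ +oo)); last exact: cvg_cst.
apply: near_eq_cvg; near=> t; apply/esym; apply: H; near: t.
by apply: nbhs_pinfty_ge; exact: num_real.
Unshelve. all: by end_near. Qed.

Lemma inside_limit (R : realType) (m k c r theta a1 a2 l1 al be : R)
    (B : set 'rV[R]_2) (v : 'rV[R]_2 * R -> R) :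
  0 < m -> 0 < k -> 0 < c -> 0 < a1 -> a1 < a2 ->
  arc_radius m k a1 = 1 / c -> arc_radius m k a2 = 1 / c ->
  C2theta_domain theta B -> bounded_set B ->
  Omega m k `&` eball 0 r `<=` B -> B `<=` Omega m k ->
  touching_from_below B c v -> {within cyl_bar B, continuous v} ->
  0 < l1 -> l1 < a1 -> al < be ->
  (forall x t, closure B x -> 0 <= t -> al <= v (x, t)) ->
  (forall x, front m k a2 0 `|x1 x| (x2 x) <= 0 -> eball 0 r x) ->
  (forall x, closure B x -> front m k (a1 - l1) 0 `|x1 x| (x2 x) < 0 -> be <= v (x, 0)) ->
  forall x, closure B x -> front m k a1 0 `|x1 x| (x2 x) < 0 ->
  exists T, forall t, T <= t -> be <= v (x, t).
Proof.
move=> m0 k0 c0 a10 a12 r1 r2 domB bB sub1 sub2 touch cv l10 l1a ab vlow hball hinit x Bx hx.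
(* The front stops at [A] short of [a1], so the slack is uniform over the range, yet close enough
   for [x] to be inside. *)
have [A [A1 A2 hA]] : exists A, [/\ a1 - l1 < A, A < a1 & front m k A 0 `|x1 x| (x2 x) < 0].
  have cA := @front_continuous_position R m k `|x1 x| (x2 x) a1 m0 a10.
  have H : \forall a \near a1, front m k a 0 `|x1 x| (x2 x) < 0 := cA _ (lt_nbhsl hx).
  have H2 : \forall a \near a1^'-, [/\ a1 - l1 < a, a < a1 & front m k a 0 `|x1 x| (x2 x) < 0].
    near=> a; split; near: a; [|exact: nbhs_left_lt|by apply: cvg_within; exact: H].
    by apply: nbhs_left_gt; rewrite ltrBlDr ltrDl.
  by apply: (@filter_ex _ (a1^'-)) H2; exact: at_left_proper_filter.
have c2 : 0 < c ^+ 2 by rewrite exprn_gt0.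
have rc : c ^+ 2 * arc_radius m k a1 ^+ 2 = 1.
  by rewrite r1; field; rewrite gt_eqF.
pose s1 := c ^+ 2 * (m ^+ 2 / 4 * ((a1 ^+ 2 - A ^+ 2) * (a2 ^+ 2 - A ^+ 2))).
have A0 : 0 < A by lra.
have sq (y z : R) : 0 < y -> y < z -> y ^+ 2 < z ^+ 2.
  by move=> y0 yz; rewrite ltr_pXn2r ?nnegrE ?(ltW y0) ?(ltW (lt_trans y0 yz)).
have s10 : 0 < s1.
  have h1 : 0 < m ^+ 2 / 4 by rewrite divr_gt0// exprn_gt0.
  have h2 : 0 < a1 ^+ 2 - A ^+ 2 by rewrite subr_gt0 sq.
  have h3 : 0 < a2 ^+ 2 - A ^+ 2 by rewrite subr_gt0 sq// (lt_trans A2).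
  by rewrite /s1 mulr_gt0// mulr_gt0// mulr_gt0.
pose lo := (a1 - l1) / 2.
apply: (@front_barrier R m k c r theta B v 1 lo A A lo (a1 - l1) a2 al be (Num.min s1 1)) => //.
- by rewrite mul1r.
- by left.
- by rewrite /lo; lra.
- by rewrite /lo; lra.
- by rewrite /lo; lra.
- by rewrite lt_min s10 ltr01.
- by rewrite ge_min lexx orbT.
- move=> a loa aA; have a0 : 0 < a by move: loa; rewrite /lo; lra.
  rewrite mul1r ge_min; apply/orP; left.
  have := arc_radius_below m0 a0 aA A2 a12 (etrans r1 (esym r2)).
  rewrite -(ler_pM2l c2) -/s1 mulrBr rc; exact.
- by lra.
- by rewrite mul1r /lo; lra.
- by rewrite mul1r; lra.
- by move=> y t _ _ _; rewrite mul1r => h; apply: hball; exact: ltW.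
- by lra.
- by rewrite mul1r /lo; lra.
- by move=> y By; rewrite mul1r; exact: hinit.
- by rewrite mul1r.
Unshelve. all: by end_near. Qed.

Lemma outside_limit (R : realType) (m k c r theta a1 a2 l2 al be : R)
    (B : set 'rV[R]_2) (v : 'rV[R]_2 * R -> R) :
  0 < m -> 0 < k -> 0 < c -> 0 < a1 -> a1 < a2 ->
  arc_radius m k a1 = 1 / c -> arc_radius m k a2 = 1 / c ->
  C2theta_domain theta B -> bounded_set B ->
  Omega m k `&` eball 0 r `<=` B -> B `<=` Omega m k ->
  touching_from_below B (- c) v -> {within cyl_bar B, continuous v} ->
  0 < l2 -> l2 < a2 - a1 -> al < be ->
  (forall x t, closure B x -> 0 <= t -> al <= v (x, t)) ->
  (forall x t, closure B x -> 0 < t -> v (x, t) < be -> eball 0 r x) ->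
  (forall x, closure B x -> 0 < front m k (a1 + l2) 0 `|x1 x| (x2 x) -> be <= v (x, 0)) ->
  forall x, closure B x -> 0 < front m k a1 0 `|x1 x| (x2 x) ->
  exists T, forall t, T <= t -> be <= v (x, t).
Proof.
move=> m0 k0 c0 a10 a12 r1 r2 domB bB sub1 sub2 touch cv l20 l2a ab vlow hball hinit x Bx hx.
have [A [A1 A2 hA]] : exists A, [/\ A < a1 + l2, a1 < A & 0 < front m k A 0 `|x1 x| (x2 x)].
  have cA := @front_continuous_position R m k `|x1 x| (x2 x) a1 m0 a10.
  have H : \forall a \near a1, 0 < front m k a 0 `|x1 x| (x2 x) := cA _ (lt_nbhsr hx).
  have H2 : \forall a \near a1^'+, [/\ a < a1 + l2, a1 < a & 0 < front m k a 0 `|x1 x| (x2 x)].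
    near=> a; split; near: a; [|exact: nbhs_right_gt|by apply: cvg_within; exact: H].
    by apply: nbhs_right_lt; rewrite ltrDl.
  by apply: (@filter_ex _ (a1^'+)) H2; exact: at_right_proper_filter.
have c2 : 0 < c ^+ 2 by rewrite exprn_gt0.
have rc : c ^+ 2 * arc_radius m k a1 ^+ 2 = 1.
  by rewrite r1; field; rewrite gt_eqF.
(* The starting position lies strictly beyond the initial arc, to leave room for the shift, and
   strictly before [a2], to keep the slack positive. *)
pose hi := (a1 + l2 + a2) / 2.
have hi2 : hi < a2 by rewrite /hi; lra.
have Ahi : A < hi by rewrite /hi; lra.
pose s1 := c ^+ 2 * (m ^+ 2 / 4 * ((A ^+ 2 - a1 ^+ 2) * (a2 ^+ 2 - hi ^+ 2))).
have A0 : 0 < A by lra.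
have sq (y z : R) : 0 < y -> y < z -> y ^+ 2 < z ^+ 2.
  by move=> y0 yz; rewrite ltr_pXn2r ?nnegrE ?(ltW y0) ?(ltW (lt_trans y0 yz)).
have s10 : 0 < s1.
  have h1 : 0 < m ^+ 2 / 4 by rewrite divr_gt0// exprn_gt0.
  have h2 : 0 < A ^+ 2 - a1 ^+ 2 by rewrite subr_gt0 sq.
  have h3 : 0 < a2 ^+ 2 - hi ^+ 2 by rewrite subr_gt0 sq// (lt_trans A0).
  by rewrite /s1 mulr_gt0// mulr_gt0// mulr_gt0.
apply: (@front_barrier R m k c r theta B v (-1) A hi A hi (a1 + l2) a1 al be (Num.min s1 1)) => //.
- by rewrite mulN1r.
- by right.
- exact: ltW.
- exact: ltW.
- by rewrite lt_min s10 ltr01.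
- by rewrite ge_min lexx orbT.
- move=> a Aa ahi.
  rewrite mulN1r opprB ge_min; apply/orP; left.
  have := arc_radius_between m0 a10 A2 Aa ahi hi2 (etrans r1 (esym r2)).
  rewrite -(ler_pM2l c2) -/s1 mulrBr rc; exact.
- by rewrite mulN1r; lra.
- by rewrite mulN1r; lra.
- by move=> y t By t0 hv _; exact: hball By t0 hv.
- by lra.
- by rewrite mulN1r /hi; lra.
- by move=> y By; rewrite mulN1r oppr_lt0; exact: hinit.
- by rewrite mulN1r oppr_lt0.
Unshelve. all: by end_near. Qed.

Theorem theorem6p1 (R : realType) (m k c a1 a2 : R) :
  0 < m -> 0 < k ->
  0 < c -> c < (rmin m k)^-1 ->
  0 < a1 -> a1 < a2 ->
  arc_radius m k a1 = 1 / c -> arc_radius m k a2 = 1 / c ->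
  exists2 Rlarge : R, 0 < Rlarge &
    forall (R0 : R), Rlarge <= R0 ->
    forall (theta : R) (Omegat : set 'rV[R]_2),
    0 < theta -> theta < 1 ->
    truncation theta (Omega m k) R0 Omegat ->
    forall (u0 : 'rV[R]_2 -> R) (l1 l2 alpha beta : R)
           (u : 'rV[R]_2 * R -> R),
    C2theta_closure theta (Omega m k) u0 ->
    (forall x nu, frontier (Omega m k) x ->
       outward_unit_normal (Omega m k) x nu ->
       dot (grad_closure (Omega m k) u0 x) nu = 0) ->
    0 < l1 -> l1 < a1 -> 0 < l2 -> l2 < a2 - a1 -> alpha < beta ->
    (forall x, Uarc m k (a1 - l1) x -> u0 x = beta) ->
    (forall x, closure (Omega m k) x -> ~ closure (Uarc m k (a1 + l2)) x ->
       u0 x = alpha) ->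
    (forall x, closure (Omega m k) x -> alpha <= u0 x /\ u0 x <= beta) ->
    unbounded_solution (Omega m k) R0 Omegat c u0 u ->
    (forall x, Uarc m k a1 x -> u (x, t) @[t --> +oo] --> beta) /\
    (forall x, closure (Omega m k) x -> ~ closure (Uarc m k a1) x ->
       u (x, t) @[t --> +oo] --> alpha).
Proof.
move=> m0 k0 c0 _ a10 a12 r1 r2.
have a20 : 0 < a2 := lt_trans a10 a12.
have Rl0 : 0 < `|arc_center m k a2| + 2 * arc_radius m k a2 + 1.
  have := arc_radius_gt0 m0 k0 a20.
  by have := normr_ge0 (arc_center m k a2); lra.
exists (`|arc_center m k a2| + 2 * arc_radius m k a2 + 1) => //.
move=> R0 hR0 theta B _ _ [domB bB sub1 sub2] u0 l1 l2 al be u [[cu0 _ _ _ _] _] _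
  l10 l1a l20 l2a ab u0in u0out u0bd [_ [al' hal'] [cu subsol supsol]].
have R00 : 0 < R0 := lt_le_trans Rl0 hR0.
have hball x : front m k a2 0 `|x1 x| (x2 x) <= 0 -> eball 0 R0 x.
  by move=> /(front_eball m0 k0 a20); rewrite /eball /= => h; exact: lt_le_trans hR0.
have a1l2 : 0 < a1 + l2 by lra.
have subB x : closure B x -> closure (Omega m k) x by exact: closureS.
(* The constant value outside the ball is identified at the point [(R0, 0)], which lies outside both
   the ball and the closure of [U(a1 + l2)]. *)
have halE : al' = al.
  pose z : 'rV[R]_2 := R0 *: evec R 0 + 0.
  have z1 : x1 z = R0 by rewrite /z x1_lin x1_evec0 /x1 mxE mulr1 addr0.
  have z2 : x2 z = 0 by rewrite /z x2_lin x2_evec0 /x2 mxE mulr0 addr0.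
  have Oz : closure (Omega m k) z.
    by apply: subset_closure; rewrite /Omega /= z2 normr0 fprofile_gt0.
  have nz : ~ eball 0 R0 z.
    rewrite /eball /= subr0 enormE z1 z2 expr0n addr0 sqrtr_sqr gtr0_norm// ltxx; exact.
  have [_ h] := hal' z 0 Oz nz (lexx _).
  have nU : ~ closure (Uarc m k (a1 + l2)) z.
    move=> /(closure_Uarc_le m0 k0 a1l2) h1; apply: nz; apply: hball; apply: ltW.
    apply: lt_le_trans h1.
    by apply: front_mono => //; lra.
  by have := u0out z Oz nU; lra.
have uout x t : closure (Omega m k) x -> ~ eball 0 R0 x -> 0 <= t -> u (x, t) = al.
  by move=> Ox nx t0; have [h _] := hal' x t Ox nx t0; rewrite -halE; lra.
have T1 := supersolution_touching supsol.
have T2 := subsolution_touching subsol.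
have cu' : {within cyl_bar B, continuous (fun z => - u z)} by exact: continuous_opp.
have [_ uinit_le _] := subsol; have [_ uinit_ge _] := supsol.
have ulow x t : closure B x -> 0 <= t -> al <= u (x, t).
  apply: (constant_bound m0 k0 domB bB sub1 sub2 T1 cu).
    move=> y s By s0 hv; apply: contrapT => ny.
    by move: hv; rewrite uout ?ltxx//; [exact: subB|exact: ltW].
  by move=> y By; apply: le_trans (uinit_ge y By); have [] := u0bd y (subB y By).
have uupp x t : closure B x -> 0 <= t -> u (x, t) <= be.
  move=> Bx t0; rewrite -lerN2; move: x t Bx t0.
  apply: (constant_bound m0 k0 domB bB sub1 sub2 T2 cu').
    move=> y s By s0 hv; apply: contrapT => ny.
    move: hv; rewrite uout//; [|exact: subB|exact: ltW].
    by rewrite ltrN2; move: ab; lra.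
  move=> y By; rewrite lerN2; apply: le_trans (uinit_le y By) _.
  by have [] := u0bd y (subB y By).
split=> x.
  move=> /(Uarc_front m0 k0 _ a10)[Ox hx].
  have Bx : closure B x.
    apply: subset_closure; apply: sub1; split=> //; apply: hball; apply: ltW.
    by apply: lt_trans hx; apply: front_mono => //; lra.
  have [T HT] : exists T, forall t, T <= t -> be <= u (x, t).
    apply: (inside_limit m0 k0 c0 a10 a12 r1 r2 domB bB sub1 sub2 T1 cu l10 l1a ab
      ulow hball _ Bx hx) => y By hy.
    apply: le_trans (uinit_ge y By).
    have a1l1 : 0 < a1 - l1 by lra.
    (* The datum is prescribed on a subset of the open set [Omega]; continuity extends it to the
       points of [closure B] on the boundary. *)
    rewrite (within_closure_eq (A := Uarc m k (a1 - l1)) (b := be) cu0) //; last 2 first.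
    - exact: subB.
    - by apply: closure_Uarc_front => //; [exact: subB|exact: ltW].
    by move=> z [Oz _]; exact: subset_closure.
  (* [T] may be negative, while the bound [u <= be] is available for nonnegative times only. *)
  apply: (@eventually_eq_cvg _ _ _ (Num.max 0 T)) => t.
  rewrite ge_max => /andP[t0 tT]; apply/eqP; rewrite eq_le HT// andbT.
  exact: uupp.
move=> Ox nU.
have hx : 0 < front m k a1 0 `|x1 x| (x2 x).
  rewrite ltNge; apply/negP => h; apply: nU.
  exact: closure_Uarc_front.
have [bx|nx] := pselect (eball 0 R0 x); last first.
  by apply: (@eventually_eq_cvg _ _ _ 0) => t t0; exact: uout.
have Bx := closure_truncation sub1 Ox bx.
(* For [- u] the roles of the two values are exchanged: [- be] is the lower bound and [- al] the
   level to be reached. *)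
have [T HT] : exists T, forall t, T <= t -> - al <= - u (x, t).
  apply: (outside_limit (al := - be) m0 k0 c0 a10 a12 r1 r2 domB bB sub1 sub2 T2 cu' l20 l2a
      _ _ _ _ Bx hx).
  - by rewrite ltrN2.
  - by move=> y t By t0; rewrite lerN2; exact: uupp.
  - move=> y t By t0 hv; apply: contrapT => ny.
    by move: hv; rewrite uout ?ltxx//; [exact: subB|exact: ltW].
  - move=> y By hy; rewrite lerN2; apply: le_trans (uinit_le y By) _.
    rewrite u0out//; first exact: subB.
    by move=> /(closure_Uarc_le m0 k0 a1l2); rewrite leNgt hy.
apply: (@eventually_eq_cvg _ _ _ (Num.max 0 T)) => t.
rewrite ge_max => /andP[t0 tT]; apply/eqP; rewrite eq_le ulow// andbT.
by rewrite -lerN2; exact: HT.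
Qed.
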